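(* Let $(G_m^n)_{n\ge n_0}$ be a model from the $PA$-class with constants $A,B$, and suppose that for some constant $D>0$, for all distinct vertices $i,j\in\{1,\dots,n\}$, $$\mathsf P\left(d_i^{n+1}=d_i^n+1,\ d_j^{n+1}=d_j^n+1\mid G_m^n\right)=e_{ij}\frac{D}{mn}+O\left(\frac{d_i^n d_j^n}{n^2}\right),$$ where $e_{ij}$ is the number of edges between $i$ and $j$ in $G_m^n$. Let $C_1(n)$ be the global clustering coefficient of $G_m^n$. Then: (1) if $2A<1$, then whp $C_1(n)\sim\dfrac{3(1-2A)D}{2m(A+B)+\frac{m(m-1)}{2}}$; (2) if $2A=1$, then whp $C_1(n)\sim\dfrac{3D}{\left(2m(A+B)+\frac{m(m-1)}{2}\right)\log n}$; (3) if $2A>1$, then for any $\varepsilon>0$ whp $n^{1-2A-\varepsilon}\le C_1(n)\le n^{1-2A+\varepsilon}$.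
   Context: Definition of the $PA$-class. Fix integers $m\ge 1$ and $n_0\ge 1$. Let $G_m^{n}$ ($n\ge n_0$) be a graph with vertex set $\{1,\dots,n\}$ and $mn$ edges obtained by the following random process (self-loops and multiple edges may or may not occur). The process starts at time $n_0$ from an arbitrary graph $G_m^{n_0}$ with $n_0$ vertices and $mn_0$ edges. At step $n+1$ ($n\ge n_0$), $G_m^{n+1}$ is made from $G_m^n$ by adding a new vertex $n+1$ and $m$ edges connecting this vertex to some $m$ vertices from $\{1,\dots,n,n+1\}$ (chosen at random according to some rule). Let $d_v^n$ be the degree of $v$ in $G_m^n$. The process is a model from the $PA$-class with constants $A,B$ if $$\mathsf P(d_v^{n+1}=d_v^n\mid G_m^n)=1-A\frac{d_v^n}{n}-B\frac1n+O\left(\frac{(d_v^n)^2}{n^2}\right),\quad 1\le v\le n,$$ $$\mathsf P(d_v^{n+1}=d_v^n+1\mid G_m^n)=A\frac{d_v^n}{n}+B\frac1n+O\left(\frac{(d_v^n)^2}{n^2}\right),\quad 1\le v\le n,$$ $$\mathsf P(d_v^{n+1}=d_v^n+j\mid G_m^n)=O\left(\frac{(d_v^n)^2}{n^2}\right),\quad 2\le j\le m,\ 1\le v\le n,$$ $$\mathsf P(d_{n+1}^{n+1}=m+j)=O\left(\frac1n\right),\quad 1\le j\le m,$$ where the implied constants in all $O$-terms (including the one in the claim) depend on the model only. It is a standing assumption that $2mA+B=m$ and $0\le A\le 1$. The global clustering coefficient $C_1(n)$ is the ratio of three times the number of triangles in $G_m^n$ to the number $P_2(n)$ of pairs of adjacent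 edges in $G_m^n$, where $P_2(n)=\sum_d N_n(d)\frac{d(d-1)}{2}$ and $N_n(d)$ is the number of vertices of degree $d$ in $G_m^n$. ''Whp'' (with high probability) means that the probability of the event in question tends to $1$ as $n\to\infty$; $a_n\sim b_n$ means $a_n=(1+o(1))b_n$, so ''whp $X_n\sim b_n$'' means that for some function $\varphi(n)=o(1)$ one has $\mathsf P(|X_n-b_n|\le\varphi(n)b_n)\to1$.
   Formalization: Part (3) is stated for 1/2 < A < 1: at A = 1 it fails, e.g. m = 2, B = -2, two initial vertices with two self-loops each and every new vertex joined to both; all conditions hold for any D > 0, but there is never a triangle, so C_1(n) = 0. *)

(* Defs.v *)
From HB Require Import structures.
From mathcomp Require Import all_boot all_order all_algebra.
From mathcomp Require Import all_classical all_reals all_analysis.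

Set Implicit Arguments.
Unset Strict Implicit.
Unset Printing Implicit Defensive.

Import Order.TTheory GRing.Theory Num.Theory.
Import numFieldNormedType.Exports.

Local Open Scope classical_set_scope.
Local Open Scope ring_scope.

(* A multigraph on n vertices is given by its multiplicity matrix g : 'M[nat]_n.
   The vertex k of {1, ..., n} is the ordinal of value k - 1.  For i != j, g i j
   is the number of edges between i and j; g i i is the number of self-loops at
   i, each of them being one edge and contributing 2 to the degree of i. *)
Definition nedges n (g : 'M[nat]_n) : nat :=
  (\sum_(i < n) \sum_(j < n | i <= j) g i j)%N.

Definition deg n (g : 'M[nat]_n) (v : 'I_n) : nat :=
  ((\sum_(u < n) g v u) + g v v)%N.

Definition multigraph (n k : nat) (g : 'M[nat]_n) : Prop :=
  g^T = g /\ nedges g = k.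

Definition old_vertex n (v : 'I_n) : 'I_n.+1 := widen_ord (leqnSn n) v.

(* The edges of h inside the old vertices are those of g, and the m remaining
   edges of h join the new vertex to old vertices or to itself. *)
Definition growth_step (m n : nat) (g : 'M[nat]_n) (h : 'M[nat]_n.+1) : Prop :=
  [/\ h^T = h,
      forall i j : 'I_n, h (old_vertex i) (old_vertex j) = g i j &
      (\sum_(u < n.+1) h ord_max u)%N = m].

(* A triangle is a choice of three edges joining three distinct vertices
   pairwise, so parallel edges are counted with their multiplicity, as they are
   in the number P_2 of pairs of adjacent edges. *)
Definition ntriangles n (g : 'M[nat]_n) : nat :=
  (\sum_(i < n) \sum_(j < n | i < j) \sum_(k < n | j < k)
     g i j * g j k * g i k)%N.

Definition ndeg n (g : 'M[nat]_n) (d : nat) : nat := #|[pred v | deg g v == d]|.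

(* The sum over d stops at the maximum degree, past which ndeg g d = 0. *)
Definition npaths2 n (g : 'M[nat]_n) : nat :=
  (\sum_(0 <= d < (\max_(v < n) deg g v).+1) ndeg g d * 'C(d, 2))%N.

Definition global_clustering (R : realType) n (g : 'M[nat]_n) : R :=
  3 * (ntriangles g)%:R / (npaths2 g)%:R.

Section RandomGraphProcess.
Context {d : measure_display} {T : measurableType d} {R : realType}.
Variable P : probability T R.
Variable G : forall n, T -> 'M[nat]_n.
Implicit Types (m n : nat) (A B D : R).

(* G n is relevant for n0 <= n only.  It takes finitely many values, so that
   measurability amounts to measurability of its fibers. *)
Definition growth_process m (n0 : nat) : Prop :=
  [/\ forall n (g : 'M[nat]_n), (n0 <= n)%N -> measurable [set w | G n w = g],
      exists2 g0 : 'M[nat]_n0, multigraph (m * n0) g0 & forall w, G n0 w = g0 &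
      forall n w, (n0 <= n)%N -> growth_step m (G n w) (G n.+1 w)].

Definition possible n (g : 'M[nat]_n) : Prop := P [set w | G n w = g] != 0%E.

(* Conditional probability of E given that G n = g, meaningful when g is a
   possible value of G n. *)
Definition cprob n (g : 'M[nat]_n) (E : set T) : R :=
  fine (P (E `&` [set w | G n w = g])) / fine (P [set w | G n w = g]).

Definition deg_incr n (v : 'I_n) (j : nat) : set T :=
  [set w | deg (G n.+1 w) (old_vertex v) = (deg (G n w) v + j)%N].

(* In the O-terms below, the constant C depends on the process only: it is
   uniform in n, in the value g of G n, and in the vertices and increments. *)
Record PA_class m A B : Prop := {
  PA_incr0 : exists C : R, \forall n \near \oo,
    forall g : 'M[nat]_n, possible g -> forall v : 'I_n,
      `| cprob g (deg_incr v 0)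
         - (1 - A * ((deg g v)%:R / n%:R) - B * (1 / n%:R)) |
      <= C * ((deg g v)%:R ^+ 2 / n%:R ^+ 2);
  PA_incr1 : exists C : R, \forall n \near \oo,
    forall g : 'M[nat]_n, possible g -> forall v : 'I_n,
      `| cprob g (deg_incr v 1)
         - (A * ((deg g v)%:R / n%:R) + B * (1 / n%:R)) |
      <= C * ((deg g v)%:R ^+ 2 / n%:R ^+ 2);
  PA_incr_ge2 : exists C : R, \forall n \near \oo,
    forall g : 'M[nat]_n, possible g -> forall (v : 'I_n) (j : nat),
      (2 <= j <= m)%N ->
      cprob g (deg_incr v j) <= C * ((deg g v)%:R ^+ 2 / n%:R ^+ 2);
  PA_new_vertex : exists C : R, \forall n \near \oo,
    forall j : nat, (1 <= j <= m)%N ->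
      fine (P [set w | deg (G n.+1 w) ord_max = (m + j)%N]) <= C * (1 / n%:R)
}.

Definition joint_increment m D : Prop :=
  exists C : R, \forall n \near \oo,
    forall g : 'M[nat]_n, possible g -> forall i j : 'I_n, i != j ->
      `| cprob g (deg_incr i 1 `&` deg_incr j 1)
         - (g i j)%:R * (D / (m%:R * n%:R)) |
      <= C * ((deg g i)%:R * (deg g j)%:R / n%:R ^+ 2).

Definition whp (E : nat -> set T) : Prop := P (E n) @[n --> \oo] --> 1%E.

Definition whp_equiv (X : nat -> T -> R) (b : nat -> R) : Prop :=
  exists2 phi : nat -> R, phi n @[n --> \oo] --> 0 &
    whp (fun n => [set w | `|X n w - b n| <= phi n * b n]).

End RandomGraphProcess.

(* Main.v *)
(* Conditionally on G n, the mean increments of the number T of triangles and of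
   P_2 are D and (2A/n) P_2 + c, up to errors controlled by the degrees divided
   by n.  The O-terms of the PA-class say nothing about a vertex whose degree is
   comparable to n, and the heart of the matter is that for A < 1 there is no
   such vertex.  The deviations of the mean degree increments from (A d_v + B)/n
   add up to minus the mean number of new loops, hence to at most 0: large
   degrees cannot all be fed by their error terms.  For a small th the potential
   sum_v d_v^2/(d_v + th n) therefore grows at rate A/n only.  Multiplied by a
   power n^(-r) with A < r < 1 it is a supermartingale, and the maximal
   inequality bounds it by 1 at all times after k, with a probability that tends
   to 1 with k.  On this event all degrees are at most n^(1-a) for some a > 0.

   Expectations truncated to this event obey closed recursions in n.  They give
   E (T - D n)^2 = O(n^(2-a)), where the error term sum_(i,j) e_ij d_i d_j is
   bounded by the maximal degree times O(n) because each vertex has boundedly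
   many edges to older vertices.  For 2A < 1 and 2A = 1, second moments show that
   P_2 is concentrated around c n/(1-2A) and c n log n respectively.  For 2A > 1,
   bounds on E P_2 and on E 1/(P_2 - c n/(1-2A)) give the upper and
   the lower bounds n^(2A+e) and n^(2A-e) on P_2. *)

Require Import Defs.
From mathcomp Require Import all_boot all_order all_algebra.
From mathcomp Require Import all_classical all_reals all_analysis.
From mathcomp Require Import finmap ring lra zify.

Import Order.TTheory GRing.Theory Num.Theory.
Import numFieldNormedType.Exports.

Local Open Scope classical_set_scope.
Local Open Scope ring_scope.

Set Implicit Arguments.
Unset Strict Implicit.

(** * Real sequences *)

(** The relation [2 m A + B = m] makes the affine rates add up to exactly [m], the number of edges
    of the new vertex, so that what the old vertices miss becomes loops. This ties the unknown error
    terms together. The weight of a vertex in the drift of the potential is the derivative of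
    [d^2 / (d + th n)]. It tends to 1 for large [d], where the potential essentially counts
    half-edges, whose total is known; for small [d] the potential is quadratic and still controls
    the second moment. Truncation is compatible with recursions: the event decreases in time and the
    truncated quantities are nonnegative, so each step may drop the newest condition. A recursion [u
    (n+1) <= (1 + al / n) u n + K n^(r - 1)] yields [O(n^r)] as soon as [al < r]. The loss of a
    small power is harmless except at [2 A = 1], where the target [(n log n)^2] exceeds [n^2] by a
    logarithmic factor only. The mean increment of triangles is [D] because the sum of [e_ij^2] over
    pairs is the number [m n] of edges up to parallel edges and loops; both are therefore followed
    along the process and shown to be negligible. *)

Lemma nearP_oo (Q : nat -> Prop) :
  (\forall n \near \oo, Q n) <-> exists N, forall n, (N <= n)%N -> Q n.
Proof.
split=> [[N _ NQ]|[N NQ]]; first by exists N => n; exact: NQ.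
by exists N.
Qed.

Lemma near_natr_ge (R : realType) (x : R) : \forall n \near \oo, x <= n%:R.
Proof.
exists (Num.truncn x).+1 => // n /= hn.
apply/ltW/(lt_le_trans (truncnS_gt x)).
by rewrite ler_nat.
Qed.

Lemma near_powRN_le (R : realType) (a K e : R) : 0 < a -> 0 < e ->
  \forall n \near \oo, K * n%:R `^ (- a) <= e.
Proof.
move=> a0 e0.
have [K0|K0] := leP K 0.
  apply: nearW => n; apply: (@le_trans _ _ 0); last exact: ltW.
  by rewrite mulr_le0_ge0 ?powR_ge0.
near=> n.
have n0 : (0 : R) < n%:R by rewrite (lt_le_trans ltr01)//; near: n; exact: near_natr_ge.
rewrite powRN ler_pdivrMr ?powR_gt0// mulrC -ler_pdivrMr//.
have -> : K / e = ((K / e) `^ a^-1) `^ a.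
  by rewrite -powRrM mulVf ?gt_eqF// powRr1// ltW ?divr_gt0.
apply: ge0_ler_powR; rewrite ?nnegrE ?powR_ge0 ?ler0n ?(ltW a0)//.
by near: n; exact: near_natr_ge.
Unshelve. all: by end_near. Qed.

Lemma near_ln_le_powR (R : realType) (a K : R) : 0 < a -> 
  \forall n \near \oo, K * ln n%:R <= (n%:R : R) `^ a.
Proof.
move=> a0.
have a20 : 0 < a / 2 by rewrite divr_gt0.
have hK0 := near_powRN_le (2 * K / a) a20 ltr01.
near=> n.
have n1 : (1 : R) <= n%:R by near: n; exact: near_natr_ge.
have n0 : (0 : R) < n%:R by exact: lt_le_trans n1.
have l0 : 0 <= ln (n%:R : R) by exact: ln_ge0.
have hh : (n%:R : R) `^ a = (n%:R : R) `^ (a / 2) * (n%:R : R) `^ (a / 2).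
  by rewrite -powRD ?gt_eqF ?implybT// -splitr.
have hl : (a / 2) * ln (n%:R : R) <= (n%:R : R) `^ (a / 2).
  by rewrite -ln_powR ltW// ln_sublinear// powR_gt0.
have hK : 2 * K / a <= (n%:R : R) `^ (a / 2).
  have : (2 * K / a) * (n%:R : R) `^ (- (a / 2)) <= 1 by near: n.
  by rewrite powRN ler_pdivrMr ?powR_gt0// mul1r.
rewrite hh.
have -> : K * ln (n%:R : R) = (2 * K / a) * ((a / 2) * ln n%:R) by field; rewrite gt_eqF.
apply: (@le_trans _ _ ((n%:R `^ (a / 2)) * (a / 2 * ln n%:R))).
  by apply: ler_wpM2r => //; rewrite mulr_ge0// ltW// divr_gt0.
by apply: ler_wpM2l => //; exact: powR_ge0.
Unshelve. all: by end_near. Qed.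

Lemma ln_succ_bounds (R : realType) (n : nat) : (0 < n)%N ->
  (n.+1%:R : R)^-1 <= ln (n.+1%:R : R) - ln n%:R <= n%:R^-1.
Proof.
move=> n0; have n0R : (0 : R) < n%:R by rewrite ltr0n.
have n1R : (0 : R) < n.+1%:R by rewrite ltr0n.
apply/andP; split.
  have h : -1 < (- (n.+1%:R : R)^-1).
    by rewrite ltrN2 invf_lt1// ltr1n ltnS.
  have := le_ln1Dx h.
  have -> : 1 - (n.+1%:R : R)^-1 = n%:R / n.+1%:R.
    by rewrite -natr1; field; rewrite natr1 gt_eqF.
  by rewrite ln_div ?posrE// -lerN2 opprB opprK.
have h : -1 < (n%:R : R)^-1 by rewrite (lt_trans (ltrN10 R))// invr_gt0.
have := le_ln1Dx h.
have -> : 1 + (n%:R : R)^-1 = n.+1%:R / n%:R by rewrite -natr1; field; rewrite gt_eqF.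
by rewrite ln_div ?posrE.
Qed.

(** The ratio of the two powers is [exp (r (ln (n+1) - ln n))], and [exp x >= 1 + x]. The quadratic
    term is the price of replacing the logarithm by [1 / n], for [r] of either sign. *)
Lemma powR_succ_ge (R : realType) (r : R) (n : nat) : (0 < n)%N ->
  (n%:R : R) `^ r * (1 + r / n%:R - `|r| / n%:R ^+ 2) <= n.+1%:R `^ r.
Proof.
move=> n0; have n0R : (0 : R) < n%:R by rewrite ltr0n.
have n1R : (0 : R) < n.+1%:R by rewrite ltr0n.
have /andP[h1 h2] := ln_succ_bounds R n0.
rewrite /powR !gt_eqF//.
have -> : r * ln n.+1%:R = r * ln n%:R + r * (ln (n.+1%:R : R) - ln n%:R) by ring.
rewrite expRD ler_pM2l ?expR_gt0//.
apply: le_trans (expR_ge1Dx _).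
rewrite -addrA lerD2l.
set dl := ln n.+1%:R - ln n%:R in h1 h2 *.
have hd : `|n%:R^-1 - dl| <= (n%:R ^+ 2)^-1.
  rewrite ger0_norm ?subr_ge0//.
  apply: (@le_trans _ _ (n%:R^-1 - n.+1%:R^-1)); first by rewrite lerD2l lerN2.
  rewrite -natr1 -subr_ge0.
  have -> : (n%:R ^+ 2)^-1 - ((n%:R : R)^-1 - (n%:R + 1)^-1) = (n%:R ^+ 2 * (n%:R + 1))^-1.
    by field; rewrite natr1 ?gt_eqF.
  by rewrite invr_ge0 mulr_ge0 ?exprn_ge0// ?ltW// natr1.
have : `|r| * `|n%:R^-1 - dl| <= `|r| / n%:R ^+ 2 by exact: ler_wpM2l.
rewrite -normrM => /(le_trans (ler_norm _)).
by rewrite mulrBr => h; rewrite lerBlDr addrC -lerBlDr.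
Qed.

(** Because [f >= 0], the multiples [M v] with [M >= 1] are still supersolutions; [M] is chosen to
    dominate [u] at the initial time, and [a >= 0] propagates the domination. *)
Lemma comparison (R : realType) (u v a f : nat -> R) :
  (\forall n \near \oo, [/\ 0 <= a n, 0 < v n, 0 <= f n,
     u n.+1 <= a n * u n + f n & a n * v n + f n <= v n.+1]) ->
  exists2 M : R, 0 <= M & \forall n \near \oo, u n <= M * v n.
Proof.
move=> /nearP_oo[N hN].
exists (Num.max 1 (u N / v N)); first by rewrite le_max ler01.
apply/nearP_oo; exists N => n; elim: n => [|n IH].
  rewrite leqn0 => /eqP N0; rewrite N0 in hN *.
  by have [_ v0 _ _ _] := hN 0%N isT; rewrite -ler_pdivrMr// le_max lexx orbT.
rewrite leq_eqVlt => /orP[/eqP <-|]; last rewrite ltnS => Nn.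
  by have [_ v0 _ _ _] := hN N (leqnn _); rewrite -ler_pdivrMr// le_max lexx orbT.
have [a0 v0 f0 hu hv] := hN n Nn.
apply: (le_trans hu); set M := Num.max _ _ in IH *.
have M1 : 1 <= M by rewrite le_max lexx.
apply: (@le_trans _ _ (M * (a n * v n + f n))); last first.
  by apply: ler_wpM2l => //; exact: le_trans M1.
rewrite mulrDr lerD//; last by rewrite ler_peMl.
by rewrite mulrCA; apply: ler_wpM2l => //; exact: IH.
Qed.

(** The supersolution is [M0 n^r]: it outgrows the rate [al] by [(r - al) M0 n^(r - 1)]. Half of
    this surplus pays for [K n^(r - 1)], which fixes [M0], and half for the second-order error of
    [powR_succ_ge]. *)
Lemma powR_comparison (R : realType) (u : nat -> R) (al r K : R) :
  al < r -> 
  (\forall n \near \oo, u n.+1 <= (1 + al / n%:R) * u n + K * n%:R `^ (r - 1)) ->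
  exists2 M : R, 0 <= M & \forall n \near \oo, u n <= M * n%:R `^ r.
Proof.
move=> alr hu.
pose L := Num.max K 0.
have L0 : 0 <= L by rewrite le_max lexx orbT.
pose M0 := 2 * L / (r - al) + 1.
have M00 : 0 < M0 by rewrite ltr_wpDl// divr_ge0 ?mulr_ge0 ?subr_ge0 ?(ltW alr).
pose v (n : nat) := M0 * n%:R `^ r; pose a (n : nat) := 1 + al / n%:R.
pose f (n : nat) := L * n%:R `^ (r - 1).
have /comparison[M M_ge0 hM] : \forall n \near \oo, [/\ 0 <= a n, 0 < v n, 0 <= f n,
     u n.+1 <= a n * u n + f n & a n * v n + f n <= v n.+1].
  near=> n.
  have n1 : (1 : R) <= n%:R by near: n; exact: near_natr_ge.
  have n0 : (0 : R) < n%:R by exact: lt_le_trans n1.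
  rewrite /a /v /f; split.
  - have : `|al / n%:R| <= 1.
      rewrite normrM (ger0_norm (x := n%:R^-1)) ?invr_ge0 ?(ltW n0)//.
      rewrite ler_pdivrMr// mul1r; near: n; exact: near_natr_ge.
    by rewrite ler_norml; lra.
  - by rewrite mulr_gt0// powR_gt0.
  - by rewrite mulr_ge0// powR_ge0.
  - apply: (@le_trans _ _ ((1 + al / n%:R) * u n + K * n%:R `^ (r - 1))); first by near: n.
    by rewrite lerD2l ler_wpM2r ?powR_ge0// le_max lexx.
  - have n0' : (0 < n)%N by rewrite -(ltr0n R).
    apply: (@le_trans _ _ (M0 * (n%:R `^ r * (1 + r / n%:R - `|r| / n%:R ^+ 2)))); last first.
      by rewrite ler_pM2l// powR_succ_ge.
    have -> : n%:R `^ (r - 1) = n%:R `^ r / n%:R :> R.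
      by rewrite powRB ?(gt_eqF n0) ?implybT// powRr1// ltW.
    have p0 : 0 < (n%:R : R) `^ r by rewrite powR_gt0.
    have -> : (1 + al / n%:R) * (M0 * n%:R `^ r) + L * (n%:R `^ r / n%:R) =
      (n%:R `^ r) * (M0 * (1 + al / n%:R) + L / n%:R) by ring.
    rewrite mulrCA ler_pM2l//.
    have h1 : 2 * `|r| / (r - al) <= n%:R by near: n; exact: near_natr_ge.
    have d0 : 0 < r - al by rewrite subr_gt0.
    rewrite ler_pdivrMr// in h1.
    rewrite -subr_ge0.
    have -> : M0 * (1 + r / n%:R - `|r| / n%:R ^+ 2) - (M0 * (1 + al / n%:R) + L / n%:R) =
      (M0 * (n%:R * (r - al) - `|r|) - L * n%:R) / n%:R ^+ 2.
      by field; rewrite gt_eqF.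
    rewrite divr_ge0 ?exprn_ge0 ?(ltW n0)// subr_ge0.
    apply: (@le_trans _ _ (M0 * (n%:R * (r - al) / 2))); last first.
      by rewrite ler_pM2l//; lra.
    rewrite mulrC.
    have -> : M0 * (n%:R * (r - al) / 2) = n%:R * (M0 * (r - al) / 2) by ring.
    rewrite ler_pM2l// /M0 mulrDl divfK ?gt_eqF//; lra.
exists (M * M0); first by rewrite mulr_ge0// ltW.
by near=> n; rewrite -mulrA; near: n.
Unshelve. all: by end_near. Qed.

Lemma powR1D (R : realType) n (y : R) : (0 < n)%N -> (n%:R : R) `^ (1 + y) = n%:R * n%:R `^ y.
Proof. by move=> n_gt0; rewrite powRD ?powRr1 // pnatr_eq0 -lt0n n_gt0 implybT. Qed.

Lemma powR2D (R : realType) n (y : R) : (0 < n)%N -> (n%:R : R) `^ (2 + y) = n%:R ^+ 2 * n%:R `^ y.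
Proof.
move=> n_gt0; rewrite powRD; last by rewrite pnatr_eq0 -lt0n n_gt0 implybT.
by rewrite powR_mulrn.
Qed.

Lemma powRN_le (R : realType) n (x y : R) : (0 < n)%N -> x <= y -> (n%:R : R) `^ (- y) <= n%:R `^ (- x).
Proof. by move=> n_gt0 xy; rewrite ler_powR ?ler1n // lerN2. Qed.

Lemma cvg_powRN (R : realType) (a : R) : 0 < a -> (n%:R : R) `^ (- a) @[n --> \oo] --> 0.
Proof.
move=> a0; apply/cvgrPdist_le => e e0.
have /nearP_oo[N hN] := near_powRN_le 1 a0 e0.
apply/nearP_oo; exists N => n Nn.
by rewrite sub0r normrN ger0_norm ?powR_ge0 // -[leLHS]mul1r; exact: hN.
Qed.

Lemma near_ln_ge (R : realType) (x : R) : \forall n \near \oo, x <= ln (n%:R : R).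
Proof.
have /nearP_oo[N hN] := near_natr_ge (expR x).
apply/nearP_oo; exists N => n Nn; rewrite -(expRK x) ler_ln ?posrE ?expR_gt0 ?hN //.
exact: lt_le_trans (expR_gt0 x) (hN n Nn).
Qed.

Lemma cvg_ln_powRN (R : realType) (a : R) : 0 < a ->
  (ln (n%:R : R)) `^ (- a) @[n --> \oo] --> (0 : R).
Proof.
move=> a0; apply/cvgrPdist_le => e e0.
have /nearP_oo[N hN] := near_ln_ge (e^-1 `^ a^-1).
apply/nearP_oo; exists N => n Nn; have h := hN n Nn.
have p0 : 0 < e^-1 `^ a^-1 by rewrite powR_gt0 // invr_gt0.
rewrite sub0r normrN ger0_norm ?powR_ge0 // powRN -[e]invrK lef_pV2 ?posrE ?invr_gt0 //.
  have -> : e^-1 = (e^-1 `^ a^-1) `^ a.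
    by rewrite -powRrM mulVf ?gt_eqF // powRr1 // invr_ge0 ltW.
  by rewrite ge0_ler_powR ?nnegrE ?(ltW a0) ?(ltW p0) // (le_trans (ltW p0)).
by rewrite powR_gt0 // (lt_le_trans p0).
Qed.

(** The condition [f2 <= 1/2] keeps [Y] above [y / 2], which costs the factor 2. *)
Lemma ratio_bound (R : realType) (X Y x y f1 f2 : R) : 0 < x -> 0 < y ->
  `|X - x| <= f1 * x -> `|Y - y| <= f2 * y -> f2 <= 2^-1 ->
  `|3 * X / Y - 3 * x / y| <= 2 * (f1 + f2) * (3 * x / y).
Proof.
move=> x0 y0 hX hY f2h.
have Y0 : y / 2 <= Y.
  have : f2 * y <= y / 2 by rewrite mulrC ler_pM2l.
  by move: hY; rewrite ler_norml => /andP[h _]; lra.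
have Yp : 0 < Y by lra.
have -> : 3 * X / Y - 3 * x / y = 3 / (Y * y) * ((X - x) * y - x * (Y - y)).
  by field; rewrite !gt_eqF.
have c0 : 0 < 3 / (Y * y) by rewrite divr_gt0 // mulr_gt0.
rewrite normrM (gtr0_norm c0).
have h : `|(X - x) * y - x * (Y - y)| <= (f1 + f2) * (x * y).
  rewrite (le_trans (ler_normB _ _)) // !normrM (gtr0_norm x0) (gtr0_norm y0).
  have := ler_wpM2r (ltW y0) hX; have := ler_wpM2l (ltW x0) hY; lra.
have f0 : 0 <= f1 + f2.
  rewrite addr_ge0 //.
    by rewrite -(pmulr_lge0 f1 x0); exact: le_trans hX.
  by rewrite -(pmulr_lge0 f2 y0); exact: le_trans hY.
apply: (le_trans (ler_wpM2l (ltW c0) h)).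
have -> : 3 / (Y * y) * ((f1 + f2) * (x * y)) = (f1 + f2) * (3 * x) * Y^-1 by field; rewrite !gt_eqF.
have -> : 2 * (f1 + f2) * (3 * x / y) = (f1 + f2) * (3 * x) * (y / 2)^-1 by field; rewrite gt_eqF.
apply: ler_wpM2l; first by rewrite mulr_ge0 // mulr_ge0 // ltW.
by rewrite lef_pV2 ?posrE // divr_gt0.
Qed.

(** * Growth of multigraphs *)

Definition inc n (h : 'M[nat]_n.+1) (v : 'I_n) : nat := h ord_max (old_vertex v).

Definition prune n (h : 'M[nat]_n.+1) : 'M[nat]_n :=
  \matrix_(i, j) h (old_vertex i) (old_vertex j).

Definition loops n (g : 'M[nat]_n) : nat := (\sum_(v < n) g v v)%N.

(** Twice the number of pairs of parallel edges that are not loops; it measures how far the sum of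
    [e_ij^2] is from the sum of [e_ij]. *)
Definition multiplicity_excess n (g : 'M[nat]_n) : nat :=
  (\sum_(i < n) \sum_(j < n | (i < j)%N) g i j * (g i j).-1)%N.

(** The deterministic invariants of the growth. A vertex added by the process has at most [m] edges
    to older ones; [K] is larger in order to cover the initial graph too. *)
Record valid m K n (g : 'M[nat]_n) : Prop := {
  valid_sym : forall i j, g i j = g j i;
  valid_le : forall i j, (g i j <= K)%N;
  valid_back : forall j : 'I_n, (\sum_(i < n | (i < j)%N) g i j <= K)%N;
  valid_total : (\sum_(v < n) deg g v = 2 * (m * n))%N }.

Lemma sum_pairs_recr n (F : 'I_n.+1 -> 'I_n.+1 -> nat) :
  (\sum_(i < n.+1) \sum_(j < n.+1 | (i < j)%N) F i j =
   \sum_(i < n) \sum_(j < n | (i < j)%N) F (old_vertex i) (old_vertex j)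
   + \sum_(i < n) F (old_vertex i) ord_max)%N.
Proof.
rewrite big_ord_recr /= [X in (_ + X)%N]big1 ?addn0; last first.
  by move=> j /=; rewrite ltnNge -ltnS ltn_ord.
rewrite -big_split /=; apply: eq_bigr => i _.
by rewrite big_mkcond big_ord_recr /= ltn_ord -big_mkcond.
Qed.

Lemma sum_sym_split n (F : 'I_n -> 'I_n -> nat) : (forall i j, F i j = F j i) ->
  (\sum_(i < n) \sum_(j < n) F i j =
   2 * (\sum_(i < n) \sum_(j < n | (i < j)%N) F i j) + \sum_(i < n) F i i)%N.
Proof.
elim: n F => [|n IH] F Fs; first by rewrite !big_ord0.
rewrite sum_pairs_recr big_ord_recr [in RHS]big_ord_recr /=.
under eq_bigr do rewrite big_ord_recr /=.
rewrite big_split /= (IH (fun i j => F (old_vertex i) (old_vertex j))) //.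
rewrite big_ord_recr /= (eq_bigr _ (fun i _ => Fs ord_max (widen_ord (leqnSn n) i))).
rewrite /old_vertex; lia.
Qed.

Lemma npaths2E n (g : 'M[nat]_n) : npaths2 g = (\sum_(v < n) 'C(deg g v, 2))%N.
Proof.
rewrite /npaths2 /ndeg.
under eq_bigr do rewrite -sum1_card big_distrl big_mkcond /=.
rewrite exchange_big /=; apply: eq_bigr => v _.
rewrite (bigD1_seq (deg g v)) ?iota_uniq ?mem_index_iota //=; last first.
  by rewrite ltnS (@leq_bigmax _ (fun v => deg g v)).
rewrite inE eqxx mul1n big1 ?addn0 // => d dv.
by rewrite inE eq_sym (negbTE dv).
Qed.

Section GrowthStep.
Variables (m n : nat) (g : 'M[nat]_n) (h : 'M[nat]_n.+1).
Hypothesis gh : growth_step m g h.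

Lemma growth_step_sym i j : h i j = h j i.
Proof. by case: gh => hT _ _; rewrite -[in LHS]hT mxE. Qed.

Lemma growth_step_old (i j : 'I_n) : h (old_vertex i) (old_vertex j) = g i j.
Proof. by case: gh. Qed.

Lemma prune_growth_step : prune h = g.
Proof. by apply/matrixP => i j; rewrite mxE growth_step_old. Qed.

Lemma sum_inc : (\sum_(v < n) inc h v + h ord_max ord_max = m)%N.
Proof. by case: gh => _ _ <-; rewrite big_ord_recr. Qed.

Lemma deg_old v : deg h (old_vertex v) = (deg g v + inc h v)%N.
Proof.
rewrite /deg big_ord_recr /= growth_step_old (growth_step_sym _ ord_max) -/(inc h v).
under eq_bigr do rewrite growth_step_old.
by rewrite addnAC.
Qed.

Lemma deg_new : deg h ord_max = (m + h ord_max ord_max)%N.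
Proof. by case: gh => _ _; rewrite /deg => ->. Qed.

Lemma inc_le v : (inc h v <= m)%N.
Proof. by rewrite -sum_inc (bigD1 v) //= -addnA leq_addr. Qed.

Lemma new_loops_le : (h ord_max ord_max <= m)%N.
Proof. by rewrite -sum_inc leq_addl. Qed.

Lemma loops_growth_step : loops h = (loops g + h ord_max ord_max)%N.
Proof.
rewrite /loops big_ord_recr /=; congr addn.
by apply: eq_bigr => v _; exact: growth_step_old.
Qed.

Lemma multiplicity_excess_growth_step : multiplicity_excess h =
  (multiplicity_excess g + \sum_(v < n) inc h v * (inc h v).-1)%N.
Proof.
rewrite /multiplicity_excess sum_pairs_recr; congr addn.
  by apply: eq_bigr => i _; apply: eq_bigr => j _; rewrite growth_step_old.
by apply: eq_bigr => i _; rewrite growth_step_sym.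
Qed.

Lemma ntriangles_growth_step : ntriangles h = (ntriangles g +
  \sum_(i < n) \sum_(j < n | (i < j)%N) g i j * (inc h i * inc h j))%N.
Proof.
rewrite /ntriangles sum_pairs_recr [X in (_ + X)%N]big1 ?addn0; last first.
  move=> i _; rewrite big_pred0 // => k.
  by apply/negbTE; rewrite -leqNgt -ltnS ltn_ord.
rewrite -big_split /=; apply: eq_bigr => i _.
rewrite -big_split /=; apply: eq_bigr => j ij.
rewrite big_mkcond big_ord_recr /= ltn_ord -big_mkcond /=.
rewrite growth_step_old 2!(growth_step_sym _ ord_max) -/(inc h i) -/(inc h j).
congr addn; last by rewrite mulnAC mulnA.
by apply: eq_bigr => k _; rewrite !growth_step_old.
Qed.

Lemma npaths2_growth_step : npaths2 h = (npaths2 g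
  + \sum_(v < n) (deg g v * inc h v + 'C(inc h v, 2)) + 'C(m + h ord_max ord_max, 2))%N.
Proof.
rewrite !npaths2E big_ord_recr /= deg_new -big_split /=; congr addn.
apply: eq_bigr => v _; rewrite deg_old.
move: (deg g v) (inc h v) => a b.
elim: b => [|b IH]; first by rewrite muln0 !addn0.
by rewrite addnS !binS !bin1 IH; lia.
Qed.

Lemma valid_growth_step K : (m <= K)%N -> valid m K g -> valid m K h.
Proof.
move=> mK [gs gK gb gt]; split.
- exact: growth_step_sym.
- have hmax j : (h ord_max j <= K)%N.
    apply: leq_trans mK; have [_ _ <-] := gh.
    by rewrite (bigD1 j) //= leq_addr.
  move=> i j; have [i' ->|-> //] := unliftP ord_max i.
  have [j' ->|->] := unliftP ord_max j; last by rewrite growth_step_sym.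
  suff e (k : 'I_n) : lift ord_max k = old_vertex k by rewrite !e growth_step_old.
  by apply: val_inj; rewrite /= /bump leqNgt ltn_ord.
- move=> j; have [j' ->|->] := unliftP ord_max j; last first.
    apply: leq_trans mK; rewrite -sum_inc big_mkcond big_ord_recr /= ltnn addn0.
    under eq_bigr do rewrite ltn_ord growth_step_sym.
    exact: leq_addr.
  have -> : lift ord_max j' = old_vertex j'.
    by apply: val_inj; rewrite /= /bump leqNgt ltn_ord.
  apply: leq_trans (gb j'); rewrite big_mkcond big_ord_recr /= -big_mkcond /=.
  rewrite ltnNge (ltnW (ltn_ord j')) addn0.
  by under eq_bigr do rewrite growth_step_old.
rewrite big_ord_recr /= deg_new.
under eq_bigr do rewrite deg_old.
rewrite big_split /= gt; move: sum_inc; set a := (\sum_(i < n) inc h i)%N.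
by move: a (h ord_max ord_max) => a b; clear; nia.
Qed.

End GrowthStep.

(** The initial graph is arbitrary: an entry is at most the number [m n] of edges, and a column sum
    at most [n] times as much. *)
Lemma valid_multigraph m K n (g : 'M[nat]_n) :
  (n * (m * n) <= K)%N -> multigraph (m * n) g -> valid m K g.
Proof.
move=> nK [gT ge].
have gs i j : g i j = g j i by rewrite -[in LHS]gT mxE.
have ne : nedges g = ((\sum_(i < n) \sum_(j < n | (i < j)%N) g i j) + loops g)%N.
  rewrite /nedges /loops -big_split /=; apply: eq_bigr => i _.
  rewrite (bigD1 i) //= addnC; congr addn.
  by apply: eq_bigl => j; rewrite ltn_neqAle eq_sym andbC.
have tot : (\sum_(v < n) deg g v = 2 * (m * n))%N.
  rewrite /deg big_split /= (sum_sym_split gs) -ge ne -/(loops g) -addnA addnn.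
  by rewrite mulnDr [(2 * loops g)%N]mul2n.
have [n0|n0] := posnP n.
  by subst n; split => //; case.
have gle i j : (g i j <= m * n)%N.
  rewrite -ge ne; wlog ij : i j / (i <= j)%N.
    by move=> H; case/orP: (leq_total i j) => [/H//|/H]; rewrite gs.
  move: ij; rewrite leq_eqVlt => /orP[/eqP/val_inj <-|ij].
    by rewrite /loops [X in (_ + X)%N](bigD1 i) //= addnCA leq_addr.
  by rewrite (bigD1 i) //= (bigD1 j) //= -!addnA leq_addr.
split => //.
  by move=> i j; apply: leq_trans (gle i j) (leq_trans _ nK); rewrite leq_pmull.
move=> j; apply: leq_trans nK; rewrite big_mkcond /=.
apply: (@leq_trans (\sum_(i < n) m * n)); last by rewrite sum_nat_const card_ord.
by apply: leq_sum => i _; case: ifP.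
Qed.

Lemma valid_pairs m K n (g : 'M[nat]_n) : valid m K g ->
  (\sum_(i < n) \sum_(j < n | (i < j)%N) g i j + loops g = m * n)%N.
Proof.
case=> gs _ _; rewrite /deg big_split /= (sum_sym_split gs) -/(loops g).
by rewrite -addnA addnn -mul2n -mulnDr => /eqP; rewrite eqn_pmul2l // => /eqP.
Qed.

(** * One-step drifts *)

Definition moment (R : realType) p n (g : 'M[nat]_n) : R :=
  \sum_(v < n) (deg g v)%:R ^+ p.

Definition edge_product (R : realType) n (g : 'M[nat]_n) : R :=
  \sum_(i < n) \sum_(j < n | (i < j)%N) (g i j)%:R * ((deg g i)%:R * (deg g j)%:R).

(* The summand is of order d^2 / n for degrees d that are small compared with
   n, and of order d for the others. *)
Definition lyapunov (R : realType) (th : R) n (g : 'M[nat]_n) : R :=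
  \sum_(v < n) (deg g v)%:R ^+ 2 / ((deg g v)%:R + th * n%:R).

(** Abstracts the conditional expectation given [G n = g]: a positive normalized linear functional
    of the next graph, with the consequences of the hypotheses on the model. In [step_le] only
    growth steps are compared, so that [E] is supported on them. *)
Record step_law (R : realType) (m : nat) (A B C D : R) n (g : 'M[nat]_n)
    (E : ('M[nat]_n.+1 -> R) -> R) : Prop := {
  step_le : forall F F', (forall h, growth_step m g h -> F h <= F' h) -> E F <= E F';
  step_lin : forall a F F', E (fun h => a * F h + F' h) = a * E F + E F';
  step_one : E (fun=> 1) = 1;
  step_mean : forall v,
    `|E (fun h => (inc h v)%:R) - (A * (deg g v)%:R + B) / n%:R|
    <= C * ((deg g v)%:R ^+ 2 / n%:R ^+ 2);
  step_multi : forall v,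
    E (fun h => (1 < inc h v)%N%:R) <= C * ((deg g v)%:R ^+ 2 / n%:R ^+ 2);
  step_joint : forall i j, i != j ->
    `|E (fun h => ((inc h i == 1%N) && (inc h j == 1%N))%:R)
      - (g i j)%:R * (D / (m%:R * n%:R))|
    <= C * ((deg g i)%:R * (deg g j)%:R / n%:R ^+ 2) }.

Lemma bin2R (R : realType) (k : nat) : 2 * ('C(k, 2))%:R = k%:R * (k%:R - 1) :> R.
Proof.
elim: k => [|k IH]; first by rewrite bin0n mulr0 mul0r.
by rewrite binS bin1 natrD mulrDr IH -natr1; ring.
Qed.

(** Taylor expansion of [u^2 / (u + s) = u - s + s^2 / (u + s)]: the factor of [y] is the derivative
    at [u], and the second derivative [2 s^2 / (u + s)^3] is at most [2 / s]. *)
Lemma lyapunov_increment (R : realType) (u y s : R) : 0 <= u -> 0 <= y -> 0 < s ->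
  (u + y) ^+ 2 / (u + y + s) <=
  u ^+ 2 / (u + s) + y * (1 - s ^+ 2 / (u + s) ^+ 2) + y ^+ 2 / s.
Proof.
move=> u0 y0 s0; rewrite -subr_ge0.
have us0 : 0 < u + s by lra.
have uys0 : 0 < u + y + s by lra.
have -> : u ^+ 2 / (u + s) + y * (1 - s ^+ 2 / (u + s) ^+ 2) + y ^+ 2 / s
    - (u + y) ^+ 2 / (u + y + s) =
  y ^+ 2 * ((u + s) ^+ 2 * (u + y + s) - s ^+ 3) / (s * (u + s) ^+ 2 * (u + y + s)).
  by field; rewrite !gt_eqF.
apply: divr_ge0; last by rewrite !mulr_ge0 ?exprn_ge0 // ltW.
apply: mulr_ge0; first exact: sqr_ge0.
rewrite subr_ge0 (exprSr s 2); apply: ler_pM => //; rewrite ?exprn_ge0 ?(ltW s0) //; last by lra.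
by rewrite ler_sqr ?nnegrE ?(ltW us0) ?(ltW s0) //; lra.
Qed.

Section Drift.
Variables (R : realType) (m K : nat) (A B C D : R) (n : nat) (g : 'M[nat]_n).
Variable E : ('M[nat]_n.+1 -> R) -> R.
Hypothesis m_gt0 : (0 < m)%N.
Hypothesis n_gt0 : (0 < n)%N.
Hypothesis AB : 2 * m%:R * A + B = m%:R.
Hypothesis A01 : 0 <= A <= 1.
Hypothesis C_gt0 : 0 < C.
Hypothesis gv : valid m K g.
Hypothesis Eg : step_law m A B C D g E.

Let d (v : 'I_n) : R := (deg g v)%:R.
Let x (h : 'M[nat]_n.+1) v : R := (inc h v)%:R.
Let l (h : 'M[nat]_n.+1) : R := (h ord_max ord_max)%:R.
Let mu v := E (fun h => x h v).
Let delta v := mu v - (A * d v + B) / n%:R.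

Let n0R : 0 < n%:R :> R. Proof. by rewrite ltr0n. Qed.
Let m0R : 0 < m%:R :> R. Proof. by rewrite ltr0n. Qed.
Let d_ge0 v : 0 <= d v. Proof. exact: ler0n. Qed.
Let x_ge0 h v : 0 <= x h v. Proof. exact: ler0n. Qed.

Lemma step_eq F F' : (forall h, growth_step m g h -> F h = F' h) -> E F = E F'.
Proof. by move=> FF; apply: le_anti; rewrite !(step_le Eg) // => h gh; rewrite FF. Qed.

Lemma step_zero : E (fun=> 0) = 0.
Proof.
have := step_lin Eg (-1) (fun=> 1) (fun=> 1); rewrite (step_one Eg).
by under step_eq do rewrite mulr1 addrC subrr; rewrite mulN1r addrC subrr.
Qed.

Lemma stepD F F' : E (fun h => F h + F' h) = E F + E F'.
Proof. by have := step_lin Eg 1 F F'; under step_eq do rewrite mul1r; rewrite mul1r. Qed.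

Lemma stepZ a F : E (fun h => a * F h) = a * E F.
Proof.
have := step_lin Eg a F (fun=> 0); under step_eq do rewrite addr0.
by rewrite step_zero addr0.
Qed.

Lemma step_cst a : E (fun=> a) = a.
Proof. by have := stepZ a (fun=> 1); under step_eq do rewrite mulr1; rewrite (step_one Eg) mulr1. Qed.

Lemma stepB F F' : E (fun h => F h - F' h) = E F - E F'.
Proof.
under step_eq do rewrite -mulN1r.
by rewrite stepD stepZ mulN1r.
Qed.

Lemma step_sum (I : Type) (s : seq I) (Q : pred I) (F : I -> 'M[nat]_n.+1 -> R) :
  E (fun h => \sum_(i <- s | Q i) F i h) = \sum_(i <- s | Q i) E (F i).
Proof.
elim: s => [|i s IH].
  by under step_eq do rewrite big_nil; rewrite step_zero big_nil.
rewrite big_cons -IH; case: ifP => Qi; under step_eq do rewrite big_cons Qi //.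
  by rewrite stepD.
by [].
Qed.

Lemma step_ge0 F : (forall h, growth_step m g h -> 0 <= F h) -> 0 <= E F.
Proof. by move=> F0; rewrite -(step_cst 0); exact: (step_le Eg). Qed.

Lemma sum_deg : \sum_(v < n) d v = 2 * (m%:R * n%:R).
Proof. by rewrite /d -natr_sum (valid_total gv) natrM natrM. Qed.

Lemma deg_le v : d v <= 2 * (m%:R * n%:R).
Proof. by rewrite -sum_deg (bigD1 v) //= lerDl sumr_ge0. Qed.

Lemma sum_incR h : growth_step m g h -> \sum_(v < n) x h v + l h = m%:R.
Proof. by move=> gh; rewrite -[in RHS](sum_inc gh) natrD natr_sum. Qed.

Lemma delta_le v : `|delta v| <= C * (d v ^+ 2 / n%:R ^+ 2).
Proof. exact: step_mean Eg v. Qed.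

(** The degrees add up to [2 m n], so [AB] says precisely that the affine rates share out the [m]
    new edges. *)
Lemma sum_affine : \sum_(v < n) (A * d v + B) / n%:R = m%:R.
Proof.
rewrite -mulr_suml big_split /= -mulr_sumr sum_deg sumr_const card_ord -mulr_natr.
have -> : B = m%:R - 2 * m%:R * A by apply/eqP; rewrite eq_sym subr_eq addrC AB.
by field; rewrite gt_eqF.
Qed.

Lemma muE v : mu v = (A * d v + B) / n%:R + delta v.
Proof. by rewrite /delta addrC subrK. Qed.

Lemma sum_mu : \sum_(v < n) mu v + E l = m%:R.
Proof. by rewrite -step_sum -stepD -[RHS]step_cst; apply: step_eq => h /sum_incR. Qed.

Lemma sum_delta : \sum_(v < n) delta v = - E l.
Proof.
have := sum_mu; under eq_bigr do rewrite muE; rewrite big_split /= sum_affine.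
by lra.
Qed.

Lemma moment_pow p v : d v ^+ p <= moment R p g.
Proof. by rewrite /moment (bigD1 v) //= lerDl sumr_ge0 // => i _; rewrite exprn_ge0. Qed.

Lemma moment23 : moment R 2 g <= moment R 3 g.
Proof.
apply: ler_sum => v _; rewrite -/(d v) /d; case: (deg g v) => [|k]; first by rewrite !expr0n.
by rewrite exprS ler_peMl ?exprn_ge0 // ler1n.
Qed.

Lemma moment_div p : \sum_(v < n) C * (d v ^+ p / n%:R ^+ 2) = C * (moment R p g / n%:R ^+ 2).
Proof. by rewrite -mulr_sumr -mulr_suml. Qed.

(** By [sum_delta] the mean number of new loops is minus the sum of the deviations [delta] and
    inherits their bounds. *)
Lemma step_new_loops : 0 <= E l <= C * (moment R 2 g / n%:R ^+ 2).
Proof.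
apply/andP; split; first by apply: step_ge0 => h _; exact: ler0n.
rewrite -[E l]opprK -sum_delta -moment_div -sumrN.
by apply: ler_sum => v _; have := delta_le v; rewrite ler_norml; lra.
Qed.

Lemma step_loops :
  E (fun h => (loops h)%:R) <= (loops g)%:R + C * (moment R 2 g / n%:R ^+ 2).
Proof.
have -> : E (fun h => (loops h)%:R) = E (fun h => (loops g)%:R + l h).
  by apply: step_eq => h gh; rewrite (loops_growth_step gh) natrD.
by rewrite stepD step_cst lerD2l; case/andP: step_new_loops.
Qed.

Lemma step_sum_multi :
  0 <= E (fun h => \sum_(v < n) (1 < inc h v)%N%:R) <= C * (moment R 2 g / n%:R ^+ 2).
Proof.
apply/andP; split; first by apply: step_ge0 => h _; rewrite sumr_ge0.
by rewrite step_sum -moment_div; apply: ler_sum => v _; exact: step_multi Eg v.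
Qed.

Lemma step_multiplicity_excess : E (fun h => (multiplicity_excess h)%:R) <=
  (multiplicity_excess g)%:R + m%:R ^+ 2 * (C * (moment R 2 g / n%:R ^+ 2)).
Proof.
apply: (@le_trans _ _ (E (fun h => (multiplicity_excess g)%:R
    + m%:R ^+ 2 * \sum_(v < n) (1 < inc h v)%N%:R))).
  apply: (step_le Eg) => h gh; rewrite (multiplicity_excess_growth_step gh) natrD lerD2l.
  rewrite natr_sum mulr_sumr; apply: ler_sum => v _; rewrite -natrX -natrM ler_nat.
  have := inc_le gh v; case: ltnP => [|+ _]; last by case: (inc h v) => [|[]].
  rewrite muln1 expnS expn1 => _ im; apply: leq_mul => //.
  exact: leq_trans (leq_pred _) im.
rewrite stepD step_cst stepZ lerD2l ler_wpM2l ?exprn_ge0 //.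
by case/andP: step_sum_multi.
Qed.

Lemma npaths2_moment : moment R 2 g = 2 * (npaths2 g)%:R + 2 * (m%:R * n%:R).
Proof.
rewrite -sum_deg npaths2E natr_sum mulr_sumr -big_split /=; apply: eq_bigr => v _.
by rewrite bin2R /d; ring.
Qed.

(** Expansion of the sum of [(d_v - 2 m)^2 >= 0], where [2 m] is the mean degree: [P_2] is smallest
    when all degrees are equal. *)
Lemma npaths2_ge : 2 * (m%:R * n%:R) ^+ 2 <= n%:R * ((npaths2 g)%:R + m%:R * n%:R) :> R.
Proof.
pose t : R := 2 * m%:R.
have : 0 <= \sum_(v < n) (d v - t) ^+ 2.
  by apply: sumr_ge0 => v _; exact: sqr_ge0.
have -> : \sum_(v < n) (d v - t) ^+ 2 = moment R 2 g - 2 * t * (2 * (m%:R * n%:R)) + t ^+ 2 * n%:R.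
  have -> : t ^+ 2 * n%:R = \sum_(v < n) t ^+ 2 by rewrite sumr_const card_ord mulr_natr.
  rewrite -sum_deg mulr_sumr /moment -sumrN -!big_split /=.
  by apply: eq_bigr => v _; rewrite -/(d v); ring.
rewrite npaths2_moment /t => h.
have : 0 <= n%:R * (2 * (npaths2 g)%:R + 2 * (m%:R * n%:R)
    - 2 * (2 * m%:R) * (2 * (m%:R * n%:R)) + (2 * m%:R) ^+ 2 * n%:R) :> R.
  by rewrite mulr_ge0.
lra.
Qed.

(** The affine rates contribute [(A sum d_v^2 + 2 m n B) / n], which [sum d_v^2 = 2 P_2 + 2 m n]
    turns into [2 A P_2 / n + 2 m (A + B)]. The pairs of edges at the new vertex give
    [m (m - 1) / 2]. *)
Lemma step_npaths2 :
  `|E (fun h => (npaths2 h)%:R) - ((1 + 2 * A / n%:R) * (npaths2 g)%:R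
     + (2 * m%:R * (A + B) + m%:R * (m%:R - 1) / 2))|
  <= C * (1 + m%:R) ^+ 2 * (moment R 3 g / n%:R ^+ 2).
Proof.
(* The part of the increment due to increments of at least 2 and to new loops; the rest is
   [sum d_v x_v + C(m, 2)]. *)
pose X (h : 'M[nat]_n.+1) : R :=
  \sum_(v < n) ('C(inc h v, 2))%:R + (('C(m + h ord_max ord_max, 2))%:R - ('C(m, 2))%:R).
have EX : 0 <= E X <= C * (m%:R ^+ 2 + 2 * m%:R) * (moment R 2 g / n%:R ^+ 2).
  apply/andP; split.
    apply: step_ge0 => h gh; rewrite addr_ge0 ?sumr_ge0 // subr_ge0 ler_nat.
    by rewrite leq_bin2l // leq_addr.
  apply: (@le_trans _ _ (E (fun h => m%:R ^+ 2 * \sum_(v < n) (1 < inc h v)%N%:R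
     + 2 * m%:R * l h))); last first.
    rewrite stepD !stepZ.
    have /andP[_ h1] := step_sum_multi; have /andP[_ h2] := step_new_loops.
    have := ler_wpM2l (exprn_ge0 2 (ltW m0R)) h1.
    have := ler_wpM2l (mulr_ge0 (ler0n R 2) (ltW m0R)) h2.
    by lra.
  apply: (step_le Eg) => h gh; rewrite /X lerD //.
    rewrite mulr_sumr; apply: ler_sum => v _; rewrite -natrX -natrM ler_nat.
    have := inc_le gh v; case: ltnP => [_ im|+ _]; last by case: (inc h v) => [|[]].
    rewrite muln1 bin2 -divn2 (leq_trans (leq_div _ _)) // expnS expn1.
    by rewrite leq_mul // (leq_trans (leq_pred _)).
  have lm : l h <= m%:R by rewrite ler_nat (new_loops_le gh).
  have l0 : 0 <= l h by exact: ler0n.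
  have := bin2R R (m + h ord_max ord_max); have := bin2R R m; rewrite natrD -/(l h).
  set p := ('C(m, 2))%:R; set q := ('C(_, 2))%:R => e1 e2.
  have h3 : 0 <= l h * (m%:R - l h) by rewrite mulr_ge0 ?subr_ge0.
  have h4 : 0 <= m%:R * l h by rewrite mulr_ge0.
  by lra.
have EP : E (fun h => (npaths2 h)%:R) =
   (npaths2 g)%:R + ('C(m, 2))%:R + \sum_(v < n) d v * mu v + E X.
  rewrite -(step_cst ((npaths2 g)%:R + ('C(m, 2))%:R)).
  under eq_bigr do rewrite -stepZ.
  rewrite -step_sum -!stepD; apply: step_eq => h gh.
  rewrite (npaths2_growth_step gh) !natrD /X.
  have -> : (\sum_(v < n) (deg g v * inc h v + 'C(inc h v, 2)))%:R =
      \sum_(v < n) d v * x h v + \sum_(v < n) ('C(inc h v, 2))%:R.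
    by rewrite natr_sum -big_split /=; apply: eq_bigr => v _; rewrite natrD natrM.
  by ring.
rewrite EP.
have -> : \sum_(v < n) d v * mu v =
    (A * moment R 2 g + B * (2 * (m%:R * n%:R))) / n%:R + \sum_(v < n) d v * delta v.
  rewrite -sum_deg !mulr_sumr -big_split /= mulr_suml -big_split /=.
  by apply: eq_bigr => v _; rewrite muE -/(d v); ring.
have dd : `|\sum_(v < n) d v * delta v| <= C * (moment R 3 g / n%:R ^+ 2).
  rewrite (le_trans (ler_norm_sum _ _ _)) // -moment_div; apply: ler_sum => v _.
  rewrite normrM ger0_norm ?d_ge0 //.
  have -> : C * (d v ^+ 3 / n%:R ^+ 2) = d v * (C * (d v ^+ 2 / n%:R ^+ 2)) by ring.
  by rewrite ler_wpM2l // delta_le.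
rewrite npaths2_moment.
have b2 := bin2R R m.
have M23 : C * (m%:R ^+ 2 + 2 * m%:R) * (moment R 2 g / n%:R ^+ 2) <=
    C * (m%:R ^+ 2 + 2 * m%:R) * (moment R 3 g / n%:R ^+ 2).
  apply: ler_wpM2l; first by rewrite mulr_ge0 ?(ltW C_gt0) // addr_ge0 ?exprn_ge0 ?mulr_ge0.
  by rewrite ler_pM2r ?moment23 // invr_gt0 exprn_gt0.
case/andP: EX => X0 X1.
rewrite [X in `|X|](_ : _ = \sum_(v < n) d v * delta v + E X); last first.
  set p := ('C(m, 2))%:R in b2 *.
  have -> : p = m%:R * (m%:R - 1) / 2 by rewrite -b2; field.
  by field; rewrite gt_eqF.
rewrite (le_trans (ler_normD _ _)) // (ger0_norm X0).
rewrite [leRHS](_ : _ = C * (moment R 3 g / n%:R ^+ 2)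
  + C * (m%:R ^+ 2 + 2 * m%:R) * (moment R 3 g / n%:R ^+ 2)); last by ring.
by apply: lerD => //; exact: le_trans X1 M23.
Qed.

(** The increment is at most [y + 3 m^2] with [y = sum d_v x_v], and [y^2 <= m sum d_v^2 x_v] since
    at most [m] edges reach old vertices. In the mean, [d_v <= 2 m n] bounds [delta] by a multiple
    of [d_v / n], so that it is of the order of the main term. *)
Lemma step_npaths2_sqr :
  E (fun h => ((npaths2 h)%:R - (npaths2 g)%:R) ^+ 2) <=
  2 * m%:R * (A + `|B| + 2 * (C * m%:R)) * (moment R 3 g / n%:R) + 18 * m%:R ^+ 4.
Proof.
pose y (h : 'M[nat]_n.+1) := \sum_(v < n) d v * x h v.
have incb h : growth_step m g h ->
   0 <= ((npaths2 h)%:R - (npaths2 g)%:R : R) <= y h + 3 * m%:R ^+ 2.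
  move=> gh; rewrite (npaths2_growth_step gh).
  have -> : (npaths2 g + \sum_(v < n) (deg g v * inc h v + 'C(inc h v, 2)) +
      'C(m + h ord_max ord_max, 2))%:R - (npaths2 g)%:R =
     y h + (\sum_(v < n) ('C(inc h v, 2)))%:R + ('C(m + h ord_max ord_max, 2))%:R :> R.
    rewrite big_split /= !natrD [X in _ + (X + _)]natr_sum.
    by under eq_bigr do rewrite natrM; rewrite -/(y h); ring.
  have y0 : 0 <= y h.
    by apply: sumr_ge0 => v _; apply: mulr_ge0; [exact: d_ge0|exact: x_ge0].
  apply/andP; split; first by apply: addr_ge0; [apply: addr_ge0|].
  rewrite -addrA lerD2l.
  have : (\sum_(v < n) ('C(inc h v, 2)) + 'C(m + h ord_max ord_max, 2) <= 3 * m ^ 2)%N.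
    have h1 : (\sum_(v < n) ('C(inc h v, 2)) <= m ^ 2)%N.
      apply: (@leq_trans (\sum_(v < n) inc h v * m)).
        apply: leq_sum => v _; rewrite bin2 -divn2 (leq_trans (leq_div _ _)) // leq_mul //.
        exact: leq_trans (leq_pred _) (inc_le gh v).
      rewrite -big_distrl /= expnS expn1 leq_mul2r.
      by rewrite -[X in (_ <= X)%N](sum_inc gh) leq_addr orbT.
    have h2 : ('C(m + h ord_max ord_max, 2) <= 2 * m ^ 2)%N.
      apply: (@leq_trans ('C(m + m, 2))); first by rewrite leq_bin2l // leq_add2l (new_loops_le gh).
      rewrite bin2 addnn -mul2n -divn2 -mulnA mulKn // expnS expn1.
      by rewrite [X in (_ <= X)%N]mulnCA leq_mul2l leq_pred orbT.
    lia.
  by rewrite -(ler_nat R) natrD [leRHS]natrM natrX.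
have ysq h : growth_step m g h -> y h ^+ 2 <= m%:R * \sum_(v < n) d v ^+ 2 * x h v.
  move=> gh; apply: (@le_trans _ _ ((\sum_(v < n) x h v) *
    \sum_(v < n) d v ^+ 2 * x h v)); last first.
    apply: ler_wpM2r; first by apply: sumr_ge0 => v _; rewrite mulr_ge0 ?sqr_ge0 ?x_ge0.
    by rewrite -(sum_incR gh) lerDl.
  (* The Cauchy-Schwarz inequality in the form of Lagrange's identity. *)
  have : 0 <= \sum_(u < n) \sum_(v < n) x h u * x h v * (d u - d v) ^+ 2.
    by apply: sumr_ge0 => u _; apply: sumr_ge0 => v _; rewrite mulr_ge0 ?sqr_ge0 ?mulr_ge0 ?x_ge0.
  have -> : \sum_(u < n) \sum_(v < n) x h u * x h v * (d u - d v) ^+ 2 =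
      2 * ((\sum_(v < n) x h v) * \sum_(v < n) d v ^+ 2 * x h v) - 2 * y h ^+ 2; last by lra.
  rewrite expr2 /y !big_distrl /= !mulr_sumr -sumrB.
  under [RHS]eq_bigr do rewrite !big_distrr /= -sumrB.
  have e u : \sum_(v < n) x h u * x h v * (d u - d v) ^+ 2 =
     \sum_(v < n) (2 * (x h u * (d v ^+ 2 * x h v)) - 2 * (d u * x h u * (d v * x h v)))
     + \sum_(v < n) (x h v * (d u ^+ 2 * x h u) - x h u * (d v ^+ 2 * x h v)).
    by rewrite -big_split /=; apply: eq_bigr => v _; ring.
  under eq_bigr do rewrite e.
  rewrite big_split /= [X in _ + X](_ : _ = 0) ?addr0 //.
  under eq_bigr do rewrite sumrB.
  by rewrite sumrB exchange_big /= subrr.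
apply: (@le_trans _ _ (E (fun h => 2 * m%:R * (\sum_(v < n) d v ^+ 2 * x h v) + 18 * m%:R ^+ 4))).
  apply: (step_le Eg) => h gh; have /andP[p0 p1] := incb h gh; have := ysq h gh.
  set z := (npaths2 h)%:R - _ in p0 p1 *; set q : R := m%:R ^+ 2 in p1 *.
  have -> : m%:R ^+ 4 = q ^+ 2 by rewrite -exprM.
  have y3 : z ^+ 2 <= (y h + 3 * q) ^+ 2 by rewrite ler_sqr ?nnegrE // (le_trans p0).
  have := sqr_ge0 (y h - 3 * q).
  by move: y3; rewrite !expr2; lra.
rewrite stepD step_cst stepZ lerD2r -!mulrA ler_pM2l // ler_pM2l // step_sum.
apply: (@le_trans _ _ (\sum_(v < n) (A + `|B| + 2 * (C * m%:R)) * (d v ^+ 3 / n%:R))); last first.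
  by rewrite -mulr_sumr -mulr_suml.
apply: ler_sum => v _; rewrite stepZ -/(mu v) muE.
have dl : delta v <= C * (2 * m%:R * (d v / n%:R)).
  have := delta_le v; rewrite ler_norml => /andP[_ /le_trans]; apply.
  rewrite ler_pM2l // ler_pdivrMr ?exprn_gt0 //.
  have -> : 2 * m%:R * (d v / n%:R) * n%:R ^+ 2 = d v * (2 * (m%:R * n%:R)) by field; rewrite gt_eqF.
  by rewrite expr2 ler_wpM2l // deg_le.
have d23 : d v ^+ 2 <= d v ^+ 3.
  rewrite /d; case: (deg g v) => [|k]; first by rewrite !expr0n.
  by rewrite [leRHS]exprS ler_peMl ?exprn_ge0 // ler1n.
rewrite mulrDr.
have h1 : d v ^+ 2 * ((A * d v + B) / n%:R) <= (A + `|B|) * (d v ^+ 3 / n%:R).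
  have -> : d v ^+ 2 * ((A * d v + B) / n%:R) = (A * d v ^+ 3 + B * d v ^+ 2) / n%:R by ring.
  rewrite [leRHS]mulrA ler_pM2r ?invr_gt0 // mulrDl lerD2l.
  apply: (@le_trans _ _ (`|B| * d v ^+ 2)); last by rewrite ler_wpM2l.
  by rewrite ler_wpM2r ?exprn_ge0 // ler_norm.
have h2 : d v ^+ 2 * delta v <= 2 * (C * m%:R) * (d v ^+ 3 / n%:R).
  have -> : 2 * (C * m%:R) * (d v ^+ 3 / n%:R) = d v ^+ 2 * (C * (2 * m%:R * (d v / n%:R))) by ring.
  by rewrite ler_wpM2l ?exprn_ge0.
by rewrite [leRHS]mulrDl lerD.
Qed.

(* Every edge is charged to its younger end, and a vertex is the younger end of
   at most K edges. *)
Lemma edge_product_le (X : R) : (forall v, d v <= X) ->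
  edge_product R g <= X * K%:R * (2 * (m%:R * n%:R)).
Proof.
move=> dX; rewrite -sum_deg mulr_sumr.
rewrite /edge_product (exchange_big_dep xpredT) //=; apply: ler_sum => j _.
apply: (@le_trans _ _ (\sum_(i < n | (i < j)%N) (g i j)%:R * (X * d j))).
  by apply: ler_sum => i _; rewrite ler_wpM2l ?ler0n // ler_wpM2r ?ler0n //; exact: dX.
have X0 : 0 <= X by exact: le_trans (dX j).
have -> : X * K%:R * d j = K%:R * (X * d j) by ring.
rewrite -mulr_suml -natr_sum; apply: ler_wpM2r; first by rewrite mulr_ge0 ?ler0n.
by rewrite ler_nat (valid_back gv).
Qed.

Lemma ntriangles_step_le h : growth_step m g h ->
  ((ntriangles g)%:R : R) <= ((ntriangles h)%:R : R) <= (ntriangles g)%:R + K%:R * m%:R ^+ 2.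
Proof.
move=> gh; rewrite (ntriangles_growth_step gh) -natrX -natrM -natrD !ler_nat leq_addr leq_add2l /=.
apply: (@leq_trans (\sum_(i < n) \sum_(j < n) K * (inc h i * inc h j))%N).
  apply: leq_sum => i _; rewrite big_mkcond; apply: leq_sum => j _; case: ifP => // _.
  by rewrite leq_mul2r (valid_le gv) orbT.
under eq_bigr do rewrite -big_distrr -big_distrr /=.
rewrite -big_distrr -big_distrl /= leq_mul // expnS expn1.
by rewrite leq_mul // -[X in (_ <= X)%N](sum_inc gh) leq_addr.
Qed.

Lemma sum_pairs_sqr : \sum_(i < n) \sum_(j < n | (i < j)%N) ((g i j)%:R * (g i j)%:R : R) =
  m%:R * n%:R + (multiplicity_excess g)%:R - (loops g)%:R.
Proof.
rewrite -natrM -(valid_pairs gv) natrD addrAC addrK -natrD -big_split /= natr_sum.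
apply: eq_bigr => i _; rewrite -big_split /= natr_sum; apply: eq_bigr => j _.
by rewrite -natrM; congr (_%:R); case: (g i j) => [|k] //=; rewrite mulnS.
Qed.

(** [J] keeps the pairs with both increments equal to 1, the only ones that the hypothesis on joint
    increments describes. Any other new triangle involves a vertex hit at least twice: the factors
    are 2 for the choice of this end, [K] for the multiplicity of the old edge and [m^2] for the
    increments. *)
Lemma ntriangles_step_bounds h : growth_step m g h ->
  let J := \sum_(i < n) \sum_(j < n | (i < j)%N)
     (g i j)%:R * ((inc h i == 1%N) && (inc h j == 1%N))%:R : R in
  (ntriangles g)%:R + J <= (ntriangles h)%:R /\
  (ntriangles h)%:R <= (ntriangles g)%:R + J
     + 2 * K%:R * m%:R ^+ 2 * \sum_(v < n) (1 < inc h v)%N%:R.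
Proof.
move=> gh J.
have -> : J = (\sum_(i < n) \sum_(j < n | (i < j)%N)
     g i j * ((inc h i == 1%N) && (inc h j == 1%N)))%N%:R.
  rewrite natr_sum; apply: eq_bigr => i _; rewrite natr_sum; apply: eq_bigr => j _.
  by rewrite natrM.
rewrite -natr_sum -natrX -!natrM -!natrD !ler_nat (ntriangles_growth_step gh).
rewrite leq_add2l -addnA leq_add2l; split.
  apply: leq_sum => i _; apply: leq_sum => j _; rewrite leq_mul2l.
  by apply/orP; right; case: eqP => [->|_] //=; case: eqP => [->|_].
pose I v : nat := (1 < inc h v)%N.
apply: (@leq_trans (\sum_(i < n) \sum_(j < n | (i < j)%N)
     g i j * ((inc h i == 1%N) && (inc h j == 1%N)) +
   \sum_(i < n) \sum_(j < n) (K * m * I i * inc h j + K * m * I j * inc h i))%N).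
  rewrite -big_split /=; apply: leq_sum => i _.
  rewrite [X in (_ <= _ + X)%N](bigID (fun j : 'I_n => (i < j)%N)) /= addnA.
  rewrite -big_split /=; apply: leq_trans (leq_addr _ _); apply: leq_sum => j _.
  apply: (@leq_trans (g i j * ((inc h i == 1%N) && (inc h j == 1%N))
      + g i j * (m * I i * inc h j + m * I j * inc h i))%N); last first.
    have -> : (K * m * I i * inc h j + K * m * I j * inc h i =
        K * (m * I i * inc h j + m * I j * inc h i))%N by rewrite mulnDr !mulnA.
    by rewrite leq_add2l leq_mul2r (valid_le gv) orbT.
  rewrite -mulnDr leq_mul2l; apply/orP; right.
  have := inc_le gh i; have := inc_le gh j; rewrite /I.
  case: (inc h i) => [|[|a]]; case: (inc h j) => [|[|b]] //= => bm am; nia.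
rewrite leq_add2l.
have -> : (\sum_(i < n) \sum_(j < n) (K * m * I i * inc h j + K * m * I j * inc h i) =
   2 * (K * m * (\sum_(i < n) I i) * \sum_(i < n) inc h i))%N.
  transitivity (\sum_(i < n) (K * m * I i * (\sum_(j < n) inc h j)
     + K * m * (\sum_(j < n) I j) * inc h i))%N.
    apply: eq_bigr => i _; rewrite big_split /= -big_distrr; congr addn.
    by rewrite -big_distrl -big_distrr.
  by rewrite big_split /= -big_distrl -!big_distrr /= addnn mul2n.
have sm : (\sum_(i < n) inc h i <= m)%N by rewrite -[X in (_ <= X)%N](sum_inc gh) leq_addr.
rewrite expnS expn1 -!mulnA leq_mul2l /= leq_mul2l; apply/orP; right.
by rewrite leq_mul2l mulnC leq_mul2r sm !orbT.
Qed.

(** Both [i] and [j] are hit at rate [e_ij D / (m n)], and this creates [e_ij] triangles, hence the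
    sum of [e_ij^2]. By [sum_pairs_sqr] it is [m n] up to parallel edges and loops, which leaves
    [D]. *)
Lemma step_ntriangles :
  `|E (fun h => (ntriangles h)%:R) - (ntriangles g)%:R - D| <=
  `|D| / m%:R * (((multiplicity_excess g)%:R + (loops g)%:R) / n%:R)
  + C * (edge_product R g / n%:R ^+ 2)
  + 2 * K%:R * m%:R ^+ 2 * (C * (moment R 2 g / n%:R ^+ 2)).
Proof.
pose J (h : 'M[nat]_n.+1) := \sum_(i < n) \sum_(j < n | (i < j)%N)
     (g i j)%:R * ((inc h i == 1%N) && (inc h j == 1%N))%:R : R.
pose W (h : 'M[nat]_n.+1) : R := \sum_(v < n) (1 < inc h v)%N%:R.
pose c := 2 * K%:R * m%:R ^+ 2 : R.
have low : (ntriangles g)%:R + E J <= E (fun h => (ntriangles h)%:R).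
  rewrite -(step_cst (ntriangles g)%:R) -stepD; apply: (step_le Eg) => h gh.
  by have [] := ntriangles_step_bounds gh.
have upp : E (fun h => (ntriangles h)%:R) <= (ntriangles g)%:R + E J + c * E W.
  rewrite -(step_cst (ntriangles g)%:R) -stepD -stepZ -stepD; apply: (step_le Eg) => h gh.
  by have [] := ntriangles_step_bounds gh.
have c0 : 0 <= c by rewrite !mulr_ge0 ?exprn_ge0.
have /andP[_ /(ler_wpM2l c0)] := step_sum_multi; rewrite -/W => EW.
pose S := \sum_(i < n) \sum_(j < n | (i < j)%N) ((g i j)%:R * (g i j)%:R : R).
have EJ : `|E J - S * (D / (m%:R * n%:R))| <= C * (edge_product R g / n%:R ^+ 2).
  rewrite /J step_sum /S mulr_suml -sumrB (le_trans (ler_norm_sum _ _ _)) //.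
  rewrite /edge_product mulr_suml mulr_sumr; apply: ler_sum => i _.
  rewrite step_sum mulr_suml -sumrB (le_trans (ler_norm_sum _ _ _)) //.
  rewrite mulr_suml mulr_sumr; apply: ler_sum => j ij.
  rewrite stepZ -mulrA -mulrBr normrM ger0_norm ?ler0n //.
  have -> : C * ((g i j)%:R * ((deg g i)%:R * (deg g j)%:R) / n%:R ^+ 2) =
     (g i j)%:R * (C * ((deg g i)%:R * (deg g j)%:R / n%:R ^+ 2)) by ring.
  apply: ler_wpM2l; first exact: ler0n.
  by apply: (step_joint Eg); rewrite neq_ltn ij.
have ES : S * (D / (m%:R * n%:R)) =
   D + D / m%:R * ((multiplicity_excess g)%:R / n%:R) - D / m%:R * ((loops g)%:R / n%:R).
  by rewrite /S sum_pairs_sqr; field; rewrite !gt_eqF.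
have ab (z : nat) : `|D / m%:R * (z%:R / n%:R)| = `|D| / m%:R * (z%:R / n%:R).
  by rewrite !normrM !normfV !(ger0_norm (ler0n _ _)).
have := ler_norm (D / m%:R * ((loops g)%:R / n%:R)).
have := ler_norm (D / m%:R * ((multiplicity_excess g)%:R / n%:R)).
have := ler_norm (- (D / m%:R * ((loops g)%:R / n%:R))).
have := ler_norm (- (D / m%:R * ((multiplicity_excess g)%:R / n%:R))).
rewrite !normrN !ab mulrDl mulrDr.
move: EJ; rewrite ES !ler_norml -/c => /andP[].
move: low upp EW; set u1 := E _; set u2 := E J; set u3 := E W.
move=> *; apply/andP; split; lra.
Qed.

(* The deviations [delta v] of the mean increments add up to at most 0, so that
   [sum w delta <= sum (w - 1) delta]: the vertices of degree comparable to n,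
   for which [delta v] is not small, have weight [w v] close to 1. *)
Lemma step_lyapunov (th := (1 - A) / (8 * C)) :
  A < 1 -> 2 <= n%:R * (1 - A) ->
  E (fun h => lyapunov th h) <= (1 + A / n%:R) * lyapunov th g
    + (5 * m%:R ^+ 2 + 4 * m%:R * `|B|) / th / n%:R.
Proof.
move=> A1 nA; have /andP[A0 _] := A01.
have n1 : 1 <= n%:R :> R by rewrite ler1n.
have th0 : 0 < th by rewrite divr_gt0 ?subr_gt0 // mulr_gt0.
pose s := th * n.+1%:R.
have sE : s = th * n%:R + th by rewrite /s -natr1 mulrDr mulr1.
have thn0 : 0 < th * n%:R by rewrite mulr_gt0.
have s0 : 0 < s by lra.
have us0 v : 0 < d v + s by rewrite ltr_wpDl.
pose w v := 1 - s ^+ 2 / (d v + s) ^+ 2.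
have inv_s : s^-1 <= (th * n%:R)^-1 by rewrite lef_pV2 ?posrE //; lra.
have c2 : 0 <= 5 * m%:R ^+ 2 :> R by rewrite mulr_ge0 ?exprn_ge0.
apply: (@le_trans _ _ (\sum_(v < n) (d v ^+ 2 / (d v + s) + mu v * w v)
    + 5 * m%:R ^+ 2 / s)).
  rewrite [leRHS](_ : _ = E (fun h => \sum_(v < n) (d v ^+ 2 / (d v + s) + w v * x h v)
      + 5 * m%:R ^+ 2 / s)); last first.
    rewrite stepD step_cst step_sum; congr (_ + _); apply: eq_bigr => v _.
    by rewrite stepD step_cst stepZ [w v * _]mulrC.
  apply: (step_le Eg) => h gh.
  rewrite /lyapunov big_ord_recr /= -/s (deg_new gh).
  have lm : l h <= m%:R by rewrite ler_nat (new_loops_le gh).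
  have l0 : 0 <= l h by exact: ler0n.
  have m0 := ltW m0R.
  have new : (m + h ord_max ord_max)%:R ^+ 2 / ((m + h ord_max ord_max)%:R + s) <= 4 * m%:R ^+ 2 / s.
    rewrite natrD -/(l h); apply: ler_pM; rewrite ?exprn_ge0 ?invr_ge0 ?addr_ge0 // ?(ltW s0) //.
      by rewrite (_ : 4 * m%:R ^+ 2 = (2 * m%:R) ^+ 2); [rewrite ler_sqr ?nnegrE; lra|ring].
    by rewrite lef_pV2 ?posrE //; lra.
  have old : \sum_(v < n) x h v ^+ 2 / s <= m%:R ^+ 2 / s.
    rewrite -mulr_suml ler_pM2r ?invr_gt0 //.
    apply: (@le_trans _ _ (\sum_(v < n) m%:R * x h v)).
      by apply: ler_sum => v _; rewrite expr2 ler_wpM2r ?x_ge0 // ler_nat (inc_le gh).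
    by rewrite -mulr_sumr expr2 ler_wpM2l // -(sum_incR gh) lerDl.
  have -> : 5 * m%:R ^+ 2 / s = m%:R ^+ 2 / s + 4 * m%:R ^+ 2 / s by ring.
  rewrite addrA; apply: lerD => //; apply: le_trans (lerD (lexx _) old).
  rewrite -big_split /=.
  apply: ler_sum => v _; rewrite (deg_old gh) natrD -/(d v) -/(x h v) [w v * _]mulrC.
  exact: lyapunov_increment (d_ge0 v) (x_ge0 h v) s0.
have wd v : w v = d v * (d v + 2 * s) / (d v + s) ^+ 2.
  by rewrite /w; field; rewrite (gt_eqF (us0 v)).
have w0 v : 0 <= w v.
  rewrite wd divr_ge0 ?exprn_ge0 ?(ltW (us0 v)) // mulr_ge0 ?d_ge0 //.
  by rewrite addr_ge0 ?d_ge0 // mulr_ge0 // ltW.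
have w2 v : w v <= 2 * d v / s.
  rewrite wd ler_pdivrMr ?exprn_gt0 // mulrAC ler_pdivlMr // -subr_ge0.
  have -> : 2 * d v * (d v + s) ^+ 2 - d v * (d v + 2 * s) * s =
     d v * (2 * d v ^+ 2 + 3 * d v * s) by ring.
  have ds : 0 <= d v * s by rewrite mulr_ge0 ?d_ge0 // ltW.
  by apply: mulr_ge0; [exact: d_ge0|have := sqr_ge0 (d v); lra].
have El0 : 0 <= E l by case/andP: step_new_loops.
(* The necessary gain comes from the growth of the threshold from [th n] to [s = th (n + 1)], which
   lowers the summand of [v] by at least [th d^2 / (d + s)^2]. *)
have key v : d v ^+ 2 / (d v + s) + w v * (A * d v) / n%:R
     + (1 - w v) * (C * (d v ^+ 2 / n%:R ^+ 2))
     <= (1 + A / n%:R) * (d v ^+ 2 / (d v + th * n%:R)).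
  have usv := us0 v; have dv0 := d_ge0 v.
  have -> : d v ^+ 2 / (d v + s) + w v * (A * d v) / n%:R
     + (1 - w v) * (C * (d v ^+ 2 / n%:R ^+ 2)) = d v ^+ 2 *
       ((d v + s)^-1 + (A * (d v + 2 * s) / n%:R + C * (s / n%:R) ^+ 2) / (d v + s) ^+ 2).
    by rewrite wd; field; rewrite !gt_eqF.
  rewrite [leRHS]mulrCA; apply: ler_wpM2l; first exact: sqr_ge0.
  apply: (@le_trans _ _ ((1 + A / n%:R) / (d v + s) + th / (d v + s) ^+ 2)).
    have -> : (1 + A / n%:R) / (d v + s) = (d v + s)^-1 + A / n%:R / (d v + s) by ring.
    rewrite -addrA lerD2l.
    have -> : A / n%:R / (d v + s) = (A / n%:R * (d v + s)) / (d v + s) ^+ 2 by field; rewrite !gt_eqF.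
    rewrite -mulrDl ler_pM2r ?invr_gt0 ?exprn_gt0 //.
    have -> : A * (d v + 2 * s) / n%:R = A / n%:R * (d v + s) + A * (s / n%:R) by ring.
    rewrite -addrA lerD2l.
    (* Origin of [th]: with [s / n = th (1 + r)], the claim reads [A + A r + C th (1 + r)^2 <= 1].
       Here [2 <= n (1 - A)] bounds [A r] by [(1 - A) / 2], and [(1 + r)^2 <= 4] leaves [4 C th],
       which is the other half. *)
    pose r : R := n%:R^-1.
    have r0 : 0 < r by rewrite invr_gt0.
    have r1 : r <= 1 by rewrite invf_le1.
    have -> : s / n%:R = th * (1 + r) by rewrite sE /r; field; rewrite gt_eqF.
    have Ar : A * r <= (1 - A) / 2.
      rewrite ler_pdivrMr //; lra.
    have Cth : C * th = (1 - A) / 8 by rewrite /th; field; rewrite gt_eqF.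
    have -> : A * (th * (1 + r)) + C * (th * (1 + r)) ^+ 2 =
       th * (A + A * r + (C * th) * (1 + r) ^+ 2) by ring.
    rewrite Cth -[leRHS]mulr1 ler_pM2l //.
    have : (1 + r) ^+ 2 <= 4 by rewrite expr2; nra.
    move=> /(ler_wpM2l (_ : 0 <= (1 - A) / 8)) => /(_ _); lra.
  have p1 : 0 < d v + th * n%:R by rewrite ltr_wpDl.
  (* Convexity of the inverse: the left-hand side is its tangent at [d v + s], evaluated at
     [d v + s - th]. *)
  have h1 : (d v + s)^-1 + th / (d v + s) ^+ 2 <= (d v + th * n%:R)^-1.
    rewrite -subr_ge0.
    have -> : (d v + th * n%:R)^-1 - ((d v + s)^-1 + th / (d v + s) ^+ 2) =
       th ^+ 2 / ((d v + th * n%:R) * (d v + s) ^+ 2).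
      have -> : d v + th * n%:R = d v + s - th by lra.
      by field; rewrite !gt_eqF //; lra.
    by rewrite divr_ge0 ?sqr_ge0 // mulr_ge0 ?sqr_ge0 // ltW.
  have h2 : (d v + s)^-1 <= (d v + th * n%:R)^-1 by rewrite lef_pV2 ?posrE //; lra.
  have h3 := ler_wpM2l (divr_ge0 A0 (ltW n0R)) h2.
  by lra.
apply: (@le_trans _ _ (\sum_(v < n) (d v ^+ 2 / (d v + s) + w v * (A * d v) / n%:R
     + (1 - w v) * (C * (d v ^+ 2 / n%:R ^+ 2)) + delta v + `|B| * (2 * d v / s) / n%:R)
     + 5 * m%:R ^+ 2 / s)).
  rewrite lerD2r; apply: ler_sum => v _.
  have h1 : w v * B <= `|B| * (2 * d v / s).
    apply: (@le_trans _ _ (w v * `|B|)); first by rewrite ler_wpM2l // ler_norm.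
    by rewrite mulrC ler_wpM2l.
  have h2 : w v * B / n%:R <= `|B| * (2 * d v / s) / n%:R by rewrite ler_pM2r ?invr_gt0.
  have w1 : 0 <= 1 - w v by rewrite /w opprB addrC subrK divr_ge0 ?sqr_ge0.
  have h3 : (1 - w v) * (- delta v) <= (1 - w v) * (C * (d v ^+ 2 / n%:R ^+ 2)).
    by rewrite ler_wpM2l //; have := delta_le v; rewrite ler_norml; lra.
  rewrite muE.
  have -> : ((A * d v + B) / n%:R + delta v) * w v =
     w v * (A * d v) / n%:R + w v * B / n%:R + delta v + (1 - w v) * (- delta v) by ring.
  by lra.
rewrite [X in X + _](_ : _ = (\sum_(v < n) d v ^+ 2 / (d v + s)
     + \sum_(v < n) w v * (A * d v) / n%:R
     + \sum_(v < n) (1 - w v) * (C * (d v ^+ 2 / n%:R ^+ 2)))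
     + \sum_(v < n) delta v
     + `|B| * (\sum_(v < n) 2 * d v / s) / n%:R); last first.
  by rewrite mulr_sumr mulr_suml -!big_split.
rewrite sum_delta.
have -> : \sum_(v < n) 2 * d v / s = 4 * m%:R * n%:R / s.
  by rewrite -mulr_suml -mulr_sumr sum_deg; ring.
have hk : \sum_(v < n) d v ^+ 2 / (d v + s) + \sum_(v < n) w v * (A * d v) / n%:R
     + \sum_(v < n) (1 - w v) * (C * (d v ^+ 2 / n%:R ^+ 2))
     <= (1 + A / n%:R) * lyapunov th g.
  by rewrite -!big_split /= mulr_sumr; apply: ler_sum => v _; exact: key.
have hB : `|B| * (4 * m%:R * n%:R / s) / n%:R + 5 * m%:R ^+ 2 / s <=
    (5 * m%:R ^+ 2 + 4 * m%:R * `|B|) / th / n%:R.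
  have -> : `|B| * (4 * m%:R * n%:R / s) / n%:R + 5 * m%:R ^+ 2 / s =
    (5 * m%:R ^+ 2 + 4 * m%:R * `|B|) / s by field; rewrite !gt_eqF.
  by rewrite -(mulrA _ th^-1) -invfM; apply: ler_wpM2l => //; rewrite addr_ge0 ?mulr_ge0.
lra.
Qed.

End Drift.

(** * Expectations along the process *)

Section Process.
Context {d : measure_display} {T : measurableType d} {R : realType}.
Variables (P : probability T R) (m n0 : nat) (G : forall n : nat, T -> 'M[nat]_n).
Hypothesis hG : growth_process G m n0.

Let K := (n0 * (m * n0) + m)%N.

Lemma process_valid n w : (n0 <= n)%N -> valid m K (G n w).
Proof.
have [_ [g0 g0m Gg0] Gstep] := hG.
have init : valid m K (G n0 w) by rewrite Gg0; apply: valid_multigraph g0m; rewrite leq_addr.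
elim: n => [|n IH].
  by rewrite leqn0 => /eqP <-.
rewrite leq_eqVlt => /orP[/eqP <- //|]; rewrite ltnS => nn.
exact: (valid_growth_step (Gstep n w nn) (leq_addl _ _) (IH nn)).
Qed.

(* The entries of [G n w] are at most K, so that expectations of functions of
   [G n] are finite sums over matrices with entries in ['I_K.+1]. *)
Definition decode n (a : 'M['I_K.+1]_n) : 'M[nat]_n := map_mx (@nat_of_ord K.+1) a.

Lemma decode_inj n : injective (@decode n).
Proof.
by move=> a b /matrixP ab; apply/matrixP => i j; apply: val_inj; have := ab i j; rewrite !mxE.
Qed.

Lemma decodeK n (g : 'M[nat]_n) : valid m K g -> exists a, decode a = g.
Proof.
move=> gv; exists (map_mx (fun k => inord k) g); apply/matrixP => i j.
by rewrite !mxE inordK // ltnS (valid_le gv).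
Qed.

Let fiber n (g : 'M[nat]_n) : set T := [set w | G n w = g].

Let fiberm n (g : 'M[nat]_n) : (n0 <= n)%N -> measurable (fiber g).
Proof. by case: hG => + _ _; apply. Qed.

Let pr (S : set T) : R := fine (P S).

Let pr_ge0 S : 0 <= pr S.
Proof. by rewrite fine_ge0. Qed.

Let pr_le S S' : measurable S -> measurable S' -> S `<=` S' -> pr S <= pr S'.
Proof.
move=> mS mS' SS'; apply: fine_le; [exact: fin_num_measure|exact: fin_num_measure|].
by apply: le_measure => //; apply/mem_set.
Qed.

Lemma total_probability n S : (n0 <= n)%N -> measurable S ->
  pr S = \sum_(a : 'M['I_K.+1]_n) pr (S `&` fiber (decode a)).
Proof.
move=> nn mS; pose A (a : 'M['I_K.+1]_n) := S `&` fiber (decode a).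
have mA a : measurable (A a) by apply: measurableI => //; exact: fiberm.
have {1}-> : S = \bigcup_(a in [set` [fset x | x in 'M['I_K.+1]_n]%fset]) A a.
  apply/seteqP; split => [w Sw|w [a _ []] //].
  have [a aw] := decodeK (process_valid w nn).
  by exists a; rewrite /= ?inE // /A /fiber.
rewrite bigcup_fset /pr measure_fbigsetU //; last first.
  by move=> a b _ _ [w [[_ wa] [_ wb]]]; apply: decode_inj; rewrite -wa -wb.
rewrite -sum_fine; last by move=> a _; rewrite fin_num_measure.
apply: perm_big; apply: uniq_perm; rewrite ?index_enum_uniq //.
by move=> a; rewrite mem_index_enum !inE.
Qed.

Definition expect n (F : 'M[nat]_n -> R) : R :=
  \sum_(a : 'M['I_K.+1]_n) F (decode a) * pr (fiber (decode a)).

(* For an impossible g this is 0, by division by 0. *)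
Definition cexpect n (g : 'M[nat]_n) (F : 'M[nat]_n.+1 -> R) : R :=
  \sum_(a : 'M['I_K.+1]_n.+1) F (decode a) * cprob P G g (fiber (decode a)).

Lemma expect_le n (F F' : 'M[nat]_n -> R) :
  (forall g, possible P G g -> F g <= F' g) -> expect F <= expect F'.
Proof.
move=> FF; apply: ler_sum => a _.
have [p0|p0] := eqVneq (P (fiber (decode a))) 0%E.
  by rewrite /pr p0 /= !mulr0.
by rewrite ler_wpM2r //; exact: FF.
Qed.

Lemma expectD n (F F' : 'M[nat]_n -> R) :
  expect (fun g => F g + F' g) = expect F + expect F'.
Proof. by rewrite /expect -big_split /=; apply: eq_bigr => a _; rewrite mulrDl. Qed.

Lemma expectZ n (a : R) (F : 'M[nat]_n -> R) : expect (fun g => a * F g) = a * expect F.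
Proof. by rewrite /expect mulr_sumr; apply: eq_bigr => b _; rewrite mulrA. Qed.

Lemma measurable_graph n (Q : 'M[nat]_n -> Prop) : (n0 <= n)%N ->
  measurable [set w | Q (G n w)].
Proof.
move=> nn.
have -> : [set w | Q (G n w)] =
    \bigcup_(a in [set a : 'M['I_K.+1]_n | Q (decode a)]) fiber (decode a).
  apply/seteqP; split => [w /= Qw|w [a /= Qa] ->//].
  have [a aw] := decodeK (process_valid w nn).
  by exists a; rewrite /= ?aw.
by apply: fin_bigcup_measurable => [|a _]; [exact: finite_finset|exact: fiberm].
Qed.

Lemma expect_indicator n (Q : 'M[nat]_n -> bool) : (n0 <= n)%N ->
  expect (fun g => (Q g)%:R) = pr [set w | Q (G n w)].
Proof.
move=> nn; rewrite (total_probability nn (measurable_graph (fun g => Q g) nn)).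
apply: eq_bigr => a _; case Qa : (Q (decode a)); rewrite ?mul1r ?mul0r.
  by congr pr; apply/seteqP; split => [w /= wa|w [] //]; split => //; rewrite wa.
rewrite [X in pr X](_ : _ = set0) /pr ?measure0 //.
by apply/seteqP; split => // w [/= + wa]; rewrite wa Qa.
Qed.

Lemma expect1 n : (n0 <= n)%N -> expect (fun _ : 'M[nat]_n => 1) = 1.
Proof.
move=> nn; have := expect_indicator (fun=> true) nn; rewrite /= => ->.
rewrite /pr [X in P X](_ : _ = setT) ?probability_setT //.
by apply/seteqP; split.
Qed.

Lemma possible_ex n (g : 'M[nat]_n) : possible P G g -> exists w, G n w = g.
Proof.
have [e|/set0P[w <-] _] := eqVneq (fiber g) set0; last by exists w.
by rewrite /possible -/(fiber g) e measure0 eqxx.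
Qed.

Lemma possible_valid n (g : 'M[nat]_n) : (n0 <= n)%N -> possible P G g -> valid m K g.
Proof. by move=> nn /possible_ex[w <-]; exact: process_valid. Qed.

Lemma possible_pr n (g : 'M[nat]_n) : (n0 <= n)%N -> possible P G g -> 0 < pr (fiber g).
Proof.
move=> nn pg; have fP := fin_num_measure P _ (fiberm g nn).
by apply: fine_gt0; rewrite lt0e pg measure_ge0 /= -ge0_fin_numE.
Qed.

Lemma expect_cexpect n (F : 'M[nat]_n.+1 -> R) : (n0 <= n)%N ->
  expect F = expect (fun g => cexpect g F).
Proof.
move=> nn; have nn1 : (n0 <= n.+1)%N by exact: leqW.
rewrite /expect /cexpect.
under [RHS]eq_bigr do rewrite mulr_suml.
rewrite exchange_big /=; apply: eq_bigr => b _.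
under eq_bigr do rewrite -mulrA.
rewrite -mulr_sumr; congr (_ * _).
rewrite (total_probability nn (fiberm (decode b) nn1)); apply: eq_bigr => a _.
rewrite /cprob -/(pr _) -/(pr _) -/(fiber _).
have [p0|p0] := eqVneq (P (fiber (decode a))) 0%E; last first.
  by rewrite divfK // gt_eqF //; exact: possible_pr.
rewrite /pr p0 /= mulr0; apply/le_anti; rewrite pr_ge0 andbT.
have -> : 0 = pr (fiber (decode a)) by rewrite /pr p0.
by apply: pr_le; [apply: measurableI; exact: fiberm|exact: fiberm|move=> w []].
Qed.

Section Conditional.
Variables (n : nat) (g : 'M[nat]_n).
Hypotheses (nn : (n0 <= n)%N) (pg : possible P G g).

Lemma cprob_total (S : set T) : measurable S ->
  cprob P G g S = \sum_(a : 'M['I_K.+1]_n.+1) cprob P G g (S `&` fiber (decode a)).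
Proof.
move=> mS; rewrite /cprob -/(pr _) -/(fiber _) -mulr_suml; congr (_ / _).
rewrite (total_probability (leqW nn)); last by apply: measurableI => //; exact: fiberm.
by apply: eq_bigr => a _; rewrite setIAC.
Qed.

Lemma cprob_indicator (S : set T) (Q : 'M[nat]_n.+1 -> bool) :
  (forall w, G n w = g -> S w <-> Q (G n.+1 w)) ->
  cprob P G g S = cexpect g (fun h => (Q h)%:R).
Proof.
move=> SQ; have -> : cprob P G g S = cprob P G g [set w | Q (G n.+1 w)].
  rewrite /cprob; congr (fine (P _) / _).
  by apply/seteqP; split => w [h1 h2]; split => //; apply/SQ.
rewrite cprob_total; last exact: (measurable_graph (fun h => Q h) (leqW nn)).
apply: eq_bigr => a _; case Qa : (Q (decode a)); rewrite ?mul1r ?mul0r.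
  by congr (cprob _ _ _ _); apply/seteqP; split => [w []//|w /= wa]; split => //; rewrite wa.
rewrite [X in cprob _ _ _ X](_ : _ = set0); first by rewrite /cprob set0I measure0 mul0r.
by apply/seteqP; split => // w [/= + wa]; rewrite wa Qa.
Qed.

Lemma cexpect_le (F F' : 'M[nat]_n.+1 -> R) :
  (forall h, growth_step m g h -> F h <= F' h) -> cexpect g F <= cexpect g F'.
Proof.
move=> FF; apply: ler_sum => a _; rewrite /cprob -/(pr _) -/(pr _).
have [-> |/set0P[w [/= wa wg]]] := eqVneq (fiber (decode a) `&` [set w | G n w = g]) set0.
  by rewrite /pr measure0 !mul0r !mulr0.
apply: ler_wpM2r; first by rewrite divr_ge0.
by apply: FF; rewrite -wa -wg; case: hG => _ _; apply.
Qed.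

Lemma cexpect_lin a (F F' : 'M[nat]_n.+1 -> R) :
  cexpect g (fun h => a * F h + F' h) = a * cexpect g F + cexpect g F'.
Proof.
by rewrite /cexpect mulr_sumr -big_split /=; apply: eq_bigr => b _; ring.
Qed.

Lemma cexpect1 : cexpect g (fun=> 1) = 1.
Proof.
rewrite -(@cprob_indicator setT (fun=> true)) //.
by rewrite /cprob setTI divff // gt_eqF //; exact: possible_pr.
Qed.

End Conditional.

(** Turns the events of the hypotheses, which compare two consecutive graphs, into properties of the
    new graph alone. *)
Lemma deg_incr_inc n (v : 'I_n) j w : (n0 <= n)%N ->
  deg_incr G v j w <-> inc (G n.+1 w) v == j.
Proof.
move=> nn; have [_ _ Gstep] := hG.
rewrite /deg_incr /= (deg_old (Gstep n w nn)).
by split=> [/eqP|/eqP ->]; rewrite ?eqn_add2l.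
Qed.

Lemma nat_split_indicator (k : nat) : (k <= m)%N ->
  k%:R = (k == 1%N)%:R + \sum_(2 <= j < m.+1) j%:R * (k == j)%:R :> R.
Proof.
case: k => [|[|k]] km.
- by rewrite big_nat big1 ?addr0 // => j /andP[j2 _]; case: j j2 => //= *; rewrite mulr0.
- by rewrite big_nat big1 ?addr0 // => j /andP[j2 _]; case: j j2 => [|[|]] //= *; rewrite mulr0.
rewrite add0r (bigD1_seq k.+2) ?iota_uniq ?mem_index_iota ?ltnS //= eqxx mulr1.
by rewrite big1 ?addr0 // => j jk; rewrite eq_sym (negbTE jk) mulr0.
Qed.

Lemma multi_split_indicator (k : nat) : (k <= m)%N ->
  (1 < k)%N%:R = \sum_(2 <= j < m.+1) (k == j)%:R :> R.
Proof.
case: ltnP => [k1 km|k1 _].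
  rewrite (bigD1_seq k) ?iota_uniq ?mem_index_iota ?k1 ?ltnS //= eqxx.
  by rewrite big1 ?addr0 // => j jk; rewrite eq_sym (negbTE jk).
rewrite big_nat big1 // => j /andP[j2 _].
by rewrite (_ : (k == j) = false) //; apply/negbTE; rewrite neq_ltn (leq_ltn_trans k1 j2).
Qed.

(** An increment is at most [m], so its mean is the probability of the value 1 plus boundedly many
    terms for larger values, all of the order of the error. *)
Lemma process_step_law A B D : PA_class P G m A B -> joint_increment P G m D ->
  exists2 C : R, 0 < C & \forall n \near \oo, forall g : 'M[nat]_n, possible P G g ->
    step_law m A B C D g (@cexpect n g).
Proof.
case=> _ [C1 /nearP_oo[N1 h1]] [C2 /nearP_oo[N2 h2]] _ [C3 /nearP_oo[N3 h3]].
pose L2 := Num.max C2 0; pose L1 := Num.max C1 0; pose L3 := Num.max C3 0.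
have L10 : 0 <= L1 by rewrite le_max lexx orbT.
have L20 : 0 <= L2 by rewrite le_max lexx orbT.
have L30 : 0 <= L3 by rewrite le_max lexx orbT.
pose M : R := m.+1%:R.
have M1 : 1 <= M by rewrite ler1n.
(* [L1] comes from increments equal to 1, [L3] from joint increments, and [M^2 L2] from fewer than
   [M] values [j >= 2], each with a weight of at most [M]; the 1 makes [C] positive. *)
pose C := L1 + L3 + M ^+ 2 * L2 + 1.
have ML : L2 <= M ^+ 2 * L2 by rewrite ler_peMl // exprn_ege1.
have ML' : M * L2 <= M ^+ 2 * L2 by rewrite ler_wpM2r // expr2 ler_peMl // (le_trans ler01).
have C0 : 0 < C by rewrite /C; lra.
exists C => //.
apply/nearP_oo; exists (maxn n0 (maxn N1 (maxn N2 N3))) => n.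
rewrite !geq_max => /and4P[nn n1 n2 n3] g pg.
pose q (v : 'I_n) : R := (deg g v)%:R ^+ 2 / n%:R ^+ 2.
have q0 v : 0 <= q v by rewrite divr_ge0 ?exprn_ge0.
have czero : cexpect g (fun=> 0) = 0 by rewrite /cexpect big1 // => a _; rewrite mul0r.
have csum (r : seq nat) (c : nat -> R) (F : nat -> 'M[nat]_n.+1 -> R) :
    cexpect g (fun h => \sum_(j <- r) c j * F j h) = \sum_(j <- r) c j * cexpect g (F j).
  rewrite /cexpect; under [RHS]eq_bigr do rewrite mulr_sumr.
  rewrite exchange_big /=; apply: eq_bigr => a _; rewrite mulr_suml.
  by apply: eq_bigr => j _; rewrite mulrA.
have ceq F F' : (forall h, growth_step m g h -> F h = F' h) -> cexpect g F = cexpect g F'.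
  by move=> FF; apply: le_anti; rewrite !cexpect_le // => h gh; rewrite FF.
have cadd F F' : cexpect g (fun h => F h + F' h) = cexpect g F + cexpect g F'.
  by rewrite /cexpect -big_split /=; apply: eq_bigr => a _; rewrite mulrDl.
have ev1 v : `|cexpect g (fun h => (inc h v == 1%N)%:R) - (A * (deg g v)%:R + B) / n%:R| <= L1 * q v.
  rewrite -(cprob_indicator nn (S := deg_incr G v 1)); last first.
    by move=> w _; exact: deg_incr_inc.
  apply: (@le_trans _ _ (C1 * q v)); last by rewrite ler_wpM2r // le_max lexx.
  have -> : (A * (deg g v)%:R + B) / n%:R = A * ((deg g v)%:R / n%:R) + B * (1 / n%:R) by ring.
  exact: h1.
have ev2 v j : (2 <= j <= m)%N -> cexpect g (fun h => (inc h v == j)%:R) <= L2 * q v.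
  move=> hj; rewrite -(cprob_indicator nn (S := deg_incr G v j)); last first.
    by move=> w _; exact: deg_incr_inc.
  apply: (@le_trans _ _ (C2 * q v)); last by rewrite ler_wpM2r // le_max lexx.
  exact: h2.
have ev20 v j : 0 <= cexpect g (fun h => (inc h v == j)%:R) by rewrite -czero; apply: cexpect_le.
have evs v (c : nat -> R) (a : R) : (forall j, (j <= m)%N -> 0 <= c j <= a) -> 0 <= a ->
   0 <= \sum_(2 <= j < m.+1) c j * cexpect g (fun h => (inc h v == j)%:R) <= M * (a * (L2 * q v)).
  move=> ca a0; apply/andP; split.
    rewrite big_nat sumr_ge0 // => j /andP[j2 jm]; have /andP[c0 _] := ca j jm.
    by rewrite mulr_ge0.
  apply: (@le_trans _ _ (\sum_(2 <= j < m.+1) (a * (L2 * q v)))).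
    rewrite !big_nat; apply: ler_sum => j /andP[j2 jm]; have /andP[c0 c1] := ca j jm.
    by rewrite ler_pM // ev2 // j2.
  rewrite sumr_const_nat -mulr_natl ler_wpM2r ?mulr_ge0 //.
  by rewrite ler_nat leq_subr.
split.
- by move=> F F'; exact: cexpect_le.
- exact: cexpect_lin.
- exact: cexpect1.
- move=> v; rewrite -/(q v).
  have -> : cexpect g (fun h => (inc h v)%:R) = cexpect g (fun h => (inc h v == 1%N)%:R)
     + \sum_(2 <= j < m.+1) j%:R * cexpect g (fun h => (inc h v == j)%:R).
    by rewrite -csum -cadd; apply: ceq => h gh; rewrite -nat_split_indicator // (inc_le gh).
  have := evs v (fun j => j%:R) M _ (le_trans ler01 M1).
  case/(_ _)/andP => [j jm|s0 s1]; first by rewrite ler0n ler_nat ltnW.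
  have qL1 := mulr_ge0 L30 (q0 v).
  move: (ev1 v); rewrite !ler_norml => /andP[e0 e1].
  have Ls : M * (M * (L2 * q v)) = M ^+ 2 * L2 * q v by ring.
  rewrite Ls in s1; have qv := q0 v; rewrite /C !mulrDl mul1r.
  have Mq : 0 <= M ^+ 2 * L2 * q v by rewrite -Ls !mulr_ge0 // (le_trans ler01).
  by apply/andP; split; lra.
- move=> v; rewrite -/(q v).
  have -> : cexpect g (fun h => (1 < inc h v)%N%:R) =
     \sum_(2 <= j < m.+1) 1 * cexpect g (fun h => (inc h v == j)%:R).
    rewrite -csum; apply: ceq => h gh; rewrite multi_split_indicator ?(inc_le gh) //.
    by under [RHS]eq_bigr do rewrite mul1r.
  have := evs v (fun j => 1) 1 _ ler01.
  case/(_ _)/andP => [j jm|_ /le_trans]; first by rewrite ler01 lexx.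
  apply; rewrite mul1r mulrA ler_wpM2r // /C; lra.
move=> i j ij.
rewrite -(cprob_indicator nn (S := deg_incr G i 1 `&` deg_incr G j 1)); last first.
  move=> w _; rewrite /setI /=; split.
    by move=> [/(deg_incr_inc _ _ _ nn) -> /(deg_incr_inc _ _ _ nn) ->].
  by move=> /andP[h h']; split; apply/(deg_incr_inc _ _ _ nn).
apply: le_trans (h3 n n3 g pg i j ij) _; apply: ler_wpM2r.
  by rewrite divr_ge0 ?exprn_ge0 // mulr_ge0.
apply: (@le_trans _ _ L3); first by rewrite le_max lexx.
have : 0 <= M ^+ 2 * L2 by rewrite mulr_ge0 // exprn_ge0 // (le_trans ler01).
by rewrite /C; lra.
Qed.

Lemma whpP (S : forall n, 'M[nat]_n -> bool) :
  whp P (fun n => [set w | S n (G n w)]) <->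
  forall e : R, 0 < e -> \forall n \near \oo, expect (fun g : 'M[nat]_n => (~~ S n g)%:R) <= e.
Proof.
have compl (n : nat) : (n0 <= n)%N ->
    1 - pr [set w | S n (G n w)] = expect (fun g : 'M[nat]_n => (~~ S n g)%:R).
  move=> nn; rewrite -(expect_indicator (fun g => S n g) nn) -[X in X - _](expect1 nn).
  apply/eqP; rewrite subr_eq -expectD; apply/eqP; apply: eq_bigr => a _.
  by case: (S n _); rewrite ?addr0 ?add0r.
have mS (n : nat) : (n0 <= n)%N -> measurable [set w | S n (G n w)].
  exact: (measurable_graph (fun g => S n g)).
have ex0 (n : nat) : 0 <= expect (fun g : 'M[nat]_n => (~~ S n g)%:R).
  by apply: sumr_ge0 => a _; rewrite mulr_ge0.
split=> [/fine_cvgP[_ /cvgrPdist_le hS] e e0|hS].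
  have /nearP_oo[N hN] := hS e e0.
  apply/nearP_oo; exists (maxn n0 N) => n; rewrite geq_max => /andP[nn Nn].
  by have := hN n Nn; rewrite /= -/(pr _) compl // ger0_norm.
apply/fine_cvgP; split.
  by apply/nearP_oo; exists n0 => n nn; rewrite fin_num_measure //; exact: mS.
apply/cvgrPdist_le => e e0; have /nearP_oo[N hN] := hS e e0.
apply/nearP_oo; exists (maxn n0 N) => n; rewrite geq_max => /andP[nn Nn].
by rewrite /= -/(pr _) compl // ger0_norm ?hN.
Qed.

Lemma whp_combine (S1 S2 S : forall n, 'M[nat]_n -> bool) :
  (\forall n \near \oo, forall g : 'M[nat]_n, possible P G g -> S1 n g -> S2 n g -> S n g) ->
  whp P (fun n => [set w | S1 n (G n w)]) -> whp P (fun n => [set w | S2 n (G n w)]) ->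
  whp P (fun n => [set w | S n (G n w)]).
Proof.
move=> /nearP_oo[N0 hN0] /whpP h1 /whpP h2; apply/whpP => e e0.
have e20 : 0 < e / 2 by rewrite divr_gt0.
have /nearP_oo[N3 hN3] := h1 _ e20; have /nearP_oo[N2 hN2] := h2 _ e20.
apply/nearP_oo; exists (maxn N0 (maxn N3 N2)) => n; rewrite !geq_max => /and3P[n1 n3 n2].
rewrite [leRHS]splitr; apply: le_trans (lerD (hN3 n n3) (hN2 n n2)).
rewrite -expectD; apply: expect_le => g pg; have := hN0 n n1 g pg.
case: (S n g); first by move=> _; rewrite addr_ge0.
case: (S1 n g) => [|_]; last by rewrite /= lerDl.
by case: (S2 n g) => [/(_ isT isT)|_] //; rewrite /= lerDr.
Qed.

End Process.

(* The value of [G n] determines the earlier graphs, which are its principal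
   submatrices: the whole past of the process is a function of [G n]. *)
Fixpoint always (Q : forall n, 'M[nat]_n -> bool) k n : 'M[nat]_n -> bool :=
  match n return 'M[nat]_n -> bool with
  | 0 => fun=> true
  | n'.+1 => fun h => always Q k (prune h) && ((k <= n'.+1)%N ==> Q _ h)
  end.

(** * Truncated expectations and the maximal inequality *)

Section Truncation.
Context {d : measure_display} {T : measurableType d} {R : realType}.
Variables (P : probability T R) (m n0 : nat) (G : forall n : nat, T -> 'M[nat]_n).
Hypothesis hG : growth_process G m n0.
Hypothesis n0_gt0 : (0 < n0)%N.
Variable Q : forall n, 'M[nat]_n -> bool.

Local Notation E F := (expect P m n0 G F).
Local Notation CE g F := (cexpect P m n0 G g F).

Definition trunc_expect k n (F : 'M[nat]_n -> R) : R :=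
  E (fun g : 'M[nat]_n => (always Q k g)%:R * F g).

Lemma always_lt k n (g : 'M[nat]_n) : (n < k)%N -> always Q k g.
Proof.
elim: n g => [//|n IH] g nk /=; rewrite IH ?(ltn_trans _ nk) //=.
by rewrite leqNgt nk.
Qed.

(** [always] tests nothing at time 0, whence the condition [0 < n]. *)
Lemma always_now k n (g : 'M[nat]_n) : (0 < n)%N -> (k <= n)%N -> always Q k g -> Q g.
Proof. by case: n g => // n g _ kn /= /andP[_]; rewrite kn. Qed.

Lemma always_start k (g : 'M[nat]_k) : (0 < k)%N -> always Q k g = Q g.
Proof. by case: k g => // k g _ /=; rewrite always_lt // leqnn. Qed.

Lemma always_growth_step k n (g : 'M[nat]_n) (h : 'M[nat]_n.+1) : growth_step m g h ->
  always Q k h = always Q k g && ((k <= n.+1)%N ==> Q h).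
Proof. by move=> gh /=; rewrite (prune_growth_step gh). Qed.

Lemma trunc_expect_le k n (F F' : 'M[nat]_n -> R) :
  (forall g, possible P G g -> always Q k g -> F g <= F' g) ->
  trunc_expect k F <= trunc_expect k F'.
Proof.
move=> FF; apply: expect_le => g pg; case: (boolP (always Q k g)) => ag; last by rewrite !mul0r.
by rewrite !mul1r; exact: FF.
Qed.

Lemma trunc_expectD k n (F F' : 'M[nat]_n -> R) :
  trunc_expect k (fun g => F g + F' g) = trunc_expect k F + trunc_expect k F'.
Proof.
rewrite /trunc_expect -expectD; apply: eq_bigr => a _.
by rewrite mulrDr.
Qed.

Lemma trunc_expectZ k n a (F : 'M[nat]_n -> R) :
  trunc_expect k (fun g => a * F g) = a * trunc_expect k F.
Proof. by rewrite /trunc_expect -expectZ; apply: eq_bigr => b _; rewrite mulrCA. Qed.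

Lemma trunc_expect_ge0 k n (F : 'M[nat]_n -> R) :
  (forall g, possible P G g -> always Q k g -> 0 <= F g) -> 0 <= trunc_expect k F.
Proof.
move=> F0; have := trunc_expectZ k 0 F; rewrite mul0r => <-.
by apply: trunc_expect_le => g pg ag; rewrite mul0r; exact: F0.
Qed.

Lemma trunc_expect_cst k n (a : R) : (n0 <= n)%N -> 0 <= a ->
  trunc_expect k (fun _ : 'M[nat]_n => a) <= a.
Proof.
move=> nn a0; rewrite -[leRHS]mulr1 -(expect1 P hG nn) -expectZ.
by apply: expect_le => g _; case: always; rewrite ?(mul1r, mul0r, mulr1).
Qed.

(** Survival up to [n + 1] implies survival up to [n]. As [F >= 0], forgetting the test at time
    [n + 1] only increases the left-hand side, and a drift bound on surviving graphs is enough. *)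
Lemma trunc_expect_step k n (F : 'M[nat]_n.+1 -> R) (F' : 'M[nat]_n -> R) : (n0 <= n)%N ->
  (forall g, possible P G g -> forall h, growth_step m g h -> 0 <= F h) ->
  (forall g, possible P G g -> always Q k g -> CE g F <= F' g) ->
  trunc_expect k F <= trunc_expect k F'.
Proof.
move=> nn F0 FF; rewrite /trunc_expect (expect_cexpect P hG) //.
apply: expect_le => g pg; case: (boolP (always Q k g)) => ag.
  rewrite mul1r; apply: le_trans (FF g pg ag); apply: (cexpect_le P hG nn) => h gh.
  by rewrite ler_piMl ?(F0 g) //; case: always.
have -> : 0 * F' g = CE g (fun=> 0).
  by rewrite mul0r /cexpect big1 // => a _; rewrite mul0r.
by apply: (cexpect_le P hG nn) => h gh; rewrite (always_growth_step _ gh) (negbTE ag) mul0r.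
Qed.

Lemma trunc_expect_compl k n : (n0 <= n)%N ->
  1 - trunc_expect k (fun _ : 'M[nat]_n => 1) =
  E (fun g : 'M[nat]_n => 1 - (always Q k g)%:R).
Proof.
move=> nn; rewrite -[X in X - _](expect1 P hG nn) -[X in _ - X]mul1r -mulNr -expectZ -expectD.
by apply: eq_bigr => a _; rewrite mulr1 mulN1r.
Qed.

Lemma trunc_expect_indicator k n (S : 'M[nat]_n -> bool) : (n0 <= n)%N ->
  fine (P [set w | S (G n w)]) <= trunc_expect k (fun g => (S g)%:R)
    + (1 - trunc_expect k (fun _ : 'M[nat]_n => 1)).
Proof.
move=> nn; rewrite -(expect_indicator P hG S nn) trunc_expect_compl //.
rewrite -expectD; apply: expect_le => g _.
by case: always; case: (S g); rewrite ?(mul1r, mul0r, mulr1) ?subrr ?subr0 ?addr0 ?add0r.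
Qed.

(** Maximal inequality through the stopped process [U], equal to [V] before the first exit and to 1
    afterwards. At an exit a value above 1 is replaced by 1, so the mean of [U] does not increase,
    and [U] dominates the indicator of the exit. *)
Lemma trunc_expect_exit (V : forall n, 'M[nat]_n -> R) k n :
  (forall n (g : 'M[nat]_n), Q g = (V _ g <= 1)) ->
  (n0 <= k)%N ->
  (forall n (g : 'M[nat]_n), (n0 <= n)%N -> possible P G g -> 0 <= V _ g) ->
  (forall n (g : 'M[nat]_n), (k <= n)%N -> possible P G g -> CE g (V n.+1) <= V n g) ->
  (k <= n)%N ->
  1 - trunc_expect k (fun _ : 'M[nat]_n => 1) <= E (V k).
Proof.
move=> QV nk V0 VV kn.
pose U n (g : 'M[nat]_n) := (always Q k g)%:R * V n g + (1 - (always Q k g)%:R).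
apply: (@le_trans _ _ (E (U n))).
  have nn : (n0 <= n)%N by exact: leq_trans kn.
  rewrite trunc_expect_compl //; apply: expect_le => g pg; rewrite /U; have := V0 _ _ nn pg.
  by case: always; rewrite ?(mul1r, mul0r) ?subrr ?subr0 ?addr0 ?add0r.
elim: n kn => [|n IH].
  by rewrite leqn0 => /eqP k0; move: n0_gt0; rewrite ltnNge (leq_trans nk) // k0.
rewrite leq_eqVlt => /orP[/eqP <-|]; last first.
  rewrite ltnS => kn; apply: le_trans (IH kn).
  have nn : (n0 <= n)%N by exact: leq_trans kn.
  rewrite (expect_cexpect P hG) //; apply: expect_le => g pg.
  rewrite {2}/U; case: (boolP (always Q k g)) => ag; rewrite ?(mul1r, mul0r).
    rewrite subrr addr0; apply: le_trans (VV _ _ kn pg); apply: (cexpect_le P hG nn) => h gh.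
    rewrite /U (always_growth_step _ gh) ag /= QV leqW //=.
    by case: (leP (V n.+1 h) 1) => [|/ltW] h1; rewrite ?(mul1r, mul0r) ?subrr ?subr0 ?addr0 ?add0r.
  rewrite add0r subr0 -(cexpect1 hG nn pg); apply: (cexpect_le P hG nn) => h gh.
  by rewrite /U (always_growth_step _ gh) (negbTE ag) mul0r subr0 add0r.
apply: expect_le => g pg; rewrite /U; have V0g := V0 _ _ nk pg.
have -> : always Q k g = (V k g <= 1).
  by rewrite always_start ?QV //; exact: leq_trans nk.
by case: (leP (V k g) 1) => [|/ltW] h1; rewrite ?(mul1r, mul0r) ?subrr ?subr0 ?addr0 ?add0r.
Qed.

End Truncation.

(** * Absence of large degrees and truncated moments *)

Section Survival.
Context {d : measure_display} {T : measurableType d} {R : realType}.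
Variables (P : probability T R) (m n0 N1 : nat) (A B C D : R).
Variable G : forall n : nat, T -> 'M[nat]_n.
Hypothesis m_gt0 : (0 < m)%N.
Hypothesis n0_gt0 : (0 < n0)%N.
Hypothesis AB : 2 * m%:R * A + B = m%:R.
Hypothesis A01 : 0 <= A <= 1.
Hypothesis A_lt1 : A < 1.
Hypothesis hG : growth_process G m n0.
Hypothesis C_gt0 : 0 < C.
Hypothesis N1_ge : (n0 <= N1)%N.
Hypothesis N1_large : 2 <= N1%:R * (1 - A).

Let K := (n0 * (m * n0) + m)%N.

Local Notation E F := (expect P m n0 G F).
Local Notation CE g F := (cexpect P m n0 G g F).

Hypothesis law : forall n (g : 'M[nat]_n), (N1 <= n)%N -> possible P G g ->
  step_law m A B C D g (@cexpect _ _ _ P m n0 G n g).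

(* A = 1 - 16 gap; the factors 8, 4 and 2 separate the exponent of the drift of
   the potential, that of its mean and that of the threshold in [tame]. *)
Definition gap : R := (1 - A) / 16.
Definition pace : R := (1 - A) / (8 * C).
Definition offset : R := (5 * m%:R ^+ 2 + 4 * m%:R * `|B|) / pace / (1 - 8 * gap).
Definition potential n (g : 'M[nat]_n) : R := lyapunov pace g + offset.
Definition scaled_potential n (g : 'M[nat]_n) : R := n%:R `^ (2 * gap - 1) * potential g.
Definition tame n (g : 'M[nat]_n) : bool := scaled_potential g <= 1.

Local Notation TE k F := (trunc_expect P m n0 G tame k F).

Lemma gap_bounds : 0 < gap <= 1 / 16 /\ A = 1 - 16 * gap.
Proof.
have A1 := A_lt1; rewrite /gap; case/andP: A01 => A0 _.
by split; [apply/andP; split|]; lra. Qed.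

Lemma pace_gt0 : 0 < pace.
Proof. by rewrite divr_gt0 ?mulr_gt0 ?subr_gt0. Qed.

Lemma offset_ge0 : 0 <= offset.
Proof.
have [/andP[g0 g1] _] := gap_bounds.
apply: divr_ge0; last by lra.
apply: divr_ge0; last exact: ltW pace_gt0.
by rewrite addr_ge0 ?mulr_ge0 ?exprn_ge0.
Qed.

Lemma lyapunov_ge0 n (g : 'M[nat]_n) : 0 <= lyapunov pace g.
Proof.
apply: sumr_ge0 => v _; apply: divr_ge0; first exact: exprn_ge0.
by apply: addr_ge0 => //; apply: mulr_ge0 => //; exact: ltW pace_gt0.
Qed.

Lemma potential_ge0 n (g : 'M[nat]_n) : 0 <= potential g.
Proof. by rewrite addr_ge0 ?lyapunov_ge0 ?offset_ge0. Qed.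

Lemma N1n n : (N1 <= n)%N -> [/\ (n0 <= n)%N, (0 < n)%N & 2 <= n%:R * (1 - A)].
Proof.
move=> nn; have n0n : (n0 <= n)%N by exact: leq_trans nn.
split => //; first exact: leq_trans n0n.
apply: (le_trans N1_large); apply: ler_wpM2r; last by rewrite ler_nat.
by rewrite subr_ge0 ltW ?A_lt1.
Qed.

(** [offset] is chosen so that the additive term of [step_lyapunov] equals [(1 - 8 gap) offset / n]:
    once it is added, the drift is purely multiplicative. *)
Lemma cexpect_potential n (g : 'M[nat]_n) : (N1 <= n)%N -> possible P G g ->
  CE g (@potential n.+1) <= (1 + (1 - 8 * gap) / n%:R) * potential g.
Proof.
move=> nn pg; have [n0n n_gt0 nA] := N1n nn.
have gv := possible_valid hG n0n pg; have lw := law nn pg.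
have := step_lyapunov m_gt0 n_gt0 AB A01 C_gt0 gv lw A_lt1 nA.
rewrite -/pace /potential (stepD lw) (step_cst lw) => h.
have [/andP[g0 g1] Ag] := gap_bounds.
have n0R : 0 < n%:R :> R by rewrite ltr0n.
have e : (5 * m%:R ^+ 2 + 4 * m%:R * `|B|) / pace = (1 - 8 * gap) * offset.
  by rewrite /offset [RHS]mulrC divfK // gt_eqF //; lra.
rewrite e in h.
have L0 := lyapunov_ge0 g.
have h2 : A / n%:R * lyapunov pace g <= (1 - 8 * gap) / n%:R * lyapunov pace g.
  by rewrite ler_wpM2r // ler_pM2r ?invr_gt0 //; lra.
have e2 : (1 - 8 * gap) * offset / n%:R = (1 - 8 * gap) / n%:R * offset by ring.
by rewrite e2 in h; lra.
Qed.

Lemma expect_potential : exists2 M : R, 0 <= M &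
  \forall n \near \oo, E (@potential n) <= M * n%:R `^ (1 - 4 * gap).
Proof.
have [/andP[g0 g1] _] := gap_bounds.
apply: (@powR_comparison R (fun n => E (@potential n)) (1 - 8 * gap) _ 0); first by lra.
apply/nearP_oo; exists N1 => n nn; rewrite mul0r addr0.
have [n0n _ _] := N1n nn.
rewrite (expect_cexpect P hG) // -expectZ; apply: expect_le => g pg.
exact: cexpect_potential.
Qed.

Lemma scaled_potential_ge0 n (g : 'M[nat]_n) : 0 <= scaled_potential g.
Proof. by rewrite mulr_ge0 ?powR_ge0 ?potential_ge0. Qed.

(** The factor [n^(2 gap - 1)] decays at rate [(1 - 2 gap) / n], faster than the potential grows;
    the margin [6 gap / n] absorbs the second-order terms once [n] is large. *)
Lemma cexpect_scaled_potential : exists2 N, (N1 <= N)%N &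
  forall n (g : 'M[nat]_n), (N <= n)%N -> possible P G g ->
  CE g (@scaled_potential n.+1) <= scaled_potential g.
Proof.
have [/andP[g0 g1] _] := gap_bounds.
have /nearP_oo[N hN] := @near_natr_ge R (6 * gap)^-1.
exists (maxn N N1); first exact: leq_maxr.
move=> n g; rewrite geq_max => /andP[Nn nn] pg.
have [n0n n_gt0 _] := N1n nn; have n0R : 0 < n%:R :> R by rewrite ltr0n.
have lw := law nn pg.
rewrite /scaled_potential (stepZ lw).
apply: (le_trans (ler_wpM2l (powR_ge0 _ _) (cexpect_potential nn pg))).
rewrite mulrA; apply: ler_wpM2r; first exact: potential_ge0.
have p0 : 0 < (n%:R : R) `^ (1 - 2 * gap) by rewrite powR_gt0.
have p1 : 0 < (n.+1%:R : R) `^ (1 - 2 * gap) by rewrite powR_gt0 ?ltr0n.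
have -> : 2 * gap - 1 = - (1 - 2 * gap) by ring.
rewrite !powRN mulrC ler_pdivrMr // [leRHS]mulrC ler_pdivlMr // mulrC.
apply: le_trans (powR_succ_ge _ n_gt0); rewrite ler_pM2l //.
rewrite ger0_norm; last by lra.
have h := hN n Nn; rewrite -subr_ge0.
have -> : 1 + (1 - 2 * gap) / n%:R - (1 - 2 * gap) / n%:R ^+ 2 - (1 + (1 - 8 * gap) / n%:R)
   = (6 * gap * n%:R - (1 - 2 * gap)) / n%:R ^+ 2 by field; rewrite gt_eqF.
rewrite divr_ge0 ?exprn_ge0 // ?(ltW n0R) //.
have : 1 <= n%:R * (6 * gap) by rewrite -ler_pdivrMr ?mul1r //; lra.
lra.
Qed.

(** By [expect_potential] the scaled potential has mean [O(k^(- 2 gap))] at the starting time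
    [k]. *)
Lemma exit_small (e : R) : 0 < e -> exists2 k, (N1 <= k)%N &
  forall n, (k <= n)%N -> 1 - TE k (fun _ : 'M[nat]_n => 1) <= e.
Proof.
move=> e0; have [/andP[g0 g1] _] := gap_bounds.
have [N NN1 hN] := cexpect_scaled_potential.
have [M M0 /nearP_oo[N2 hN2]] := expect_potential.
have /nearP_oo[N3 hN3] := @near_powRN_le R (2 * gap) M e (mulr_gt0 (ltr0Sn R 1) g0) e0.
pose k := maxn N (maxn N2 N3); exists k; first by rewrite (leq_trans NN1) // leq_maxl.
move=> n kn.
have kN1 : (N1 <= k)%N by rewrite (leq_trans NN1) // leq_maxl.
have [n0k k_gt0 _] := N1n kN1.
apply: (@le_trans _ _ (E (@scaled_potential k))).
  apply: (trunc_expect_exit hG n0_gt0 (V := scaled_potential) _ n0k _ _ kn).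
  - by [].
  - by move=> *; exact: scaled_potential_ge0.
  - by move=> j g kj pg; apply: hN => //; rewrite (leq_trans _ kj) // leq_maxl.
have -> : E (@scaled_potential k) = k%:R `^ (2 * gap - 1) * E (@potential k) by rewrite -expectZ.
apply: (@le_trans _ _ (k%:R `^ (2 * gap - 1) * (M * k%:R `^ (1 - 4 * gap)))).
  by rewrite ler_wpM2l ?powR_ge0 // hN2 // /k !leq_max leqnn orbT.
rewrite mulrCA -powRD; last by rewrite pnatr_eq0 -lt0n k_gt0 implybT.
have -> : 2 * gap - 1 + (1 - 4 * gap) = - (2 * gap) by ring.
by apply: hN3; rewrite /k !leq_max leqnn !orbT.
Qed.

Definition tame_cst : R := 2 * m%:R + pace + 1.

(** All degrees are at most [2 m n], so [d^2] is at most [tame_cst n] times its summand in the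
    potential. The bound on a single degree follows, since one square is at most the sum of all. *)
Lemma tame_bounds k n (g : 'M[nat]_n) : (N1 <= n)%N -> (k <= n)%N -> possible P G g ->
  always tame k g ->
  moment R 2 g <= tame_cst ^+ 2 * n%:R `^ (2 - 2 * gap) /\
  forall v, (deg g v)%:R <= tame_cst * n%:R `^ (1 - gap).
Proof.
move=> nn kn pg ag; have [n0n n_gt0 _] := N1n nn; have n0R : 0 < n%:R :> R by rewrite ltr0n.
have gv := possible_valid hG n0n pg.
have p0 := pace_gt0.
have c1 : 1 <= tame_cst by rewrite /tame_cst; have := ler0n R m; lra.
have c0 : 0 <= tame_cst by lra.
have : tame g by exact: always_now ag.
have [/andP[g0 g1] _] := gap_bounds.
rewrite /tame /scaled_potential (_ : 2 * gap - 1 = - (1 - 2 * gap)); last by ring.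
rewrite powRN mulrC ler_pdivrMr ?powR_gt0 // mul1r => h.
have hl : lyapunov pace g <= n%:R `^ (1 - 2 * gap).
  by apply: le_trans h; rewrite lerDl offset_ge0.
have hm : moment R 2 g <= tame_cst * n%:R * lyapunov pace g.
  rewrite /moment /lyapunov mulr_sumr; apply: ler_sum => v _.
  have dn : (deg g v)%:R + pace * n%:R <= tame_cst * n%:R.
    have := @deg_le R m K n g gv v; rewrite /tame_cst; have := ltW n0R; lra.
  have d0 : 0 < (deg g v)%:R + pace * n%:R by rewrite ltr_wpDl ?ler0n // mulr_gt0.
  rewrite mulrCA ler_peMr ?exprn_ge0 //.
  by rewrite ler_pdivlMr // mul1r.
have cc : tame_cst <= tame_cst ^+ 2 by rewrite expr2 ler_peMl.
have h2 : moment R 2 g <= tame_cst ^+ 2 * n%:R `^ (2 - 2 * gap).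
  apply: (le_trans hm); apply: (@le_trans _ _ (tame_cst * n%:R * n%:R `^ (1 - 2 * gap))).
    by rewrite ler_wpM2l // mulr_ge0.
  have -> : 2 - 2 * gap = 1 + (1 - 2 * gap) by ring.
  rewrite [X in _ <= _ * X]powRD ?(gt_eqF n0R) ?implybT // powRr1 // [leRHS]mulrA.
  rewrite ler_wpM2r ?powR_ge0 //.
  by rewrite ler_wpM2r.
split => // v.
have := le_trans (@moment_pow R n g 2 v) h2.
have -> : tame_cst ^+ 2 * n%:R `^ (2 - 2 * gap) = (tame_cst * n%:R `^ (1 - gap)) ^+ 2.
  have -> : 2 - 2 * gap = (1 - gap) * 2 by ring.
  by rewrite powRrM powR_mulrn ?powR_ge0 // exprMn.
by rewrite ler_sqr ?nnegrE ?mulr_ge0 ?powR_ge0 ?ler0n.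
Qed.

(** Markov's inequality for [F] on the tame event; an exit after [k] costs the other half of [e].
    The time [k] is fixed before [n] tends to infinity, so [M] may depend on it. *)
Lemma whp_of_trunc (S : forall n, 'M[nat]_n -> bool) (F : forall n, 'M[nat]_n -> R)
    (v : nat -> R) :
  (forall k, (N1 <= k)%N -> exists M, \forall n \near \oo, TE k (F n) <= M * v n) ->
  v n @[n --> \oo] --> 0 ->
  (\forall n \near \oo, forall g : 'M[nat]_n, possible P G g ->
     0 <= F n g /\ (~~ S n g -> 1 <= F n g)) ->
  whp P (fun n => [set w | S n (G n w)]).
Proof.
move=> hF hv /nearP_oo[N4 hS]; apply/(whpP P hG) => e e0.
have e20 : 0 < e / 2 by rewrite divr_gt0.
have [k kN1 hk] := exit_small e20.
have [M /nearP_oo[N5 hM]] := hF k kN1.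
have [n0k _ _] := N1n kN1.
have hv' : M * v n @[n --> \oo] --> 0.
  by rewrite -[X in _ --> X](mulr0 M); apply: cvgMr.
have /cvgrPdist_le/(_ _ e20)/nearP_oo[N6 hN6] := hv'.
apply/nearP_oo; exists (maxn (maxn N4 N5) (maxn N6 k)) => n.
rewrite !geq_max => /andP[/andP[n4 n5] /andP[n6 nk]].
have nn : (n0 <= n)%N by exact: leq_trans nk.
rewrite (expect_indicator P hG (fun g => ~~ S n g) nn).
apply: (le_trans (trunc_expect_indicator P hG tame k (fun g => ~~ S n g) nn)).
have h1 : TE k (fun g : 'M[nat]_n => (~~ S n g)%:R) <= e / 2.
  apply: (@le_trans _ _ (TE k (F n))).
    apply: trunc_expect_le => g pg _; have [F0 F1] := hS n n4 g pg.
    by case: (S n g) F1 => //= F1; exact: F1.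
  apply: (le_trans (hM n n5)).
  by have := hN6 n n6; rewrite sub0r normrN => /(le_trans (ler_norm _)).
have h2 := hk n nk.
lra.
Qed.

(** * Drifts on the tame event *)

Definition surplus n (g : 'M[nat]_n) : R := (multiplicity_excess g)%:R + (loops g)%:R.

Lemma surplus_ge0 n (g : 'M[nat]_n) : 0 <= surplus g.
Proof. by rewrite addr_ge0. Qed.

Lemma tame_moment2 k n (g : 'M[nat]_n) : (N1 <= n)%N -> (k <= n)%N -> possible P G g ->
  always tame k g -> moment R 2 g / n%:R ^+ 2 <= tame_cst ^+ 2 * n%:R `^ (- (2 * gap)).
Proof.
move=> nn kn pg ag; have [_ n_gt0 _] := N1n nn.
have [h _] := tame_bounds nn kn pg ag.
by rewrite ler_pdivrMr ?exprn_gt0 ?ltr0n // -mulrA [_ * n%:R ^+ 2]mulrC -powR2D.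
Qed.

(** One factor is bounded by the maximal degree, and the remaining second moment is expressed
    through [P_2]. *)
Lemma tame_moment3 k n (g : 'M[nat]_n) : (N1 <= n)%N -> (k <= n)%N -> possible P G g ->
  always tame k g ->
  moment R 3 g <= 2 * (1 + m%:R) * tame_cst * (n%:R * n%:R `^ (- gap) * ((npaths2 g)%:R + n%:R)).
Proof.
move=> nn kn pg ag; have [n0n n_gt0 _] := N1n nn.
have gv := possible_valid hG n0n pg.
have [_ h] := tame_bounds nn kn pg ag.
have c0 : 0 <= tame_cst by have := pace_gt0; have := ler0n R m; rewrite /tame_cst; lra.
have m3 : moment R 3 g <= tame_cst * n%:R `^ (1 - gap) * moment R 2 g.
  rewrite /moment mulr_sumr; apply: ler_sum => v _.
  by rewrite exprS ler_wpM2r ?exprn_ge0 ?h.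
apply: (le_trans m3); rewrite (npaths2_moment R gv) powR1D //.
have -> : 2 * (1 + m%:R) * tame_cst * (n%:R * n%:R `^ (- gap) * ((npaths2 g)%:R + n%:R)) =
  tame_cst * (n%:R * n%:R `^ (- gap)) * (2 * (npaths2 g)%:R + 2 * (m%:R * n%:R))
  + tame_cst * (n%:R * n%:R `^ (- gap)) * (2 * n%:R + 2 * (m%:R * (npaths2 g)%:R)) by ring.
by rewrite lerDl; apply: mulr_ge0; rewrite ?addr_ge0 // !mulr_ge0 ?powR_ge0.
Qed.

Lemma tame_surplus : exists2 W, 0 <= W &
  forall k n (g : 'M[nat]_n), (N1 <= n)%N -> (k <= n)%N -> possible P G g ->
  always tame k g -> CE g (@surplus n.+1) <= surplus g + W * n%:R `^ (- (2 * gap)).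
Proof.
have C0 := ltW C_gt0.
exists ((1 + m%:R ^+ 2) * C * tame_cst ^+ 2).
  by rewrite mulr_ge0 ?sqr_ge0 // mulr_ge0 // addr_ge0 ?exprn_ge0.
move=> k n g nn kn pg ag; have [n0n n_gt0 _] := N1n nn.
have gv := possible_valid hG n0n pg; have lw := law nn pg.
have h1 := step_loops n_gt0 AB gv lw.
have h2 := step_multiplicity_excess lw.
have h3 := tame_moment2 nn kn pg ag.
have h4 : 0 <= (1 + m%:R ^+ 2) * C by rewrite mulr_ge0 // addr_ge0 ?exprn_ge0.
have := ler_wpM2l h4 h3; rewrite /surplus (stepD lw); lra.
Qed.

Lemma tame_ntriangles : exists2 W, 0 <= W &
  forall k n (g : 'M[nat]_n), (N1 <= n)%N -> (k <= n)%N -> possible P G g ->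
  always tame k g ->
  `|CE g (fun h => (ntriangles h)%:R - (ntriangles g)%:R - D)| <=
    `|D| / m%:R * (surplus g / n%:R) + W * n%:R `^ (- gap).
Proof.
have C0 := ltW C_gt0.
have c0 : 0 <= tame_cst by have := pace_gt0; have := ler0n R m; rewrite /tame_cst; lra.
pose W1 := C * (2 * tame_cst * K%:R * m%:R).
pose W2 := 2 * K%:R * m%:R ^+ 2 * (C * tame_cst ^+ 2).
have W10 : 0 <= W1 by rewrite !mulr_ge0.
have W20 : 0 <= W2 by rewrite !mulr_ge0 ?exprn_ge0.
exists (W1 + W2); first by rewrite addr_ge0.
move=> k n g nn kn pg ag; have [n0n n_gt0 _] := N1n nn.
have gv := possible_valid hG n0n pg; have lw := law nn pg.
have n0R : 0 < n%:R :> R by rewrite ltr0n.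
have [/andP[g0 g1] _] := gap_bounds.
rewrite !(stepB lw) !(step_cst lw).
apply: (le_trans (step_ntriangles m_gt0 n_gt0 A01 C_gt0 gv lw)).
rewrite -/(surplus g) -addrA lerD2l [leRHS]mulrDl; apply: lerD.
  have [_ db] := tame_bounds nn kn pg ag.
  have := edge_product_le gv db; rewrite -/K powR1D // => h.
  rewrite /W1 -!mulrA ler_pM2l // ler_pdivrMr ?exprn_gt0 //.
  apply: (le_trans h); move: (K%:R : R) (n%:R : R) (n%:R `^ _) => kk nr q.
  by rewrite le_eqVlt; apply/orP; left; apply/eqP; ring.
have h3 := tame_moment2 nn kn pg ag.
have h5 : tame_cst ^+ 2 * n%:R `^ (- (2 * gap)) <= tame_cst ^+ 2 * n%:R `^ (- gap).
  by apply: ler_wpM2l; [exact: exprn_ge0|apply: powRN_le => //; lra].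
have b0 : 0 <= 2 * K%:R * m%:R ^+ 2 * C by rewrite !mulr_ge0 ?exprn_ge0.
have := ler_wpM2l b0 (le_trans h3 h5); rewrite /W2 -/K; move: (K%:R : R) => kk; lra.
Qed.

Lemma tame_npaths2 (c := 2 * m%:R * (A + B) + m%:R * (m%:R - 1) / 2) : exists2 W, 0 <= W &
  forall k n (g : 'M[nat]_n), (N1 <= n)%N -> (k <= n)%N -> possible P G g ->
  always tame k g ->
  `|CE g (fun h => (npaths2 h)%:R) - ((1 + 2 * A / n%:R) * (npaths2 g)%:R + c)|
     <= W * (n%:R `^ (- gap) / n%:R * ((npaths2 g)%:R + n%:R)) /\
  CE g (fun h => ((npaths2 h)%:R - (npaths2 g)%:R) ^+ 2)
     <= W * (1 + n%:R `^ (- gap) * ((npaths2 g)%:R + n%:R)).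
Proof.
have C0 := ltW C_gt0; have /andP[A0 _] := A01.
have c0 : 0 <= tame_cst by have := pace_gt0; have := ler0n R m; rewrite /tame_cst; lra.
pose c3 := 2 * (1 + m%:R) * tame_cst.
have c30 : 0 <= c3 by apply: mulr_ge0 => //; apply: mulr_ge0 => //; exact: addr_ge0.
pose W1 := C * (1 + m%:R) ^+ 2 * c3.
pose W2 := 2 * m%:R * (A + `|B| + 2 * (C * m%:R)) * c3.
pose W3 : R := 18 * m%:R ^+ 4.
have W10 : 0 <= W1 by rewrite !mulr_ge0 ?sqr_ge0.
have W20 : 0 <= W2.
  by apply: mulr_ge0 => //; apply: mulr_ge0 => //; rewrite addr_ge0 ?mulr_ge0 // addr_ge0.
have W30 : 0 <= W3 by rewrite mulr_ge0 ?exprn_ge0.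
exists (W1 + W2 + W3); first by rewrite !addr_ge0.
move=> k n g nn kn pg ag; have [n0n n_gt0 _] := N1n nn.
have gv := possible_valid hG n0n pg; have lw := law nn pg.
have n0R : 0 < n%:R :> R by rewrite ltr0n.
have h3 := tame_moment3 nn kn pg ag; rewrite -/c3 in h3.
set q := n%:R `^ (- gap) in h3 *; set p := (npaths2 g)%:R + n%:R in h3 *.
have q0 : 0 <= q by exact: powR_ge0.
have p0 : 0 <= p by rewrite addr_ge0.
have pq : 0 <= q * p by rewrite mulr_ge0.
split.
  apply: (le_trans (step_npaths2 m_gt0 n_gt0 AB C_gt0 gv lw)).
  have z0 : 0 <= q / n%:R * p by rewrite mulr_ge0 // divr_ge0 // ltW.
  have h4 : moment R 3 g / n%:R ^+ 2 <= c3 * (q / n%:R * p).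
    rewrite ler_pdivrMr ?exprn_gt0 // (le_trans h3) //.
    by rewrite le_eqVlt; apply/orP; left; apply/eqP; field; rewrite gt_eqF.
  have := ler_wpM2l (mulr_ge0 C0 (sqr_ge0 (1 + m%:R))) h4.
  have := mulr_ge0 W20 z0; have := mulr_ge0 W30 z0; rewrite /W1; lra.
apply: (le_trans (step_npaths2_sqr m_gt0 n_gt0 A01 C_gt0 gv lw)).
have h4 : moment R 3 g / n%:R <= c3 * (q * p).
  rewrite ler_pdivrMr // (le_trans h3) //.
  by rewrite le_eqVlt; apply/orP; left; apply/eqP; ring.
have b0 : 0 <= 2 * m%:R * (A + `|B| + 2 * (C * m%:R)).
  by apply: mulr_ge0 => //; rewrite addr_ge0 ?mulr_ge0 // addr_ge0.
have := ler_wpM2l b0 h4.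
have := mulr_ge0 W10 pq; have := mulr_ge0 W30 pq; rewrite /W2 /W3 in W20 W30 *.
lra.
Qed.

(** * Recursions for the truncated moments *)

Lemma ntriangles_linear : exists2 W : R, 0 <= W &
  forall n (g : 'M[nat]_n), (n0 <= n)%N -> possible P G g -> (ntriangles g)%:R <= W * n%:R.
Proof.
have [_ [g0 _ Gg0] Gstep] := hG.
pose W : R := (ntriangles g0)%:R + K%:R * m%:R ^+ 2.
have K0 : 0 <= K%:R * m%:R ^+ 2 :> R by rewrite mulr_ge0 ?exprn_ge0.
have W0 : 0 <= W by rewrite addr_ge0.
exists W => // n g nn /possible_ex[w <-].
elim: n g nn => [|n IH] _.
  by rewrite leqNgt n0_gt0.
rewrite leq_eqVlt => /orP[/eqP <-|].
  rewrite Gg0; apply: (@le_trans _ _ W); first by rewrite lerDl.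
  by rewrite ler_peMr // ler1n.
rewrite ltnS => nn; have gv := process_valid hG w nn.
have /andP[_ h] := ntriangles_step_le R gv (Gstep n w nn).
apply: (le_trans h); rewrite -natr1 mulrDr mulr1; apply: lerD; first exact: IH (G n w) nn.
by rewrite lerDr.
Qed.

Lemma trunc_surplus k : (N1 <= k)%N -> exists2 M : R, 0 <= M &
  \forall n \near \oo, TE k (@surplus n) <= M * n%:R `^ (1 - 2 * gap).
Proof.
move=> kN1; have [/andP[g0 g1] _] := gap_bounds.
have [W W0 hW] := tame_surplus.
apply: (@powR_comparison R (fun n => TE k (@surplus n)) 0 _ W); first by lra.
apply/nearP_oo; exists k => n kn; have nn := leq_trans kN1 kn.
have [n0n n_gt0 _] := N1n nn.
have -> : 1 - 2 * gap - 1 = - (2 * gap) by ring.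
rewrite mul0r addr0 mul1r.
apply: (@le_trans _ _ (TE k (fun g => surplus g + W * n%:R `^ (- (2 * gap))))).
  apply: (trunc_expect_step hG) => // [g pg h gh|g pg ag]; first exact: surplus_ge0.
  exact: hW ag.
rewrite trunc_expectD lerD2l; apply: (trunc_expect_cst P hG) => //.
by rewrite mulr_ge0 ?powR_ge0.
Qed.

(** For the deviation [z] and its increment [w], the cross term [2 z w] is controlled by the crude
    bound [|z| = O(n)] and the drift error [surplus / n + n^(- gap)]; by [trunc_surplus] its mean is
    [O(n^(1 - gap))]. The square of [w] is bounded. *)
Lemma trunc_ntriangles k : (N1 <= k)%N -> exists2 M : R, 0 <= M &
  \forall n \near \oo,
    TE k (fun g : 'M[nat]_n => ((ntriangles g)%:R - D * n%:R) ^+ 2) <= M * n%:R `^ (2 - gap).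
Proof.
move=> kN1; have [/andP[g0 g1] _] := gap_bounds.
have [W W0 hW] := tame_ntriangles.
have [V V0 hV] := ntriangles_linear.
have [M M0 /nearP_oo[N2 hM]] := trunc_surplus kN1.
pose L := V + `|D|; have L0 : 0 <= L by rewrite addr_ge0.
pose Q := (K%:R * m%:R ^+ 2 + `|D|) ^+ 2 : R.
have Q0 : 0 <= Q by exact: sqr_ge0.
pose a := 2 * L * (`|D| / m%:R); have a0 : 0 <= a by rewrite !mulr_ge0 ?divr_ge0.
apply: (@powR_comparison R (fun n => TE k (fun g : 'M[nat]_n => ((ntriangles g)%:R - D * n%:R) ^+ 2))
  0 _ (a * M + 2 * L * W + Q)); first by lra.
apply/nearP_oo; exists (maxn k N2) => n; rewrite geq_max => /andP[kn n2].
have nn := leq_trans kN1 kn; have [n0n n_gt0 _] := N1n nn.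
have n0R : 0 < n%:R :> R by rewrite ltr0n.
have -> : 2 - gap - 1 = 1 + - gap by ring.
rewrite powR1D // mul0r addr0 mul1r.
set q := n%:R `^ (- gap).
have q0 : 0 <= q by exact: powR_ge0.
have nq1 : 1 <= n%:R * q.
  by rewrite -powR1D // -[X in X <= _](powRr0 (n%:R : R)) ler_powR ?ler1n //; lra.
apply: (@le_trans _ _ (TE k (fun g => ((ntriangles g)%:R - D * n%:R) ^+ 2
     + (a * surplus g + (2 * L * W * (n%:R * q) + Q))))).
  apply: (trunc_expect_step hG) => // [g pg h gh|g pg ag]; first exact: sqr_ge0.
  have lw := law nn pg; have gv := possible_valid hG n0n pg.
  set z := (ntriangles g)%:R - D * n%:R.
  pose w (h : 'M[nat]_n.+1) := (ntriangles h)%:R - (ntriangles g)%:R - D : R.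
  have zL : `|z| <= L * n%:R.
    rewrite (le_trans (ler_normB _ _)) // /L mulrDl lerD //.
      by rewrite ger0_norm // hV.
    by rewrite normrM (ger0_norm (ltW n0R)).
  apply: (@le_trans _ _ (CE g (fun h => z ^+ 2 + (2 * z * w h + Q)))).
    apply: (step_le lw) => h gh.
    have -> : (ntriangles h)%:R - D * n.+1%:R = z + w h by rewrite /z /w -natr1; ring.
    have wQ : w h ^+ 2 <= Q.
      rewrite -[w h ^+ 2](real_normK (num_real _)) /Q ler_sqr ?nnegrE ?addr_ge0 ?mulr_ge0 ?exprn_ge0 //.
      rewrite (le_trans (ler_normB _ _)) // lerD2r.
      have /andP[t0 t1] := ntriangles_step_le R gv gh.
      by rewrite ger0_norm ?subr_ge0 // lerBlDl.
    have -> : (z + w h) ^+ 2 = z ^+ 2 + (2 * z * w h + w h ^+ 2) by ring.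
    by rewrite !lerD2l.
  have -> : CE g (fun h => z ^+ 2 + (2 * z * w h + Q)) = z ^+ 2 + (2 * z * CE g w + Q).
    by rewrite (stepD lw) (step_cst lw) (stepD lw) (stepZ lw) (step_cst lw).
  rewrite lerD2l addrA lerD2r.
  have := hW k n g nn kn pg ag; rewrite -/w -/q => hw.
  apply: (le_trans (ler_norm _)); rewrite !normrM ger0_norm //.
  apply: (@le_trans _ _ (2 * (L * n%:R) * (`|D| / m%:R * (surplus g / n%:R) + W * q))).
    by apply: ler_pM => //; rewrite ler_pM2l.
  by rewrite le_eqVlt; apply/orP; left; apply/eqP; rewrite /a; field; rewrite !gt_eqF // ltr0n.
rewrite (trunc_expectD P m n0 G tame k (fun g => ((ntriangles g)%:R - D * n%:R) ^+ 2)) lerD2l.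
rewrite (trunc_expectD P m n0 G tame k (fun g => a * surplus g)) trunc_expectZ.
rewrite (trunc_expectD P m n0 G tame k (fun=> 2 * L * W * (n%:R * q))).
have h1 := hM n n2.
have h2 : n%:R `^ (1 - 2 * gap) <= n%:R * q.
  by rewrite -powR1D // ler_powR ?ler1n //; lra.
have c0 : 0 <= 2 * L * W * (n%:R * q) by rewrite !mulr_ge0 // ltW.
have h3 : TE k (fun _ : 'M[nat]_n => 2 * L * W * (n%:R * q)) <= 2 * L * W * (n%:R * q).
  exact: (trunc_expect_cst P hG).
have h4 : TE k (fun _ : 'M[nat]_n => Q) <= Q by exact: (trunc_expect_cst P hG).
have h5 : a * TE k (@surplus n) <= a * (M * (n%:R * q)).
  by rewrite ler_wpM2l // (le_trans h1) // ler_wpM2l.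
have h6 : Q <= Q * (n%:R * q) by rewrite ler_peMr.
lra.
Qed.

(** [b] is an approximate solution of the mean recursion of [P_2]; the square of the deviation from
    it grows at twice the rate [2 A / n]. The bound [n^(1 + gap / 4)] on [b] admits both linear
    sequences and [n log n]. *)
Lemma trunc_npaths2_dev (c := 2 * m%:R * (A + B) + m%:R * (m%:R - 1) / 2)
    (b : nat -> R) (Kb : R) k :
  (N1 <= k)%N -> 0 <= Kb ->
  (\forall n \near \oo, `|b n| <= Kb * n%:R `^ (1 + gap / 4) /\
     `|b n.+1 - (1 + 2 * A / n%:R) * b n - c| <= Kb * n%:R `^ (- gap)) ->
  exists2 W : R, 0 <= W & \forall n \near \oo,
    TE k (fun g : 'M[nat]_n.+1 => ((npaths2 g)%:R - b n.+1) ^+ 2) <=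
    (1 + (4 * A + W * n%:R `^ (- (gap / 2))) / n%:R) *
      TE k (fun g : 'M[nat]_n => ((npaths2 g)%:R - b n) ^+ 2)
    + W * n%:R `^ (1 - gap / 2).
Proof.
move=> kN1 Kb0 /nearP_oo[N2 hb].
have [/andP[g0 g1] _] := gap_bounds; have /andP[A0 A1] := A01.
have [W W0 hW] := tame_npaths2; rewrite -/c in hW.
pose Kc := 3 * Kb + `|c|; have Kc0 : 0 <= Kc by rewrite addr_ge0 ?mulr_ge0.
pose Kp := W * (Kb + 1) + Kb; have Kp0 : 0 <= Kp by rewrite addr_ge0 ?mulr_ge0 ?addr_ge0.
pose V := 3 * W + Kp + 2 * W * (Kb + 2) + 2 * Kc ^+ 2.
have V0 : 0 <= V.
  by have := mulr_ge0 W0 Kb0; have := sqr_ge0 Kc; rewrite /V; lra.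
exists V => //.
apply/nearP_oo; exists (maxn k N2) => n; rewrite geq_max => /andP[kn n2].
have nn := leq_trans kN1 kn; have [n0n n_gt0 _] := N1n nn.
have n0R : 0 < n%:R :> R by rewrite ltr0n.
have [hb1 hb2] := hb n n2.
(* Up to integer powers of [n], all powers that occur are integer powers of [t], which makes the
   remaining estimates algebraic. *)
pose t : R := n%:R `^ (- (gap / 4)).
have t0 : 0 < t by rewrite powR_gt0.
have t1 : t <= 1 by rewrite -(powRr0 (n%:R : R)) ler_powR ?ler1n //; lra.
have tX j : t ^+ j = n%:R `^ (- (gap / 4) * j%:R) by rewrite powRrM powR_mulrn // powR_ge0.
have t4 : n%:R `^ (- gap) = t ^+ 4 by rewrite tX; congr (_ `^ _); lra.
have t2 : n%:R `^ (- (gap / 2)) = t ^+ 2 by rewrite tX; congr (_ `^ _); lra.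
have tv : n%:R `^ (1 + gap / 4) = n%:R / t by rewrite powR1D // /t powRN invrK.
have t2' : n%:R `^ (1 - gap / 2) = n%:R * t ^+ 2 by rewrite powR1D // t2.
have nt4 : 1 <= n%:R * t ^+ 4.
  by rewrite -t4 -powR1D // -[X in X <= _](powRr0 (n%:R : R)) ler_powR ?ler1n //; lra.
rewrite t2 t2'; rewrite tv in hb1; rewrite t4 in hb2.
have tv1 : 1 <= t^-1 by rewrite invf_ge1.
have t42 : t ^+ 4 <= t ^+ 2 by rewrite ler_wiXn2l // ltW.
have t32 : t ^+ 3 <= t ^+ 2 by rewrite ler_wiXn2l // ltW.
have t20 : 0 <= t ^+ 2 by rewrite exprn_ge0 ?ltW.
have t30 : 0 <= t ^+ 3 by rewrite exprn_ge0 ?ltW.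
have t40 : 0 <= t ^+ 4 by rewrite exprn_ge0 ?ltW.
have bb : `|b n.+1 - b n| <= Kc / t.
  have -> : b n.+1 - b n = (b n.+1 - (1 + 2 * A / n%:R) * b n - c) + (2 * A / n%:R * b n + c) by ring.
  rewrite (le_trans (ler_normD _ _)) //.
  have h1 : `|2 * A / n%:R * b n + c| <= 2 * (Kb / t) + `|c|.
    rewrite (le_trans (ler_normD _ _)) // lerD2r normrM.
    rewrite (ger0_norm (_ : 0 <= 2 * A / n%:R)); last by rewrite divr_ge0 ?mulr_ge0.
    apply: (@le_trans _ _ (2 / n%:R * (Kb * (n%:R / t)))).
      apply: ler_pM => //; first by rewrite divr_ge0 ?mulr_ge0.
      by rewrite ler_pM2r ?invr_gt0 //; lra.
    by rewrite le_eqVlt; apply/orP; left; apply/eqP; field; rewrite !gt_eqF.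
  have h2 : Kb * t ^+ 4 <= Kb / t.
    by apply: ler_wpM2l => //; apply: le_trans tv1; rewrite exprn_ile1 // ltW.
  have h3 : `|c| <= `|c| / t by rewrite ler_peMr.
  rewrite /Kc; lra.
apply: (@le_trans _ _ (TE k (fun g : 'M[nat]_n => (1 + (4 * A + V * t ^+ 2) / n%:R) *
    ((npaths2 g)%:R - b n) ^+ 2 + V * (n%:R * t ^+ 2)))); last first.
  rewrite (trunc_expectD P m n0 G tame k
    (fun g => (1 + (4 * A + V * t ^+ 2) / n%:R) * ((npaths2 g)%:R - b n) ^+ 2)) trunc_expectZ.
  rewrite lerD2l; apply: (trunc_expect_cst P hG) => //.
  by rewrite !mulr_ge0 // ltW.
apply: (trunc_expect_step hG) => // [g pg h gh|g pg ag]; first exact: sqr_ge0.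
have lw := law nn pg.
have [] := hW k n g nn kn pg ag; rewrite t4.
set p : R := (npaths2 g)%:R => hp1 hp2; set z := p - b n.
pose X (h : 'M[nat]_n.+1) : R := (npaths2 h)%:R - p.
pose be := b n.+1 - b n.
have p0 : 0 <= p by exact: ler0n.
have pz : p + n%:R <= `|z| + (Kb + 1) * (n%:R / t).
  have h1 : p <= `|z| + `|b n|.
    have -> : p = z + b n by rewrite /z; ring.
    by rewrite (le_trans (ler_norm _)) // ler_normD.
  have h2 : n%:R <= n%:R / t by rewrite ler_peMr // ltW.
  lra.
have EX : CE g X = CE g (fun h => (npaths2 h)%:R) - p by rewrite (stepB lw) (step_cst lw).
pose e2 := CE g X - be - 2 * A / n%:R * z.
have he2 : `|e2| <= W * (t ^+ 4 / n%:R * `|z|) + Kp * t ^+ 3.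
  have -> : e2 = (CE g (fun h => (npaths2 h)%:R) - ((1 + 2 * A / n%:R) * p + c)) -
     (b n.+1 - (1 + 2 * A / n%:R) * b n - c) by rewrite /e2 EX /be /z; ring.
  rewrite (le_trans (ler_normB _ _)) //.
  have tn0 : 0 <= t ^+ 4 / n%:R by rewrite divr_ge0 // ltW.
  have h1 := ler_wpM2l (mulr_ge0 W0 tn0) pz.
  have h2 : W * (t ^+ 4 / n%:R) * ((Kb + 1) * (n%:R / t)) = W * (Kb + 1) * t ^+ 3.
    by field; rewrite !gt_eqF.
  have h3 : Kb * t ^+ 4 <= Kb * t ^+ 3 by rewrite ler_wpM2l // ler_wiXn2l // ltW.
  rewrite /Kp; lra.
have hX2 : CE g (fun h => X h ^+ 2) <= W * (1 + t ^+ 4 * (p + n%:R)) by exact: hp2.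
apply: (@le_trans _ _ (CE g (fun h =>
    (z ^+ 2 - 2 * z * be + 2 * be ^+ 2) + (2 * z * X h + 2 * X h ^+ 2)))).
  apply: (step_le lw) => h gh.
  have -> : (npaths2 h)%:R - b n.+1 = z + (X h - be) by rewrite /z /X /be; ring.
  have : 0 <= (X h + be) ^+ 2 by exact: sqr_ge0.
  by rewrite !expr2; lra.
have -> : CE g (fun h => (z ^+ 2 - 2 * z * be + 2 * be ^+ 2) + (2 * z * X h + 2 * X h ^+ 2)) =
   z ^+ 2 - 2 * z * be + 2 * be ^+ 2 + (2 * z * CE g X + 2 * CE g (fun h => X h ^+ 2)).
  by rewrite (stepD lw) (step_cst lw) (stepD lw) !(stepZ lw).
have be2 : be ^+ 2 <= Kc ^+ 2 * (n%:R * t ^+ 2).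
  apply: (@le_trans _ _ ((Kc / t) ^+ 2)).
    by rewrite -[be ^+ 2](real_normK (num_real _)) ler_sqr ?nnegrE // divr_ge0 // ltW.
  rewrite exprMn ler_wpM2l ?sqr_ge0 // exprVn -[X in X <= _]mul1r ler_pdivrMr ?exprn_gt0 //.
  by rewrite -mulrA -exprD.
have ze2 : 2 * z * e2 <= 2 * (W * (t ^+ 4 / n%:R * z ^+ 2)) + 2 * (Kp * (`|z| * t ^+ 3)).
  apply: (le_trans (ler_norm _)); rewrite !normrM ger0_norm //.
  have := ler_wpM2l (mulr_ge0 (ler0n R 2) (normr_ge0 z)) he2.
  have -> : z ^+ 2 = `|z| ^+ 2 by rewrite (real_normK (num_real _)).
  rewrite expr2; lra.
(* Arithmetic-geometric mean inequality: the term linear in [|z|] becomes a small multiple of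
   [z^2 / n] plus a remainder of lower order than [n]. *)
have f1 : 2 * (`|z| * t ^+ 3) <= z ^+ 2 * t ^+ 2 / n%:R + n%:R * t ^+ 4.
  have : 0 <= (`|z| * t - n%:R * t ^+ 2) ^+ 2 / n%:R by rewrite divr_ge0 ?sqr_ge0 // ltW.
  have -> : (`|z| * t - n%:R * t ^+ 2) ^+ 2 / n%:R =
     `|z| ^+ 2 * t ^+ 2 / n%:R + n%:R * t ^+ 4 - 2 * (`|z| * t ^+ 3) by field; rewrite gt_eqF.
  by rewrite (real_normK (num_real _)) subr_ge0.
have z20 : 0 <= z ^+ 2 / n%:R by rewrite divr_ge0 ?sqr_ge0 // ltW.
have zt3 : 0 <= `|z| * t ^+ 3 by rewrite mulr_ge0.
have n0' := ltW n0R.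
set Y := z ^+ 2 / n%:R * t ^+ 2; set U := n%:R * t ^+ 2.
have Y0 : 0 <= Y by rewrite mulr_ge0.
have U0 : 0 <= U by rewrite mulr_ge0.
have f2 : 2 * (`|z| * t ^+ 3) <= Y + U.
  apply: (le_trans f1); apply: lerD; first by rewrite /Y mulrAC.
  by rewrite ler_wpM2l.
have f3 : t ^+ 4 / n%:R * z ^+ 2 <= Y.
  have -> : t ^+ 4 / n%:R * z ^+ 2 = z ^+ 2 / n%:R * t ^+ 4 by ring.
  by rewrite ler_wpM2l.
have f4 : 1 + t ^+ 4 * (p + n%:R) <= Y + (Kb + 2) * U + U.
  have h1 := ler_wpM2l t40 pz.
  have h2 : t ^+ 4 * ((Kb + 1) * (n%:R / t)) <= (Kb + 1) * U.
    have -> : t ^+ 4 * ((Kb + 1) * (n%:R / t)) = (Kb + 1) * (n%:R * t ^+ 3) by field; rewrite gt_eqF.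
    by rewrite ler_wpM2l ?addr_ge0 // ler_wpM2l.
  have h3 : 1 <= U by apply: (le_trans nt4); rewrite ler_wpM2l.
  have h4 : t ^+ 4 * `|z| <= `|z| * t ^+ 3.
    by rewrite mulrC ler_wpM2l // ler_wiXn2l // ltW.
  lra.
have g2 := ler_wpM2l Kp0 f2; have g3 := ler_wpM2l W0 f3; have g4 := ler_wpM2l W0 f4.
have -> : (1 + (4 * A + V * t ^+ 2) / n%:R) * z ^+ 2 + V * U =
   z ^+ 2 + 4 * A / n%:R * z ^+ 2 + V * Y + V * U by rewrite /Y; ring.
have -> : z ^+ 2 - 2 * z * be + 2 * be ^+ 2 + (2 * z * CE g X + 2 * CE g (fun h => X h ^+ 2)) =
  z ^+ 2 + 4 * A / n%:R * z ^+ 2 + 2 * z * e2 + 2 * be ^+ 2 + 2 * CE g (fun h => X h ^+ 2).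
  by rewrite /e2; field; rewrite gt_eqF.
have k1 := mulr_ge0 Kp0 Y0; have k2 := mulr_ge0 W0 Y0; have k3 := mulr_ge0 W0 U0.
have k4 := mulr_ge0 (sqr_ge0 Kc) Y0; have k5 := mulr_ge0 (mulr_ge0 W0 Kb0) U0.
have k6 := mulr_ge0 (mulr_ge0 W0 Kb0) Y0; have k7 := mulr_ge0 Kp0 U0.
rewrite -/U in be2; rewrite /V; lra.
Qed.

End Survival.

(** * Triangles and pairs of adjacent edges *)

Section Asymptotics.
Context {d : measure_display} {T : measurableType d} {R : realType}.
Variables (P : probability T R) (m n0 N1 : nat) (A B C D : R).
Variable G : forall n : nat, T -> 'M[nat]_n.
Hypothesis m_gt0 : (0 < m)%N.
Hypothesis n0_gt0 : (0 < n0)%N.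
Hypothesis AB : 2 * m%:R * A + B = m%:R.
Hypothesis A01 : 0 <= A <= 1.
Hypothesis A_lt1 : A < 1.
Hypothesis D_gt0 : 0 < D.
Hypothesis hG : growth_process G m n0.
Hypothesis C_gt0 : 0 < C.
Hypothesis N1_ge : (n0 <= N1)%N.
Hypothesis N1_large : 2 <= N1%:R * (1 - A).
Hypothesis law : forall n (g : 'M[nat]_n), (N1 <= n)%N -> possible P G g ->
  step_law m A B C D g (@cexpect _ _ _ P m n0 G n g).

Local Notation CE g F := (cexpect P m n0 G g F).
Local Notation TE k F := (trunc_expect P m n0 G (tame m A B C) k F).
Let c := 2 * m%:R * (A + B) + m%:R * (m%:R - 1) / 2.
Let gp := gap A.

Let gp_bounds : 0 < gp <= 1 / 16.
Proof. by have [] := gap_bounds A01 A_lt1. Qed.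

Let of_trunc := whp_of_trunc m_gt0 n0_gt0 AB A01 A_lt1 hG C_gt0 N1_ge N1_large law.

(** Chebyshev's inequality on the tame event; [v] bounds the resulting probability up to a
    constant. *)
Lemma whp_deviation (X : forall n, 'M[nat]_n -> R) (b f v : nat -> R) :
  (\forall n \near \oo, 0 < b n /\ 0 < f n) -> v n @[n --> \oo] --> 0 ->
  (forall k, (N1 <= k)%N -> exists M, \forall n \near \oo,
     TE k (fun g : 'M[nat]_n => (X n g - b n) ^+ 2) <= M * (v n * (f n * b n) ^+ 2)) ->
  whp P (fun n => [set w | `|X n (G n w) - b n| <= f n * b n]).
Proof.
move=> /nearP_oo[N hN] v0 hX.
apply: (of_trunc (S := fun n g => `|X n g - b n| <= f n * b n)
  (F := fun n g => (f n * b n) ^- 2 * (X n g - b n) ^+ 2) _ v0).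
  move=> k /hX[M /nearP_oo[N2 hM]]; exists M.
  apply/nearP_oo; exists (maxn N N2) => n; rewrite geq_max => /andP[n1 n2].
  have [b0 f0] := hN n n1; have s0 : 0 < (f n * b n) ^+ 2 by rewrite exprn_gt0 ?mulr_gt0.
  rewrite trunc_expectZ mulrC ler_pdivrMr // -mulrA; exact: hM.
apply/nearP_oo; exists N => n Nn g pg; have [b0 f0] := hN n Nn.
have s0 : 0 < f n * b n by rewrite mulr_gt0.
split; first by rewrite mulr_ge0 ?sqr_ge0 // invr_ge0 exprn_ge0 // ltW.
rewrite -ltNge => h; rewrite mulrC ler_pdivlMr ?exprn_gt0 // mul1r.
by rewrite -[leRHS](real_normK (num_real _)) ler_sqr ?nnegrE ?(ltW s0) // ltW.
Qed.

Lemma whp_ntriangles :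
  whp P (fun n => [set w | `|(ntriangles (G n w))%:R - D * n%:R| <= n%:R `^ (- (gp / 4)) * (D * n%:R)]).
Proof.
have /andP[g0 g1] := gp_bounds.
apply: (@whp_deviation (fun n g => (ntriangles g)%:R) (fun n => D * n%:R)
   (fun n => n%:R `^ (- (gp / 4))) (fun n => n%:R `^ (- (gp / 2)))).
- apply/nearP_oo; exists 1%N => n n1; have n0R : 0 < n%:R :> R by rewrite ltr0n.
  by rewrite mulr_gt0 // powR_gt0.
- by apply: cvg_powRN; rewrite divr_gt0.
move=> k kN1.
have [M M0 /nearP_oo[N hM]] :=
  trunc_ntriangles m_gt0 n0_gt0 AB A01 A_lt1 hG C_gt0 N1_ge N1_large law kN1.
exists (M / D ^+ 2); apply/nearP_oo; exists (maxn N 1) => n; rewrite geq_max => /andP[n1 n2].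
apply: (le_trans (hM n n1)); rewrite le_eqVlt; apply/orP; left; apply/eqP.
rewrite -/gp powR2D //.
have n0n : (n%:R : R) != 0 by rewrite pnatr_eq0 -lt0n.
have -> : - gp = - (gp / 2) + (- (gp / 4) + - (gp / 4)) by lra.
rewrite !powRD ?n0n ?implybT //.
by field; rewrite gt_eqF.
Qed.

Lemma whp_npaths2_sublinear : 2 * A < 1 -> 0 < c ->
  exists2 f : nat -> R, f n @[n --> \oo] --> 0 &
  whp P (fun n => [set w | `|(npaths2 (G n w))%:R - c / (1 - 2 * A) * n%:R|
     <= f n * (c / (1 - 2 * A) * n%:R)]).
Proof.
move=> A2 c0; have /andP[g0 g1] := gp_bounds; have /andP[A0 _] := A01.
pose be := c / (1 - 2 * A); have be0 : 0 < be by rewrite divr_gt0 ?subr_gt0.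
(* [2 - gp / 2] is imposed by the noise, and [1 + 2 A] exceeds the rate [4 A + (1 - 2 A) / 2] used
   below; both are less than 2. *)
pose r := Num.max (2 - gp / 2) (1 + 2 * A) .
have r2 : r < 2 by rewrite gt_max; apply/andP; split; lra.
have r1 : 2 - gp / 2 <= r by rewrite le_max lexx.
have rA : 1 + 2 * A <= r by rewrite le_max lexx orbT.
(* The margin [2 - r] is divided into [2 s] for the probability and [s + s] for the square of the
   relative error. *)
pose s := (2 - r) / 4; have s0 : 0 < s by rewrite divr_gt0 ?subr_gt0.
exists (fun n => n%:R `^ (- s)); first exact: cvg_powRN.
apply: (@whp_deviation (fun n g => (npaths2 g)%:R) (fun n => be * n%:R)
   (fun n => n%:R `^ (- s)) (fun n => n%:R `^ (- (2 * s)))).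
- apply/nearP_oo; exists 1%N => n n1; have n0R : 0 < n%:R :> R by rewrite ltr0n.
  by rewrite mulr_gt0 // powR_gt0.
- by apply: cvg_powRN; rewrite mulr_gt0.
move=> k kN1.
have hb : \forall n \near \oo, `|be * n%:R| <= be * n%:R `^ (1 + gp / 4) /\
     `|be * n.+1%:R - (1 + 2 * A / n%:R) * (be * n%:R) - c| <= be * n%:R `^ (- gp).
  apply/nearP_oo; exists 1%N => n n1; have n0R : 0 < n%:R :> R by rewrite ltr0n.
  split.
    rewrite ger0_norm; last by rewrite mulr_ge0 // ltW.
    apply: ler_wpM2l; first exact: ltW.
    by rewrite -[X in X <= _]powRr1 // ler_powR ?ler1n //; lra.
  rewrite [X in `|X|](_ : _ = 0).
    by rewrite normr0; apply: mulr_ge0; [exact: ltW|exact: powR_ge0].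
  have <- : be * (1 - 2 * A) = c by rewrite /be divfK // gt_eqF // subr_gt0.
  by rewrite -natr1; field; rewrite gt_eqF.
have [W W0 hW] :=
  trunc_npaths2_dev m_gt0 n0_gt0 AB A01 A_lt1 hG C_gt0 N1_ge N1_large law kN1 (ltW be0) hb.
pose Z n := TE k (fun g : 'M[nat]_n => ((npaths2 g)%:R - be * n%:R) ^+ 2).
have [M M0 /nearP_oo[N hM]] : exists2 M : R, 0 <= M & \forall n \near \oo, Z n <= M * n%:R `^ r.
  apply: (@powR_comparison R Z (4 * A + (1 - 2 * A) / 2) r W); first by lra.
  have d0 : 0 < (1 - 2 * A) / 2 by lra.
  have gp2 : 0 < gp / 2 by lra.
  have /nearP_oo[N hN] := near_powRN_le W gp2 d0.
  have /nearP_oo[N2 hN2] := hW.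
  apply/nearP_oo; exists (maxn (maxn N N2) (maxn k 1)) => n.
  rewrite !geq_max => /andP[/andP[nN n2] /andP[nk n1]].
  have n0R : 0 < n%:R :> R by rewrite ltr0n.
  apply: (le_trans (hN2 n n2)); apply: lerD; last first.
    by rewrite ler_wpM2l // ler_powR ?ler1n // -/gp; lra.
  apply: ler_wpM2r.
    by apply: trunc_expect_ge0 => g _ _; exact: sqr_ge0.
  by rewrite lerD2l ler_pM2r ?invr_gt0 // lerD2l; exact: hN.
exists (M / be ^+ 2); apply/nearP_oo; exists (maxn N 1) => n; rewrite geq_max => /andP[n1 n2].
apply: (le_trans (hM n n1)); rewrite le_eqVlt; apply/orP; left; apply/eqP.
have n0n : (n%:R : R) != 0 by rewrite pnatr_eq0 -lt0n.
have -> : r = 2 + (- (2 * s) + (- s + - s)) by rewrite /s; lra.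
rewrite powR2D // !powRD ?n0n ?implybT //.
by field; rewrite gt_eqF.
Qed.

(* The second moment of the deviation is bounded by n^2 log n, a sequence that
   absorbs the summable perturbation W n^(- gp / 2) of the rate 2 / n. *)
Lemma whp_npaths2_critical : 2 * A = 1 -> 0 < c ->
  whp P (fun n => [set w | `|(npaths2 (G n w))%:R - c * (n%:R * ln n%:R)|
     <= (ln n%:R) `^ (- 4^-1) * (c * (n%:R * ln n%:R))]).
Proof.
move=> A2 c0; have /andP[g0 g1] := gp_bounds.
have /nearP_oo[N0 hN0] := near_ln_ge (1 : R).
have ln1 n : (N0 <= n)%N -> 1 <= ln (n%:R : R) by move=> /hN0.
have gp4 : 0 < gp / 4 by lra.
(* The quotient of [n^2 log n] by [(n log n)^2] is [1 / log n], split evenly between the probability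
   and the square of the relative error. *)
apply: (@whp_deviation (fun n g => (npaths2 g)%:R) (fun n => c * (n%:R * ln n%:R))
   (fun n => (ln n%:R) `^ (- 4^-1)) (fun n => (ln n%:R) `^ (- 2^-1))).
- apply/nearP_oo; exists (maxn N0 1) => n; rewrite geq_max => /andP[/ln1 l1 n1].
  have n0R : 0 < n%:R :> R by rewrite ltr0n.
  have l0 : 0 < ln (n%:R : R) by exact: lt_le_trans l1.
  by rewrite !mulr_gt0 // powR_gt0.
- by apply: cvg_ln_powRN; rewrite invr_gt0.
move=> k kN1.
have hb : \forall n \near \oo, `|c * (n%:R * ln n%:R)| <= c * n%:R `^ (1 + gp / 4) /\
     `|c * (n.+1%:R * ln n.+1%:R) - (1 + 2 * A / n%:R) * (c * (n%:R * ln n%:R)) - c|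
        <= c * n%:R `^ (- gp).
  have /nearP_oo[N2 hN2] := near_ln_le_powR 1 gp4.
  apply/nearP_oo; exists (maxn (maxn N0 N2) 1) => n; rewrite !geq_max => /andP[/andP[/ln1 l1 n2] n1].
  have n0R : 0 < n%:R :> R by rewrite ltr0n.
  have l0 : 0 < ln (n%:R : R) by exact: lt_le_trans l1.
  split.
    rewrite ger0_norm; last by rewrite !mulr_ge0 // ltW.
    by rewrite ler_pM2l // powR1D // ler_pM2l //; have := hN2 n n2; rewrite mul1r.
  rewrite A2; have /andP[d0 d1] := ln_succ_bounds R n1.
  set dl := ln n.+1%:R - ln n%:R in d0 d1.
  rewrite [X in `|X|](_ : _ = c * (n.+1%:R * dl - 1)); last first.
    by rewrite /dl -natr1; field; rewrite gt_eqF.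
  have n1R : 0 < n.+1%:R :> R by rewrite ltr0n.
  have e0 : 0 <= n.+1%:R * dl - 1 by rewrite subr_ge0 -ler_pdivrMl // mulr1.
  have e1 : n.+1%:R * dl - 1 <= n%:R^-1.
    rewrite lerBlDr; apply: (@le_trans _ _ (n.+1%:R * n%:R^-1)); first by rewrite ler_pM2l.
    by rewrite -natr1 mulrDl divff ?gt_eqF // mul1r addrC.
  rewrite ger0_norm; last by rewrite mulr_ge0 // ltW.
  rewrite ler_pM2l // (le_trans e1) // -[n%:R^-1]powR_inv1 // ler_powR ?ler1n //; lra.
have [W W0 /nearP_oo[N2 hN2]] :=
  trunc_npaths2_dev m_gt0 n0_gt0 AB A01 A_lt1 hG C_gt0 N1_ge N1_large law kN1 (ltW c0) hb.
pose Z n := TE k (fun g : 'M[nat]_n => ((npaths2 g)%:R - c * (n%:R * ln n%:R)) ^+ 2).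
pose v n : R := n%:R ^+ 2 * ln n%:R.
have [M M0 /nearP_oo[N hM]] : exists2 M : R, 0 <= M & \forall n \near \oo, Z n <= M * v n.
  apply: (@comparison R Z v (fun n => 1 + (4 * A + W * n%:R `^ (- (gp / 2))) / n%:R)
     (fun n => W * n%:R `^ (1 - gp / 2))).
  have half0 : (0 : R) < 2^-1 by rewrite invr_gt0.
  have /nearP_oo[N3 hN3] := near_powRN_le W gp4 half0.
  have /nearP_oo[N4 hN4] := near_ln_le_powR 1 gp4.
  apply/nearP_oo; exists (maxn (maxn (maxn N0 N2) (maxn N3 N4)) 1) => n.
  rewrite !geq_max => /andP[/andP[/andP[/ln1 l1 n2] /andP[n3 n4]] n1].
  have n0R : 0 < n%:R :> R by rewrite ltr0n.
  have l0 : 0 < ln (n%:R : R) by exact: lt_le_trans l1.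
  have A0 : 4 * A = 2 by lra.
  rewrite A0; split.
  - by rewrite addr_ge0 // divr_ge0 ?addr_ge0 ?mulr_ge0 ?powR_ge0 // ltW.
  - by rewrite mulr_gt0 // exprn_gt0.
  - by rewrite mulr_ge0 // powR_ge0.
  - by have := hN2 n n2; rewrite A0.
  have hq := hN3 n n3; have hl := hN4 n n4; rewrite mul1r in hl.
  cbv beta; rewrite powR1D //; set q := n%:R `^ (- (gp / 2)).
  set t := n%:R `^ (- (gp / 4)) in hq.
  have t0 : 0 <= t by exact: powR_ge0.
  have qt : q = t * t.
    rewrite /t -powRD ?pnatr_eq0 -?lt0n ?n1 ?implybT //; congr (_ `^ _); lra.
  have tl : t * ln n%:R <= 1.
    by rewrite /t powRN mulrC ler_pdivrMr ?powR_gt0 // mul1r.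
  have Wql : W * q * ln n%:R <= 2^-1.
    rewrite qt (_ : W * (t * t) * ln n%:R = (W * t) * (t * ln n%:R)); last by ring.
    by apply: (le_trans _ hq); rewrite -[leRHS]mulr1 ler_wpM2l // mulr_ge0.
  have Wq : W * q <= 2^-1.
    by apply: (le_trans _ Wql); rewrite ler_peMr // mulr_ge0 // powR_ge0.
  have /andP[d0 _] := ln_succ_bounds R n1.
  have h1 : ln n%:R + n.+1%:R^-1 <= ln (n.+1%:R : R) by rewrite addrC -lerBrDr.
  have n1R : 0 < n.+1%:R :> R by rewrite ltr0n.
  (* [v (n+1)] exceeds [(1 + 2 / n) v n] by at least [n]; the perturbation of the rate and the noise
     use at most [n / 2] each. *)
  have := ler_wpM2l (exprn_ge0 2 (ltW n1R)) h1.
  have -> : n.+1%:R ^+ 2 * (ln n%:R + n.+1%:R^-1) =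
     n%:R ^+ 2 * ln n%:R + 2 * n%:R * ln n%:R + ln n%:R + n%:R + 1 :> R.
    by rewrite -natr1; field; rewrite natr1 gt_eqF.
  have -> : (1 + (2 + W * q) / n%:R) * v n + W * (n%:R * q) =
     n%:R ^+ 2 * ln n%:R + 2 * n%:R * ln n%:R + n%:R * (W * q * ln n%:R) + n%:R * (W * q).
    by rewrite /v; field; rewrite gt_eqF.
  have := ler_wpM2l (ltW n0R) Wql; have := ler_wpM2l (ltW n0R) Wq.
  rewrite /v => a1 a2 a3; apply: le_trans a3; lra.
exists (M / c ^+ 2); apply/nearP_oo; exists (maxn (maxn N N0) 1) => n.
rewrite !geq_max => /andP[/andP[n1 /ln1 l1] n2].
have n0R : 0 < n%:R :> R by rewrite ltr0n.
have l0 : 0 < ln (n%:R : R) by exact: lt_le_trans l1.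
apply: (le_trans (hM n n1)); rewrite le_eqVlt; apply/orP; left; apply/eqP.
rewrite /v; set l := ln n%:R in l0 *.
have e1 : (l `^ (- 4^-1)) ^+ 2 = l `^ (- 2^-1).
  by rewrite -powR_mulrn ?powR_ge0 // -powRrM; congr (_ `^ _); lra.
have e2 : l `^ (- 2^-1) * l `^ (- 2^-1) = l^-1.
  have ln0 : l != 0 by rewrite gt_eqF.
  rewrite -powRD ?ln0 ?implybT // (_ : - 2^-1 + - 2^-1 = -1); last by lra.
  by rewrite powR_inv1 // ltW.
transitivity (M / c ^+ 2 * ((l `^ (- 2^-1) * l `^ (- 2^-1)) * (c * (n%:R * l)) ^+ 2)).
  by rewrite e2; field; rewrite !gt_eqF.
by rewrite -e1; ring.
Qed.

(** Markov's inequality: [e / 4] absorbs the error of the drift, [e / 2] is the exponent allowed to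
    the mean, and [e] that of the threshold. *)
Lemma whp_npaths2_upper (e : R) : 1 < 2 * A -> 0 < e ->
  whp P (fun n => [set w | (npaths2 (G n w))%:R <= (n%:R : R) `^ (2 * A + e)]).
Proof.
move=> A2 e0; have /andP[g0 g1] := gp_bounds.
have e20 : 0 < e / 2 by rewrite divr_gt0.
have [W W0 hW] := tame_npaths2 m_gt0 n0_gt0 AB A01 A_lt1 hG C_gt0 N1_ge N1_large law.
apply: (of_trunc (S := fun n g => (npaths2 g)%:R <= (n%:R : R) `^ (2 * A + e))
  (F := fun n g => (n%:R `^ (2 * A + e))^-1 * (npaths2 g)%:R) _ (cvg_powRN e20)); last first.
  apply/nearP_oo; exists 1%N => n n1 g pg.
  have p0 : 0 < (n%:R : R) `^ (2 * A + e) by rewrite powR_gt0 // ltr0n.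
  split; first by rewrite mulr_ge0 // invr_ge0 ltW.
  by rewrite -ltNge => h; rewrite mulrC ler_pdivlMr // mul1r ltW.
move=> k kN1.
pose Z n := TE k (fun g : 'M[nat]_n => (npaths2 g)%:R).
have [M M0 /nearP_oo[N hM]] : exists2 M : R, 0 <= M &
    \forall n \near \oo, Z n <= M * n%:R `^ (2 * A + e / 2).
  apply: (@powR_comparison R Z (2 * A + e / 4) (2 * A + e / 2) (`|c| + W)); first by lra.
  have e40 : 0 < e / 4 by rewrite divr_gt0.
  have /nearP_oo[N hN] := near_powRN_le W g0 e40.
  apply/nearP_oo; exists (maxn N k) => n; rewrite geq_max => /andP[n1 kn].
  have nn := leq_trans kN1 kn.
  have [n0n n_gt0 _] := N1n n0_gt0 A_lt1 N1_ge N1_large nn.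
  have n0R : 0 < n%:R :> R by rewrite ltr0n.
  set q := n%:R `^ (- gp) in hN *.
  have q0 : 0 <= n%:R `^ (- gp) :> R by exact: powR_ge0.
  have q1 : n%:R `^ (- gp) <= 1 :> R.
    by rewrite -[leRHS](powRr0 (n%:R : R)) ler_powR ?ler1n //; lra.
  apply: (@le_trans _ _ (TE k (fun g : 'M[nat]_n =>
     (1 + (2 * A + e / 4) / n%:R) * (npaths2 g)%:R + (`|c| + W)))).
    apply: (trunc_expect_step hG) => // g pg ag.
    have [h _] := hW k n g nn kn pg ag; rewrite -/c -/gp in h.
    set p := (npaths2 g)%:R in h *; have p0 : 0 <= p by exact: ler0n.
    move: h; rewrite ler_norml => /andP[_ h].
    have h1 := hN n n1.
    have h2 : (W * n%:R `^ (- gp)) / n%:R * p <= e / 4 / n%:R * p.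
      by rewrite ler_wpM2r // ler_pM2r // invr_gt0.
    have h3 : W * n%:R `^ (- gp) <= W by rewrite ler_piMr.
    have h4 : W * (n%:R `^ (- gp) / n%:R * (p + n%:R)) =
        (W * n%:R `^ (- gp)) / n%:R * p + W * n%:R `^ (- gp).
      by field; rewrite gt_eqF.
    have h5 := ler_norm c.
    rewrite h4 in h; lra.
  rewrite (trunc_expectD P m n0 G (tame m A B C) k
    (fun g : 'M[nat]_n => (1 + (2 * A + e / 4) / n%:R) * (npaths2 g)%:R)) trunc_expectZ.
  rewrite lerD2l (le_trans (trunc_expect_cst P hG _ _ n0n _)) ?addr_ge0 //.
  rewrite ler_peMr ?addr_ge0 // -[X in X <= _](powRr0 (n%:R : R)) ler_powR ?ler1n //; lra.
exists M; apply/nearP_oo; exists (maxn N 1) => n; rewrite geq_max => /andP[n1 n2].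
have n0n : (n%:R : R) != 0 by rewrite pnatr_eq0 -lt0n.
have p0 : 0 < (n%:R : R) `^ (2 * A + e) by rewrite powR_gt0 // ltr0n.
rewrite trunc_expectZ mulrC ler_pdivrMr // -mulrA -powRD ?n0n ?implybT //.
by rewrite (_ : - (e / 2) + (2 * A + e) = 2 * A + e / 2); [exact: hM|lra].
Qed.

(** Here [c] may have either sign. The value [(2 m^2 - m) n] of [P_2] for equal degrees exceeds
    [c n / (1 - 2 A)] by exactly the left-hand side, so the difference can safely be inverted. *)
Lemma npaths2_excess_ge K n (g : 'M[nat]_n) : 1 < 2 * A -> (0 < n)%N -> valid m K g ->
  (m%:R ^+ 2 + m%:R) / (2 * (2 * A - 1)) * n%:R <= (npaths2 g)%:R - c / (1 - 2 * A) * n%:R.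
Proof.
move=> A2 n_gt0 gv; have n0R : 0 < n%:R :> R by rewrite ltr0n.
have h := npaths2_ge R gv.
have h1 : 2 * m%:R ^+ 2 * n%:R - m%:R * n%:R <= (npaths2 g)%:R :> R.
  rewrite -(ler_pM2l n0R) mulrBr lerBlDr -mulrDr; apply: le_trans h.
  by rewrite le_eqVlt; apply/orP; left; apply/eqP; ring.
have BE : B = m%:R - 2 * m%:R * A by apply/eqP; rewrite eq_sym subr_eq addrC AB.
rewrite lerBrDr; apply: le_trans h1; rewrite le_eqVlt; apply/orP; left; apply/eqP.
rewrite /c BE; field; apply/andP; split; apply/eqP; lra.
Qed.

(* With b = c / (1 - 2 A), the drift of P_2 - b n is 2 A / n times P_2 - b n: the
   first moment of its inverse thus gives a lower bound on P_2 without any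
   control on the limit of P_2 / n^(2 A). *)
Lemma trunc_inverse_excess (e : R) k : 1 < 2 * A -> 0 < e -> (N1 <= k)%N ->
  exists2 M : R, 0 <= M & \forall n \near \oo,
    TE k (fun g : 'M[nat]_n => ((npaths2 g)%:R - c / (1 - 2 * A) * n%:R)^-1)
    <= M * n%:R `^ (- (2 * A) + e).
Proof.
move=> A2 e0 kN1; have /andP[g0 g1] := gp_bounds; have /andP[A0 A1] := A01.
have [W W0 hW] := tame_npaths2 m_gt0 n0_gt0 AB A01 A_lt1 hG C_gt0 N1_ge N1_large law.
rewrite -/c -/gp in hW.
pose be := c / (1 - 2 * A).
have bec : be * (1 - 2 * A) = c by rewrite /be divfK // lt_eqF // subr_lt0.
pose de : R := (m%:R ^+ 2 + m%:R) / (2 * (2 * A - 1)).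
have de0 : 0 < de.
  apply: divr_gt0; last by lra.
  by rewrite addr_gt0 ?exprn_gt0 ?ltr0n.
(* Since [n <= S / de], errors measured by [P_2 + n] become multiples of [S]. *)
pose ka := 1 + (`|be| + 1) / de.
have ka0 : 0 < ka by rewrite ltr_pwDl // divr_ge0 ?addr_ge0 // ltW.
(* Three relative errors: that of the drift, then the constant part and the part proportional to [S]
   of the second moment. *)
pose V := W * ka + (2 * W + 2 * be ^+ 2) / de ^+ 2 + 2 * (W * ka) / de.
have e20 : 0 < e / 2 by lra.
apply: (@powR_comparison R
  (fun n => TE k (fun g : 'M[nat]_n => ((npaths2 g)%:R - be * n%:R)^-1))
  (- (2 * A) + e / 2) _ 0); first by lra.
have /nearP_oo[N hN] := near_powRN_le V g0 e20.
apply/nearP_oo; exists (maxn N k) => n; rewrite geq_max => /andP[n1 kn].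
have nn := leq_trans kN1 kn.
have [n0n n_gt0 _] := N1n n0_gt0 A_lt1 N1_ge N1_large nn.
have n0R : 0 < n%:R :> R by rewrite ltr0n.
rewrite mul0r addr0 -trunc_expectZ.
have pos j (h : 'M[nat]_j) : (0 < j)%N -> valid m (n0 * (m * n0) + m) h ->
    de * j%:R <= (npaths2 h)%:R - be * j%:R.
  exact: npaths2_excess_ge.
have vstep (g : 'M[nat]_n) (h : 'M[nat]_n.+1) : possible P G g -> growth_step m g h ->
    valid m (n0 * (m * n0) + m) h.
  move=> pg gh; apply: (valid_growth_step gh (leq_addl _ _)).
  exact: (possible_valid hG n0n pg).
apply: (trunc_expect_step hG) => // [g pg h gh|g pg ag].
  rewrite invr_ge0; apply: le_trans (pos _ _ _ (vstep g h pg gh)) => //.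
  by rewrite mulr_ge0 // ltW.
have lw := law nn pg; have gv := possible_valid hG n0n pg.
have [hp1 hp2] := hW k n g nn kn pg ag.
have hS := pos _ g n_gt0 gv.
set p : R := (npaths2 g)%:R in hp1 hp2 hS *; set S := p - be * n%:R in hS *.
set q := n%:R `^ (- gp) in hp1 hp2.
have q0 : 0 <= q by exact: powR_ge0.
have dn0 : 0 < de * n%:R by rewrite mulr_gt0.
have S0 : 0 < S by exact: lt_le_trans hS.
pose X (h : 'M[nat]_n.+1) : R := (npaths2 h)%:R - p.
have pS : p + n%:R <= ka * S.
  have h1 : n%:R <= S / de by rewrite ler_pdivlMr // mulrC.
  have -> : p + n%:R = S + (be + 1) * n%:R by rewrite /S; ring.
  rewrite /ka [leRHS]mulrDl mul1r lerD2l; apply: (@le_trans _ _ ((`|be| + 1) * n%:R)).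
    by rewrite ler_wpM2r // lerD2r ler_norm.
  by rewrite -mulrA [de^-1 * S]mulrC ler_wpM2l // addr_ge0.
apply: (@le_trans _ _ (CE g (fun h => (S^-1 + (S ^- 2 * be + 2 * be ^+ 2 / (S ^+ 2 * (de * n%:R))))
   + (- S ^- 2 * X h + 2 / (S ^+ 2 * (de * n%:R)) * X h ^+ 2)))).
  apply: (step_le lw) => h gh.
  have hS' := pos _ h (ltn0Sn n) (vstep g h pg gh).
  have eS : (npaths2 h)%:R - be * n.+1%:R = S + (X h - be) by rewrite /S /X -natr1; ring.
  rewrite eS in hS' *.
  set y := X h - be in hS' *.
  have Sy : de * n%:R <= S + y.
    by apply: le_trans hS'; rewrite ler_pM2l // ler_nat.
  have Sy0 : 0 < S + y by exact: lt_le_trans Sy.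
  (* Exact second-order expansion of the inverse; the last factor is at most [1 / (de n)]. The
     first-order term is negative in [y], so a lower bound on the drift suffices. *)
  have h1 : (S + y)^-1 = S^-1 - y * S ^- 2 + y ^+ 2 * (S ^- 2 * (S + y)^-1).
    by field; rewrite !gt_eqF.
  have h2 : y ^+ 2 * (S ^- 2 * (S + y)^-1) <= y ^+ 2 * (S ^- 2 * (de * n%:R)^-1).
    rewrite ler_wpM2l ?sqr_ge0 // ler_wpM2l ?invr_ge0 ?exprn_ge0 ?(ltW S0) //.
    by rewrite lef_pV2 ?posrE.
  have h3 : y ^+ 2 <= 2 * X h ^+ 2 + 2 * be ^+ 2.
    have := sqr_ge0 (X h + be); rewrite /y !expr2; lra.
  have c0 : 0 <= S ^- 2 * (de * n%:R)^-1.
    by apply: mulr_ge0; rewrite invr_ge0 ?exprn_ge0 // ltW.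
  have h4 := ler_wpM2r c0 h3.
  have h5 : y * S ^- 2 = X h * S ^- 2 - be * S ^- 2 by rewrite /y; ring.
  by rewrite h1 h5 [(S ^+ 2 * _)^-1]invfM; lra.
rewrite (stepD lw) (step_cst lw) (stepD lw) !(stepZ lw).
have EX : CE g X = CE g (fun h => (npaths2 h)%:R) - p by rewrite (stepB lw) (step_cst lw).
have hX2 : CE g (fun h => X h ^+ 2) <= W * (1 + q * (p + n%:R)) by exact: hp2.
have hX1 : 2 * A / n%:R * S + be - W * ka * q / n%:R * S <= CE g X.
  move: hp1; rewrite ler_norml => /andP[h _].
  have h1 : W * (q / n%:R * (p + n%:R)) <= W * ka * q / n%:R * S.
    have -> : W * ka * q / n%:R * S = W * (q / n%:R * (ka * S)) by ring.
    by rewrite ler_wpM2l // ler_wpM2l // divr_ge0 // ltW.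
  have h2 : (1 + 2 * A / n%:R) * p + c = p + 2 * A / n%:R * S + be.
    by rewrite -bec /S; field; rewrite gt_eqF.
  rewrite EX; rewrite h2 in h; lra.
have S20 : 0 < S ^- 2 by rewrite invr_gt0 exprn_gt0.
have k1 := ler_wpM2l (ltW S20) hX1.
have c0 : 0 <= 2 / (S ^+ 2 * (de * n%:R)).
  by rewrite divr_ge0 // mulr_ge0 ?exprn_ge0 // ltW.
have k2 := ler_wpM2l c0 hX2.
have k3 : 2 / (S ^+ 2 * (de * n%:R)) * (W * (1 + q * (p + n%:R))) <=
   2 / (S ^+ 2 * (de * n%:R)) * (W * (1 + q * (ka * S))).
  by rewrite ler_wpM2l // ler_wpM2l // lerD2l ler_wpM2l.
have nq : n%:R^-1 <= q.
  by rewrite /q -[n%:R^-1]powR_inv1 // ler_powR ?ler1n //; lra.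
have k4 : (2 * W + 2 * be ^+ 2) / (S ^+ 2 * (de * n%:R)) <=
   (2 * W + 2 * be ^+ 2) / de ^+ 2 * q / n%:R * S^-1.
  have w0 : 0 <= 2 * W + 2 * be ^+ 2 by have := sqr_ge0 be; lra.
  have -> : (2 * W + 2 * be ^+ 2) / (S ^+ 2 * (de * n%:R)) =
     (2 * W + 2 * be ^+ 2) * (S^-1 * (de^-1 * n%:R^-1)) * S^-1 by field; rewrite !gt_eqF.
  rewrite ler_pM2r ?invr_gt0 //.
  have -> : (2 * W + 2 * be ^+ 2) / de ^+ 2 * q / n%:R =
     (2 * W + 2 * be ^+ 2) * ((q / de) * (de^-1 * n%:R^-1)) by field; rewrite !gt_eqF.
  rewrite ler_wpM2l // ler_wpM2r ?mulr_ge0 ?invr_ge0 ?(ltW de0) //.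
  apply: (@le_trans _ _ (de * n%:R)^-1); first by rewrite lef_pV2 ?posrE.
  by rewrite invfM mulrC ler_pM2r ?invr_gt0.
have hV := hN n n1; rewrite -/q in hV.
have k5 : V * q / n%:R * S^-1 <= e / 2 / n%:R * S^-1.
  by rewrite ler_pM2r ?invr_gt0 // ler_pM2r ?invr_gt0.
have e1 : S ^- 2 * (2 * A / n%:R * S + be - W * ka * q / n%:R * S) =
   2 * A / n%:R * S^-1 + S ^- 2 * be - W * ka * q / n%:R * S^-1 by field; rewrite !gt_eqF.
have e2 : 2 / (S ^+ 2 * (de * n%:R)) * (W * (1 + q * (ka * S))) + 2 * be ^+ 2 / (S ^+ 2 * (de * n%:R))
   = (2 * W + 2 * be ^+ 2) / (S ^+ 2 * (de * n%:R)) + 2 * (W * ka) / de * q / n%:R * S^-1.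
  by field; rewrite !gt_eqF.
have e3 : V * q / n%:R * S^-1 = W * ka * q / n%:R * S^-1
   + (2 * W + 2 * be ^+ 2) / de ^+ 2 * q / n%:R * S^-1 + 2 * (W * ka) / de * q / n%:R * S^-1.
  by rewrite /V; ring.
rewrite e1 in k1; rewrite e3 in k5.
have -> : (1 + (- (2 * A) + e / 2) / n%:R) * S^-1 =
   S^-1 - 2 * A / n%:R * S^-1 + e / 2 / n%:R * S^-1 by ring.
lra.
Qed.

(** The condition [e <= 2 A - 1] gives [n <= n^(2 A - e)]. A value of [P_2] below [n^(2 A - e)] thus
    keeps [P_2 - be n] below [(1 + |be|) n^(2 A - e)], which Markov's inequality for the inverse
    makes unlikely. *)
Lemma whp_npaths2_lower (e : R) : 1 < 2 * A -> 0 < e -> e <= 2 * A - 1 ->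
  whp P (fun n => [set w | (n%:R : R) `^ (2 * A - e) <= (npaths2 (G n w))%:R]).
Proof.
move=> A2 e0 eA; have e20 : 0 < e / 2 by rewrite divr_gt0.
pose be := c / (1 - 2 * A).
pose F n (g : 'M[nat]_n) :=
  ((1 + `|be|) * n%:R `^ (2 * A - e)) * ((npaths2 g)%:R - be * n%:R)^-1.
apply: (of_trunc (S := fun n g => (n%:R : R) `^ (2 * A - e) <= (npaths2 g)%:R) (F := F)
  _ (cvg_powRN e20)); last first.
  apply/nearP_oo; exists N1 => n nn g pg.
  have [n0n n_gt0 _] := N1n n0_gt0 A_lt1 N1_ge N1_large nn.
  have n0R : 0 < n%:R :> R by rewrite ltr0n.
  have S0 : 0 < (npaths2 g)%:R - be * n%:R.
    apply: lt_le_trans (npaths2_excess_ge A2 n_gt0 (possible_valid hG n0n pg)).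
    rewrite mulr_gt0 // divr_gt0 ?addr_gt0 ?exprn_gt0 ?ltr0n //; lra.
  split; first by rewrite !mulr_ge0 ?addr_ge0 ?powR_ge0 ?invr_ge0 // ltW.
  rewrite -ltNge => h; rewrite ler_pdivlMr // mul1r mulrDl mul1r.
  apply: lerD; first exact: ltW.
  rewrite -mulNr; apply: (@le_trans _ _ (`|be| * n%:R)).
    by rewrite ler_wpM2r // -normrN ler_norm.
  rewrite ler_wpM2l // -[X in X <= _]powRr1 // ler_powR ?ler1n //; lra.
move=> k kN1; have [M M0 /nearP_oo[N hM]] := trunc_inverse_excess A2 e20 kN1.
exists ((1 + `|be|) * M); apply/nearP_oo; exists (maxn N 1) => n; rewrite geq_max => /andP[n1 n2].
have n0n : (n%:R : R) != 0 by rewrite pnatr_eq0 -lt0n.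
rewrite trunc_expectZ.
apply: (@le_trans _ _ ((1 + `|be|) * n%:R `^ (2 * A - e) * (M * n%:R `^ (- (2 * A) + e / 2)))).
  by rewrite ler_wpM2l ?hM // mulr_ge0 ?powR_ge0 ?addr_ge0.
rewrite mulrACA -powRD ?n0n ?implybT //.
by rewrite (_ : 2 * A - e + (- (2 * A) + e / 2) = - (e / 2)) //; lra.
Qed.

End Asymptotics.

(** * From the two counts to the clustering coefficient *)

Lemma whp_equiv_clustering (d : measure_display) (T : measurableType d) (R : realType)
    (P : probability T R) (m n0 : nat) (G : forall n : nat, T -> 'M[nat]_n)
    (x y f1 f2 b : nat -> R) : growth_process G m n0 ->
  (\forall n \near \oo, [/\ 0 < x n, 0 < y n & b n = 3 * x n / y n]) ->
  f1 n @[n --> \oo] --> 0 -> f2 n @[n --> \oo] --> 0 ->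
  whp P (fun n => [set w | `|(ntriangles (G n w))%:R - x n| <= f1 n * x n]) ->
  whp P (fun n => [set w | `|(npaths2 (G n w))%:R - y n| <= f2 n * y n]) ->
  whp_equiv P (fun n w => global_clustering R (G n w)) b.
Proof.
move=> hG /nearP_oo[N hN] f10 f20 hT hP.
exists (fun n => 2 * (f1 n + f2 n)).
  rewrite -[X in _ --> X](mulr0 (2 : R)); apply: cvgMr.
  by rewrite -[X in _ --> X](addr0 (0 : R)); exact: cvgD.
apply: (whp_combine hG
  (S1 := fun n g => `|(ntriangles g)%:R - x n| <= f1 n * x n)
  (S2 := fun n g => `|(npaths2 g)%:R - y n| <= f2 n * y n)
  (S := fun n g => `|global_clustering R g - b n| <= 2 * (f1 n + f2 n) * b n) _ hT hP).
have half0 : (0 : R) < 2^-1 by rewrite invr_gt0.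
have /cvgrPdist_le/(_ _ half0)/nearP_oo[N2 hN2] := f20.
apply/nearP_oo; exists (maxn N N2) => n; rewrite geq_max => /andP[n1 n2] g _ gT gP.
have [x0 y0 ->] := hN n n1; apply: (ratio_bound x0 y0 gT gP).
by have := hN2 n n2; rewrite sub0r normrN => /(le_trans (ler_norm _)).
Qed.

Unset Implicit Arguments.
Set Strict Implicit.

(* The third case is restricted to A < 1: for A = 1 it fails.  Take m = 2,
   n0 = 2, two vertices carrying two self-loops each, and join every new vertex
   to both of them.  The process is in the PA-class with A = 1 and B = -2, it
   satisfies the joint increment condition for every D > 0, and it contains no
   triangle. *)
Theorem theorem6 (d : measure_display) (T : measurableType d) (R : realType)
  (P : probability T R) (m n0 : nat) (A B D : R)
  (G : forall n : nat, T -> 'M[nat]_n)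
  (m_ge1 : (1 <= m)%N) (n0_ge1 : (1 <= n0)%N)
  (hAB : 2 * m%:R * A + B = m%:R) (hA : 0 <= A <= 1)
  (hG : growth_process G m n0) (hPA : PA_class P G m A B)
  (D_gt0 : 0 < D) (hD : joint_increment P G m D) :
  let C1 := fun n w => global_clustering R (G n w) in
  let c := 2 * m%:R * (A + B) + m%:R * (m%:R - 1) / 2 in
  [/\ 2 * A < 1 ->
        whp_equiv P C1 (fun=> 3 * (1 - 2 * A) * D / c),
      2 * A = 1 ->
        whp_equiv P C1 (fun n => 3 * D / (c * ln n%:R)) &
      1 < 2 * A -> A < 1 -> forall eps : R, 0 < eps ->
        whp P (fun n => [set w |
          n%:R `^ (1 - 2 * A - eps) <= C1 n w <= n%:R `^ (1 - 2 * A + eps)])].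
Proof.
move=> C1 c; have /andP[A0 A1] := hA.
have [C C0 /nearP_oo[N0 law0]] := process_step_law hG hPA hD.
have setup : A < 1 -> exists N1, [/\ (n0 <= N1)%N, 2 <= N1%:R * (1 - A) &
    forall n (g : 'M[nat]_n), (N1 <= n)%N -> possible P G g ->
      step_law m A B C D g (@cexpect _ _ _ P m n0 G n g)].
  move=> Alt1; have /nearP_oo[N2 hN2] := near_natr_ge (2 / (1 - A)).
  exists (maxn n0 (maxn N0 N2)); split; first exact: leq_maxl.
    by rewrite -ler_pdivrMr ?subr_gt0 //; apply: hN2; rewrite !leq_max leqnn !orbT.
  by move=> n g; rewrite !geq_max => /and3P[_ n1 _]; exact: law0.
have m0R : 1 <= m%:R :> R by rewrite ler1n.
(* [A + B = m - (2 m - 1) A] is at least 1/2 when [A <= 1/2]. *)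
have c_gt0 : 2 * A <= 1 -> 0 < c.
  move=> A2; rewrite /c.
  have h1 : 0 <= m%:R * (m%:R - 1) / 2 :> R by rewrite divr_ge0 // mulr_ge0 // subr_ge0.
  have h2 : 0 < A + B.
    have : (2 * m%:R - 1) * A <= (2 * m%:R - 1) * 2^-1.
      by apply: ler_wpM2l; lra.
    lra.
  by rewrite ltr_pwDl // !mulr_gt0 // ltr0n.
have g0 : A < 1 -> 0 < gap A / 4 by move=> Alt1; rewrite /gap; lra.
split.
- move=> A2; have Alt1 : A < 1 by lra.
  have [N1 [N1_ge N1_large law]] := setup Alt1.
  have c0 : 0 < c by apply: c_gt0; lra.
  have [f f0 hP] := whp_npaths2_sublinear m_ge1 n0_ge1 hAB hA Alt1 hG C0 N1_ge N1_large law A2 c0.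
  have hT := whp_ntriangles m_ge1 n0_ge1 hAB hA Alt1 D_gt0 hG C0 N1_ge N1_large law.
  apply: (whp_equiv_clustering hG _ (cvg_powRN (g0 Alt1)) f0 hT hP).
  apply/nearP_oo; exists 1%N => n n_gt0; have n0R : 0 < n%:R :> R by rewrite ltr0n.
  have A2' : 0 < 1 - 2 * A by lra.
  rewrite -/c; split; [by rewrite mulr_gt0|by rewrite mulr_gt0 // divr_gt0|].
  by field; rewrite !gt_eqF.
- move=> A2; have Alt1 : A < 1 by lra.
  have [N1 [N1_ge N1_large law]] := setup Alt1.
  have c0 : 0 < c by apply: c_gt0; lra.
  have hP := whp_npaths2_critical m_ge1 n0_ge1 hAB hA Alt1 hG C0 N1_ge N1_large law A2 c0.
  have hT := whp_ntriangles m_ge1 n0_ge1 hAB hA Alt1 D_gt0 hG C0 N1_ge N1_large law.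
  have q0 : (0 : R) < 4^-1 by rewrite invr_gt0.
  apply: (whp_equiv_clustering hG _ (cvg_powRN (g0 Alt1)) (cvg_ln_powRN q0) hT hP).
  have /nearP_oo[N2 hN2] := near_ln_ge (1 : R).
  apply/nearP_oo; exists (maxn 1 N2) => n; rewrite geq_max => /andP[n_gt0 n2].
  have n0R : 0 < n%:R :> R by rewrite ltr0n.
  have l0 : 0 < ln (n%:R : R) by exact: lt_le_trans (hN2 n n2).
  rewrite -/c; split; [by rewrite mulr_gt0|by rewrite !mulr_gt0|].
  by field; rewrite !gt_eqF.
move=> A2 Alt1 eps eps0.
have [N1 [N1_ge N1_large law]] := setup Alt1.
(* The lower bound on [P_2] requires [e <= 2 A - 1]; with [e <= eps / 2] a factor [n^(eps / 2)]
   remains to absorb constants. *)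
pose e := Num.min (eps / 2) (2 * A - 1).
have e0 : 0 < e by rewrite lt_min; apply/andP; split; lra.
have e1 : e <= eps / 2 by rewrite ge_min lexx.
have e2 : e <= 2 * A - 1 by rewrite ge_min lexx orbT.
have hT := whp_ntriangles m_ge1 n0_ge1 hAB hA Alt1 D_gt0 hG C0 N1_ge N1_large law.
have hL := whp_npaths2_lower m_ge1 n0_ge1 hAB hA Alt1 hG C0 N1_ge N1_large law A2 e0 e2.
have hU := whp_npaths2_upper m_ge1 n0_ge1 hAB hA Alt1 hG C0 N1_ge N1_large law A2 e0.
(* The upper bound on [C1] uses this deterministic bound on triangles, the lower bound their
   concentration around [D n]. *)
have [V V0 hV] := ntriangles_linear P n0_ge1 hG.
have e20 : 0 < eps / 2 by rewrite divr_gt0.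
have hTL : whp P (fun n => [set w | (D / 2 * n%:R <= (ntriangles (G n w))%:R) &&
    (n%:R `^ (2 * A - e) <= (npaths2 (G n w))%:R :> R)]).
  apply: (whp_combine hG
    (S1 := fun n g => `|(ntriangles g)%:R - D * n%:R| <= n%:R `^ (- (gap A / 4)) * (D * n%:R))
    (S2 := fun n g => n%:R `^ (2 * A - e) <= (npaths2 g)%:R :> R)
    (S := fun n g => (D / 2 * n%:R <= (ntriangles g)%:R) &&
    (n%:R `^ (2 * A - e) <= (npaths2 g)%:R :> R)) _ hT hL).
  have half0 : (0 : R) < 2^-1 by rewrite invr_gt0.
  have /nearP_oo[N hN] := near_powRN_le 1 (g0 Alt1) half0.
  apply/nearP_oo; exists N => n Nn g _ /= hTn ->; rewrite andbT.
  have Dn : 0 <= D * n%:R by rewrite mulr_ge0 // ltW.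
  have := ler_wpM2r Dn (hN n Nn); rewrite mul1r => h.
  by move: (le_trans hTn h); rewrite ler_norml => /andP[h1 _]; lra.
apply: (whp_combine hG
  (S1 := fun n g => (D / 2 * n%:R <= (ntriangles g)%:R) &&
    (n%:R `^ (2 * A - e) <= (npaths2 g)%:R :> R))
  (S2 := fun n g => (npaths2 g)%:R <= n%:R `^ (2 * A + e) :> R)
  (S := fun n g =>
    n%:R `^ (1 - 2 * A - eps) <= global_clustering R g <= n%:R `^ (1 - 2 * A + eps)) _ hTL hU).
have D20 : 0 < 3 * (D / 2) by rewrite mulr_gt0 // divr_gt0.
have V1 : 0 < (3 * V + 1)^-1 by rewrite invr_gt0 ltr_wpDl // mulr_ge0.
have /nearP_oo[N2 hN2] := near_powRN_le 1 e20 D20.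
have /nearP_oo[N3 hN3] := near_powRN_le 1 e20 V1.
apply/nearP_oo; exists (maxn (maxn n0 1) (maxn N2 N3)) => n.
rewrite !geq_max => /andP[/andP[n0n n_gt0] /andP[n2 n3]] g pg /andP[t1 p1] p2.
have n0R : 0 < n%:R :> R by rewrite ltr0n.
have n1R : 1 <= n%:R :> R by rewrite ler1n.
have nn0 : (n%:R : R) != 0 by rewrite gt_eqF.
have P0 : 0 < (npaths2 g)%:R :> R by apply: lt_le_trans p1; rewrite powR_gt0.
have powE (a b : R) : (n%:R : R) `^ (a + b) = n%:R `^ a * n%:R `^ b.
  by rewrite powRD // nn0 implybT.
have t2 := hV n g n0n pg.
rewrite /global_clustering; apply/andP; split.
  rewrite ler_pdivlMr //.
  apply: (@le_trans _ _ (n%:R `^ (1 - 2 * A - eps) * n%:R `^ (2 * A + e))).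
    by rewrite ler_wpM2l // powR_ge0.
  rewrite -powE; apply: (@le_trans _ _ (n%:R `^ (1 + - (eps / 2)))).
    by rewrite ler_powR //; lra.
  rewrite powE powRr1 ?(ltW n0R) //.
  have := ler_wpM2l (ltW n0R) (hN2 n n2); rewrite mul1r; lra.
rewrite ler_pdivrMr //.
apply: (@le_trans _ _ (n%:R `^ (1 - 2 * A + eps) * n%:R `^ (2 * A - e))); last first.
  by rewrite ler_wpM2l // powR_ge0.
rewrite -powE; apply: (@le_trans _ _ (n%:R `^ (1 + eps / 2))); last first.
  by rewrite ler_powR //; lra.
rewrite powE powRr1 ?(ltW n0R) //.
have h3 : 3 * V + 1 <= n%:R `^ (eps / 2).
  have := hN3 n n3; rewrite mul1r powRN lef_pV2 ?posrE ?powR_gt0 //.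
  by rewrite ltr_wpDl // mulr_ge0.
have := ler_wpM2l (ltW n0R) h3; lra.
Qed.
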